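(* Let $k\ge0$ be an integer, $\mathbf{A}\in W^{1,\infty}(\Omega;\mathbb{R}^d)$ and $V\in L^\infty(\Omega;\mathbb{R})$. There exist constants $\alpha>0$ and $\gamma>0$, independent of $h$, such that for all $\underline{v}_h\in\underline{U}_h$, $$a_h(\underline{v}_h,\underline{v}_h;\mathbf{A})\ \ge\ \alpha\,\|\underline{v}_h\|_{1,h}^2-\gamma\left(\|\mathbf{A}\|_{L^\infty(\Omega)}^2+\|V\|_{L^\infty(\Omega)}\right)\|\underline{v}_h\|_{L^2(\Omega)}^2,$$ where $\|\underline{v}_h\|_{L^2(\Omega)}^2:=\sum_{T\in\mathcal{T}_h}\|v_T\|_T^2$.
   Context: Domain and meshes. $\Omega\subset\mathbb{R}^d$, $d\in\{2,3\}$, is a bounded Lipschitz domain. $(\mathcal{T}_h)_{h\in\mathcal{H}}$ is a sequence of polytopal tessellations of $\Omega$ indexed by a countable set $\mathcal{H}\subset(0,\infty)$ having $0$ as its only accumulation point, with $h=\max_{T\in\mathcal{T}_h}h_T$, $h_T$ the diameter of $T$. A mesh face $F$ is a hyperplanar closed connected subset of $\overline{\Omega}$ with positive $(d-1)$-dimensional Hausdorff measure such that either $F\subset\partial T_1\cap\partial T_2$ for two distinct elements, or $F\subset\partial T\cap\partial\Omega$ for some element (boundary face). $\mathcal{F}_h$ is the set of faces, $\mathcal{F}_h^b$ the set of boundary faces, $\mathcal{F}_T$ the set of faces contained in $\partial T$; $h_F$ is the diameter of $F$ and $\mathbf{n}$ the unit normal to $F\in\mathcal F_T$ pointing out of $T$.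 The sequence is admissible: there is $\varrho>0$ independent of $h$ such that every $\mathcal{T}_h$ has a matching simplicial submesh in which each simplex $S$ (diameter $h_S$, inradius $r_S$) satisfies $\varrho h_S\le r_S$, and $\varrho h_T\le h_S$ whenever $S\subset T\in\mathcal{T}_h$. Notation. $(u,v)_X=\int_X u\,\overline{v}$ (with the Hermitian product of $\mathbb{C}^d$ for vector fields), $\|\cdot\|_X$ the $L^2(X)$ norm. $\mathbb{P}^k(X;\mathbb{C})$ is the space of complex polynomials of total degree at most $k$ on $X$ ($X$ an element or a face), and $\pi_X^k$ the $L^2$-orthogonal projector onto it. Spaces. $\underline{U}_T:=\mathbb{P}^k(T;\mathbb{C})\times\prod_{F\in\mathcal{F}_T}\mathbb{P}^k(F;\mathbb{C})$, with elements $\underline{v}_T=(v_T,(v_F)_{F\in\mathcal{F}_T})$. $\underline{U}_h$ is the set of families $\underline{v}_h=(\underline{v}_T)_{T\in\mathcal{T}_h}$, $\underline{v}_T\in\underline{U}_T$, with one (single-valued) unknown $v_F$ per face and $v_F=0$ for all $F\in\mathcal{F}_h^b$. Norms: $\|\underline{v}_T\|_{1,T}^2:=\|\nabla v_T\|_T^2+\sum_{F\in\mathcal{F}_T}h_F^{-1}\|v_F-v_T\|_F^2$ and $\|\underline{v}_h\|_{1,h}^2:=\sum_{T}\|\underline{v}_T\|_{1,T}^2$. Potential reconstruction. $p_T\underline{v}_T\in\mathbb{P}^{k+1}(T;\mathbb{C})$ is defined by $(\nabla p_T\underline{v}_T,\nabla w)_T=(\nabla v_T,\nabla w)_T+\sum_{F\in\mathcal{F}_T}(v_F-v_T,\nabla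 w\cdot\mathbf{n})_F$ for all $w\in\mathbb{P}^{k+1}(T;\mathbb{C})$, and $(p_T\underline{v}_T-v_T,1)_T=0$. Stabilization. $s_T$ is a sesquilinear form on $\underline{U}_T$ that is a HHO stabilization, i.e.: (S1) $s_T$ is Hermitian positive semidefinite; (S2) there is $\eta>0$ independent of $h$ and $T$ with $\eta^{-1}\|\underline{v}_T\|_{1,T}^2\le\|\nabla p_T\underline{v}_T\|_T^2+s_T(\underline{v}_T,\underline{v}_T)\le\eta\|\underline{v}_T\|_{1,T}^2$ for all $\underline v_T\in\underline U_T$; (S3) $s_T(\underline{I}_Tw,\underline{v}_T)=0$ for all $w\in\mathbb{P}^{k+1}(T;\mathbb{C})$, $\underline{v}_T\in\underline U_T$, where $\underline{I}_Tw=(\pi_T^kw,(\pi_F^kw)_{F\in\mathcal{F}_T})$. For instance $s_T(\underline{u}_T,\underline{v}_T)=\sum_{F\in\mathcal{F}_T}h_F^{-1}\big((\delta_{TF}-\delta_T)\underline{u}_T,(\delta_{TF}-\delta_T)\underline{v}_T\big)_F$ with $\delta_T\underline{v}_T=\pi_T^k(p_T\underline{v}_T-v_T)$, $\delta_{TF}\underline{v}_T=\pi_F^k(p_T\underline{v}_T-v_F)$. Discrete covariant gradient and form. $G_T[\mathbf{A}]:\underline{U}_T\to\mathbb{P}^k(T;\mathbb{C})^d$ is defined by $(G_T[\mathbf{A}]\underline{v}_T,\boldsymbol{\tau})_T=(v_T,-i\nabla\cdot\boldsymbol{\tau}-\mathbf{A}\cdot\boldsymbol{\tau})_T-i\sum_{F\in\mathcal{F}_T}(v_F,\boldsymbol{\tau}\cdot\mathbf{n})_F$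 for all $\boldsymbol{\tau}\in\mathbb{P}^k(T;\mathbb{C})^d$. The global form is $$a_h(\underline{u}_h,\underline{v}_h;\mathbf{A})=\sum_{T\in\mathcal{T}_h}\Big\{(G_T[\mathbf{A}]\underline{u}_T,G_T[\mathbf{A}]\underline{v}_T)_T+s_T(\underline{u}_T,\underline{v}_T)+(Vu_T,v_T)_T\Big\}.$$ *)

(* Defs.v *)
From HB Require Import structures.
From mathcomp Require Import all_boot all_order all_algebra.
From mathcomp Require Import all_classical all_reals all_analysis.
From mathcomp Require Import complex.
(* mpoly's notations clash with those of mathcomp-analysis, hence the filtered
   import and the qualified names below. *)
From mathcomp Require mpoly.
Import (canonicals, coercions) mpoly.

Set Implicit Arguments.
Unset Strict Implicit.
Unset Printing Implicit Defensive.

Import Order.TTheory GRing.Theory Num.Theory numFieldNormedType.Exports.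
Local Open Scope classical_set_scope.
Local Open Scope complex_scope.
Local Open Scope ring_scope.

(* The sigma-algebra generated by the coordinates, i.e. the Borel sets of R^n. *)
Definition rV_display : measure_display.
Proof. exact: default_measure_display. Qed.

Section measurable_rV.
Context (R : realType) (n : nat).

Definition rV_coord (i : 'I_n) (x : 'rV[R]_n) : measurableTypeR R := x ord0 i.

Let rV_set0 : g_sigma_preimage rV_coord set0.
Proof. exact: sigma_algebra0. Qed.

Let rV_setC A : g_sigma_preimage rV_coord A -> g_sigma_preimage rV_coord (~` A).
Proof. exact: sigma_algebraC. Qed.

Let rV_bigcup (F : (set 'rV[R]_n)^nat) :
  (forall i, g_sigma_preimage rV_coord (F i)) ->
  g_sigma_preimage rV_coord (\bigcup_i F i).
Proof. exact: sigma_algebra_bigcup. Qed.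

HB.instance Definition _ := @isMeasurable.Build rV_display
  'rV[R]_n (g_sigma_preimage rV_coord) rV_set0 rV_setC rV_bigcup.

Lemma measurable_rV_coord (i : 'I_n) : measurable_fun setT (rV_coord i).
Proof.
move=> _ Y mY; rewrite setTI; apply: sub_sigma_algebra => /=.
rewrite -bigcup_seq/=; exists i => /=; first by rewrite mem_index_enum.
by exists Y => //; rewrite setTI.
Qed.

Lemma measurable_fun_rV d (T : measurableType d) (f : T -> 'rV[R]_n) :
  (forall i, measurable_fun setT (rV_coord i \o f)) -> measurable_fun setT f.
Proof.
move=> mf _ A mA; rewrite setTI; move: A mA.
apply: smallest_sub => /=.
  split => /=.
  - by rewrite preimage_set0.
  - by move=> B mB; rewrite setTD preimage_setC; exact: measurableC.
  - by move=> F mF; rewrite preimage_bigcup; exact: bigcup_measurable.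
rewrite -bigcup_seq => B [/= i _ [C mC <-]].
by rewrite setTI -comp_preimage -[X in measurable X]setTI; exact: mf.
Qed.

End measurable_rV.

Section lebesgue_rV_step.
Context (R : realType) (n : nat).

Definition cons_rV (p : measurableTypeR R * 'rV[R]_n) : 'rV[R]_n.+1 :=
  row_mx (const_mx p.1 : 'rV[R]_1) p.2.

Definition uncons_rV (x : 'rV[R]_n.+1) : measurableTypeR R * 'rV[R]_n :=
  (x ord0 ord0, @rsubmx R 1 1 n x).

Lemma cons_rVK : cancel cons_rV uncons_rV.
Proof.
move=> [a v]; rewrite /cons_rV/uncons_rV row_mxKr; congr pair.
have -> : (ord0 : 'I_n.+1) = lshift n (ord0 : 'I_1) by exact: val_inj.
apply: (etrans (row_mxEl (const_mx a : 'rV[R]_1) v ord0 ord0)).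
by rewrite mxE.
Qed.

Lemma measurable_cons_rV : measurable_fun setT cons_rV.
Proof.
apply: measurable_fun_rV => i; rewrite -(splitK (i : 'I_(1 + n))).
case: (fintype.split (i : 'I_(1 + n))) => j /=.
  rewrite (_ : _ \o _ = fst)//; apply/funext => p /=.
  apply: (etrans (row_mxEl (const_mx p.1 : 'rV[R]_1) p.2 ord0 j)).
  by rewrite mxE.
rewrite (_ : _ \o _ = rV_coord j \o snd); last first.
  apply/funext => p /=.
  exact: (row_mxEr (const_mx p.1 : 'rV[R]_1) p.2 ord0 j).
by apply: measurableT_comp => //; exact: measurable_rV_coord.
Qed.

Lemma measurable_uncons_rV : measurable_fun setT uncons_rV.
Proof.
apply/measurable_fun_pairP; split.
  exact: (@measurable_rV_coord R n.+1 ord0).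
apply: measurable_fun_rV => i.
rewrite (_ : _ \o _ = @rV_coord R n.+1 (rshift 1 i)).
  exact: measurable_rV_coord.
by apply/funext => x /=; rewrite /rV_coord /= mxE.
Qed.

Variable mu : {sigma_finite_measure set 'rV[R]_n -> \bar R}.
Let nu : {measure set (measurableTypeR R * 'rV[R]_n)%type -> \bar R} :=
  (@lebesgue_measure R \x mu)%E.

Definition lebesgue_step : set 'rV[R]_n.+1 -> \bar R :=
  pushforward (@lebesgue_measure R \x mu)%E cons_rV.

Let lebesgue_step0 : lebesgue_step set0 = 0%E.
Proof. by rewrite /lebesgue_step /pushforward preimage_set0 (measure0 nu). Qed.

Let lebesgue_step_ge0 A : (0 <= lebesgue_step A)%E.
Proof. exact: (measure_ge0 nu). Qed.

Let pre_cons (A : set 'rV[R]_n.+1) :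
  measurable A -> measurable (cons_rV @^-1` A).
Proof.
by move=> mA; rewrite -[X in measurable X]setTI; exact: measurable_cons_rV.
Qed.

Let lebesgue_step_sigma_additive : semi_sigma_additive lebesgue_step.
Proof.
move=> F mF tF mUF; rewrite /lebesgue_step /pushforward preimage_bigcup.
apply: (@measure_semi_sigma_additive _ _ _ nu).
- by move=> i; exact: pre_cons.
- apply/trivIsetP => /= i j _ _ ij; rewrite -preimage_setI.
  by move/trivIsetP : tF => /(_ _ _ _ _ ij) ->//; rewrite preimage_set0.
- by rewrite -preimage_bigcup; exact: pre_cons.
Qed.

HB.instance Definition _ := isMeasure.Build _ _ _ lebesgue_step
  lebesgue_step0 lebesgue_step_ge0 lebesgue_step_sigma_additive.

Let nu_sigma_finite : sigma_finite setT nu.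
Proof.
have /sigma_finiteP[F [TF ndF Foo]] := sigma_finiteT (@lebesgue_measure R).
have /sigma_finiteP[G [TG ndG Goo]] := sigma_finiteT mu.
exists (fun i => F i `*` G i).
  rewrite -setXTT TF TG predeqE => -[x y]; split.
    move=> [/= [i _ Fix] [k _ Gky]]; exists (maxn i k) => //; split.
    - by move: x Fix; exact/subsetPset/ndF/leq_maxl.
    - by move: y Gky; exact/subsetPset/ndG/leq_maxr.
  by move=> [i _ []/= ? ?]; split; exists i.
move=> k; have [? ?] := Foo k; have [? ?] := Goo k.
split; first exact: measurableX.
by rewrite [ltLHS]product_measure1E// lte_mul_pinfty// ge0_fin_numE.
Qed.

Let lebesgue_step_sigma_finite : sigma_finite setT lebesgue_step.
Proof.
have [F UF mF] := nu_sigma_finite.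
exists (fun i => uncons_rV @^-1` F i).
  by rewrite -preimage_bigcup -UF preimage_setT.
move=> i; have [mFi nuFi] := mF i; split.
  by rewrite -[X in measurable X]setTI; exact: measurable_uncons_rV.
rewrite /lebesgue_step /pushforward -comp_preimage.
by rewrite (_ : uncons_rV \o cons_rV = id)//; apply/funext => p; exact: cons_rVK.
Qed.

HB.instance Definition _ := Measure_isSigmaFinite.Build _ _ _ lebesgue_step
  lebesgue_step_sigma_finite.

End lebesgue_rV_step.

(* Lebesgue measure on R^n, by iterated products; for n = 0 it is the unit mass
   of the single point. *)
Fixpoint lebesgue_rV (R : realType) (n : nat) :
    {sigma_finite_measure set 'rV[R]_n -> \bar R} :=
  match n with
  | 0 => \d_(0 : 'rV[R]_0)
  | n.+1 => lebesgue_step (lebesgue_rV R n)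
  end.

Section euclidean_geometry.
Context (R : realType).

(* 'rV[R]_n carries the sup norm in the library; lengths are Euclidean here. *)
Definition dotv n (x y : 'rV[R]_n) : R := \sum_i x ord0 i * y ord0 i.

Definition enorm n (x : 'rV[R]_n) : R := Num.sqrt (dotv x x).

Definition diameter n (D : set 'rV[R]_n) : R :=
  sup [set enorm (p.1 - p.2) | p in D `*` D].

Definition inradius n (D : set 'rV[R]_n) : R :=
  sup [set r | 0 <= r /\ exists x, [set y | enorm (y - x) < r] `<=` D].

Definition boundary n (D : set 'rV[R]_n) : set 'rV[R]_n :=
  closure D `\` interior D.

(* The rows of B are an orthonormal basis of the hyperplane orthogonal to the
   unit vector e. *)
Definition orthonormal_frame n (e : 'rV[R]_n) (B : 'M[R]_(n.-1, n)) : Prop :=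
  [/\ dotv e e = 1, B *m B^T = 1%:M & e *m B^T = 0].

(* Near each boundary point, D is the strict epigraph of a Lipschitz function,
   in some orthonormal system of coordinates (y *m B^T, dotv y e). *)
Definition lipschitz_domain n (D : set 'rV[R]_n) : Prop :=
  [/\ open D, connected D, D !=set0, bounded_set D &
   forall x, boundary D x ->
   exists (e : 'rV[R]_n) (B : 'M[R]_(n.-1, n)) (phi : 'rV[R]_n.-1 -> R) (L : R)
     (U : set 'rV[R]_n),
   [/\ orthonormal_frame e B,
       forall y z, `|phi y - phi z| <= L * enorm (y - z),
       nbhs x U &
       forall y, U y -> (D y <-> phi (y *m B^T) < dotv y e)]].

(* The convex hull of the points p i, for i in J. *)
Definition hull n m (p : 'I_m -> 'rV[R]_n) (J : {set 'I_m}) : set 'rV[R]_n :=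
  [set x | exists t : 'I_m -> R,
    [/\ forall i, 0 <= t i, forall i, i \notin J -> t i = 0,
        \sum_i t i = 1 & x = \sum_i t i *: p i]].

Definition affinely_independent n m (p : 'I_m.+1 -> 'rV[R]_n) : bool :=
  row_free (\matrix_(j < m) (p (lift ord0 j) - p ord0)).

Definition simplex n (p : 'I_n.+1 -> 'rV[R]_n) : set 'rV[R]_n :=
  hull p [set: _]%SET.

Definition simplex_face n (p : 'I_n.+1 -> 'rV[R]_n) (i : 'I_n.+1) :
  set 'rV[R]_n := hull p [set~ i]%SET.

Definition polytope n (T : set 'rV[R]_n) : Prop :=
  [/\ T !=set0, connected T &
   exists (N : nat) (p : 'I_N -> 'I_n.+1 -> 'rV[R]_n),
     (forall i, affinely_independent (p i)) /\
     T = interior (\bigcup_(i in [set: 'I_N]) simplex (p i))].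

End euclidean_geometry.

Section function_spaces.
Context (R : realType) (n : nat) (Om : set 'rV[R]_n).

Definition Linfty_norm (f : 'rV[R]_n -> R) : \bar R :=
  'N[lebesgue_rV R n]_+oo [EFin \o (f \_ Om)].

Definition Linfty (f : 'rV[R]_n -> R) : Prop :=
  measurable_fun Om f /\ (Linfty_norm f < +oo)%E.

Definition partial (f : 'rV[R]_n -> R) (j : 'I_n) : 'rV[R]_n -> R :=
  'D_(delta_mx ord0 j) f.

Definition smooth (f : 'rV[R]_n -> R) : Prop :=
  forall s : seq 'I_n, let g := foldl partial f s in
  continuous g /\ forall x j, derivable g x (delta_mx ord0 j).

Definition test_function (f : 'rV[R]_n -> R) : Prop :=
  smooth f /\ exists K : set 'rV[R]_n,
    [/\ compact K, K `<=` Om & forall x, ~ K x -> f x = 0].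

Definition weak_partial (f : 'rV[R]_n -> R) (j : 'I_n) (g : 'rV[R]_n -> R) :
    Prop :=
  forall phi, test_function phi ->
  \int[lebesgue_rV R n]_(x in Om) (f x * partial phi j x) =
  - \int[lebesgue_rV R n]_(x in Om) (g x * phi x).

Definition W1infty (f : 'rV[R]_n -> R) : Prop :=
  Linfty f /\ forall j, exists2 g, Linfty g & weak_partial f j g.

End function_spaces.

Section meshes.
Context (R : realType) (d : nat).

(* A face lies in the hyperplane parametrised isometrically by its chart
   y |-> fbase + y *m fframe; its (d-1)-dimensional Hausdorff measure is then
   the Lebesgue measure on R^(d-1) of its preimage [fdom]. *)
Record mesh := Mesh {
  cell_ix : finType;
  face_ix : finType;
  cell : cell_ix -> set 'rV[R]_d;
  face : face_ix -> set 'rV[R]_d;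
  fbase : face_ix -> 'rV[R]_d;
  fframe : face_ix -> 'M[R]_(d.-1, d);
  fnormal : cell_ix -> face_ix -> 'rV[R]_d
}.

Implicit Types (Om : set 'rV[R]_d) (M : mesh).

Definition fchart M (F : face_ix M) (y : 'rV[R]_d.-1) : 'rV[R]_d :=
  fbase F + y *m fframe F.

Definition fdom M (F : face_ix M) : set 'rV[R]_d.-1 := fchart F @^-1` face F.

Definition face_of M (T : cell_ix M) (F : face_ix M) : bool :=
  `[< face F `<=` boundary (cell T) >].

Definition boundary_face Om M (F : face_ix M) : Prop :=
  exists T : cell_ix M, face F `<=` boundary (cell T) `&` boundary Om.

Definition surface_null M (F : face_ix M) (E : set 'rV[R]_d) : Prop :=
  (lebesgue_rV R d.-1).-negligible (fdom F `&` fchart F @^-1` E).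

Definition hyperplanar M (F : face_ix M) : Prop :=
  fframe F *m (fframe F)^T = 1%:M /\ face F `<=` range (fchart F).

(* At almost every point of F, -n points into T and n points out of T. *)
Definition outward_unit_normal M (T : cell_ix M) (F : face_ix M)
    (n : 'rV[R]_d) : Prop :=
  orthonormal_frame n (fframe F) /\
  surface_null F [set x | ~ \forall e \near 0^'+,
                           cell T (x - e *: n) /\ ~ cell T (x + e *: n)].

Record polytopal_tessellation Om M : Prop := {
  cell_polytope : forall T : cell_ix M, polytope (cell T);
  cell_disjoint : forall T1 T2 : cell_ix M,
    T1 != T2 -> cell T1 `&` cell T2 = set0;
  cell_cover : closure Om = \bigcup_(T in [set: cell_ix M]) closure (cell T);
  face_hyperplanar : forall F : face_ix M, hyperplanar F;
  face_closed : forall F : face_ix M, closed (face F);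
  face_connected : forall F : face_ix M, connected (face F);
  face_sub : forall F : face_ix M, face F `<=` closure Om;
  face_positive : forall F : face_ix M, (0 < lebesgue_rV R d.-1 (fdom F))%E;
  face_position : forall F : face_ix M,
    (exists T1 T2 : cell_ix M, T1 != T2 /\
       face F `<=` boundary (cell T1) `&` boundary (cell T2)) \/
    boundary_face Om F;
  face_overlap : forall F F' : face_ix M, F != F' -> surface_null F (face F');
  face_cover : forall T : cell_ix M,
    boundary (cell T) = \bigcup_(F in [set F | face_of T F]) face F;
  face_normal : forall (T : cell_ix M) (F : face_ix M),
    face_of T F -> outward_unit_normal T F (fnormal T F)
}.

(* p i l is the l-th vertex of the i-th simplex. *)
Record matching_simplicial_submesh Om M (N : nat)
    (p : 'I_N -> 'I_d.+1 -> 'rV[R]_d) : Prop := {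
  submesh_nondegenerate : forall i, affinely_independent (p i);
  submesh_distinct : injective (fun i => simplex (p i));
  submesh_cover : closure Om = \bigcup_(i in [set: 'I_N]) simplex (p i);
  submesh_conforming : forall i j, simplex (p i) `&` simplex (p j) =
    hull (p i) [set l | [exists m, p i l == p j m]]%SET;
  submesh_in_cell : forall i, exists T : cell_ix M,
    simplex (p i) `<=` closure (cell T);
  submesh_face : forall i l (F : face_ix M),
    simplex_face (p i) l `<=` face F \/ surface_null F (simplex_face (p i) l)
}.

Definition meshsize M (h : R) : Prop :=
  (exists T : cell_ix M, diameter (cell T) = h) /\
  forall T : cell_ix M, diameter (cell T) <= h.

Definition regular_mesh Om (rho : R) M : Prop :=
  exists (N : nat) (p : 'I_N -> 'I_d.+1 -> 'rV[R]_d),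
  [/\ matching_simplicial_submesh Om M p,
      forall i, rho * diameter (simplex (p i)) <= inradius (simplex (p i)) &
      forall i (T : cell_ix M), simplex (p i) `<=` closure (cell T) ->
        rho * diameter (cell T) <= diameter (simplex (p i))].

Definition admissible_mesh_sequence Om (H : set R) (M : R -> mesh) : Prop :=
  [/\ countable H, H `<=` [set h | 0 < h], limit_point H = [set 0],
      forall h, H h -> polytopal_tessellation Om (M h) /\ meshsize (M h) h &
      exists2 rho : R, 0 < rho & forall h, H h -> regular_mesh Om rho (M h)].

End meshes.

Section hho.
Context (R : realType).

Definition deg_le n (k : nat) (p : mpoly.mpoly n R[i]) : bool :=
  (mpoly.msize p <= k.+1)%N.

Definition peval n (p : mpoly.mpoly n R[i]) (x : 'rV[R]_n) : R[i] :=
  mpoly.meval (fun j => (x ord0 j)%:C) p.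

Definition l2dot n (D : set 'rV[R]_n) (u v : 'rV[R]_n -> R[i]) : R[i] :=
  (\int[lebesgue_rV R n]_(x in D) complex.Re (u x * (v x)^*%C)) +i*
  (\int[lebesgue_rV R n]_(x in D) complex.Im (u x * (v x)^*%C)).

Definition l2normsq n (D : set 'rV[R]_n) (u : 'rV[R]_n -> R[i]) : R :=
  complex.Re (l2dot D u u).

(* L2-orthogonal projection of u onto the polynomials of degree at most k. *)
Definition l2proj n (k : nat) (D : set 'rV[R]_n) (u : 'rV[R]_n -> R[i]) :
    mpoly.mpoly n R[i] :=
  xget 0 [set p | deg_le k p /\ forall q, deg_le k q ->
    l2dot D (fun x => peval p x - u x) (peval q) = 0].

Context (d : nat) (k : nat) (M : mesh R d).
Implicit Types (T : cell_ix M) (F : face_ix M).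

(* A pair (v_T, (v_F)_F). Face polynomials are written in the coordinates of
   the chart of the face, so that the trace on F of a function u is
   u \o fchart F. *)
Definition local_dof : Type :=
  mpoly.mpoly d R[i] * {ffun face_ix M -> mpoly.mpoly d.-1 R[i]}.

(* A family indexed by the faces of T is stored as a family over all faces that
   vanishes off the faces of T. *)
Definition UT T : set local_dof := [set v : local_dof |
  [/\ deg_le k v.1, forall F, deg_le k (v.2 F) &
      forall F, ~~ face_of T F -> v.2 F = 0]].

Definition global_dof : Type :=
  {ffun cell_ix M -> mpoly.mpoly d R[i]} *
  {ffun face_ix M -> mpoly.mpoly d.-1 R[i]}.

Definition Uh (Om : set 'rV[R]_d) : set global_dof := [set v : global_dof |
  [/\ forall T, deg_le k (v.1 T), forall F, deg_le k (v.2 F) &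
      forall F, boundary_face Om F -> v.2 F = 0]].

Definition restrict_dof T (v : global_dof) : local_dof :=
  (v.1 T, [ffun F => if face_of T F then v.2 F else 0]).

Definition jump F (v : local_dof) (y : 'rV[R]_d.-1) : R[i] :=
  peval (v.2 F) y - peval v.1 (fchart F y).

Definition graddot T (p q : mpoly.mpoly d R[i]) : R[i] :=
  \sum_j l2dot (cell T) (peval (mpoly.mderiv j p)) (peval (mpoly.mderiv j q)).

Definition gradnormsq T (p : mpoly.mpoly d R[i]) : R :=
  \sum_j l2normsq (cell T) (peval (mpoly.mderiv j p)).

Definition normal_trace T F (tau : 'I_d -> mpoly.mpoly d R[i])
    (y : 'rV[R]_d.-1) : R[i] :=
  \sum_j peval (tau j) (fchart F y) * (fnormal T F ord0 j)%:C.

Definition norm1Tsq T (v : local_dof) : R :=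
  gradnormsq T v.1 +
  \sum_(F | face_of T F) (diameter (face F))^-1 * l2normsq (fdom F) (jump F v).

Definition norm1hsq (v : global_dof) : R := \sum_T norm1Tsq T (restrict_dof T v).

Definition l2hsq (v : global_dof) : R :=
  \sum_T l2normsq (cell T) (peval (v.1 T)).

(* xget selects the polynomial characterised by the defining relations; it is
   unique as cells are nonempty and open. The same holds for l2proj and
   cov_gradient. *)
Definition potential T (v : local_dof) : mpoly.mpoly d R[i] :=
  xget 0 [set p : mpoly.mpoly d R[i] | [/\ deg_le k.+1 p,
    forall w, deg_le k.+1 w ->
      graddot T p w = graddot T v.1 w +
        \sum_(F | face_of T F) l2dot (fdom F) (jump F v)
          (normal_trace T F (fun j => mpoly.mderiv j w)) &
    l2dot (cell T) (fun x => peval p x - peval v.1 x) (fun=> 1) = 0]].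

Definition interpolate T (w : mpoly.mpoly d R[i]) : local_dof :=
  (l2proj k (cell T) (peval w),
   [ffun F => if face_of T F
              then l2proj k (fdom F) (peval w \o fchart F) else 0]).

Definition sesquilinear_on (U : set local_dof)
    (s : local_dof -> local_dof -> R[i]) : Prop :=
  forall (a : R[i]) u v w, U u -> U v -> U w ->
    s (a *: u + v) w = a * s u w + s v w /\
    s w (a *: u + v) = a^*%C * s w u + s w v.

Record hho_stabilization (eta : R) T
    (s : local_dof -> local_dof -> R[i]) : Prop := {
  stab_sesquilinear : sesquilinear_on (UT T) s;
  stab_hermitian : forall u v, UT T u -> UT T v -> s v u = (s u v)^*%C;
  stab_psd : forall v, UT T v -> 0 <= s v v;
  stab_equiv : forall v, UT T v ->
    eta^-1 * norm1Tsq T v <=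
      gradnormsq T (potential T v) + complex.Re (s v v) /\
    gradnormsq T (potential T v) + complex.Re (s v v) <= eta * norm1Tsq T v;
  stab_consistent : forall w v, deg_le k.+1 w -> UT T v ->
    s (interpolate T w) v = 0
}.

Definition divergence (tau : 'I_d -> mpoly.mpoly d R[i]) : mpoly.mpoly d R[i] :=
  \sum_j mpoly.mderiv j (tau j).

Definition cov_gradient T (A : 'rV[R]_d -> 'rV[R]_d) (v : local_dof) :
    {ffun 'I_d -> mpoly.mpoly d R[i]} :=
  xget [ffun=> 0] [set G : {ffun 'I_d -> mpoly.mpoly d R[i]} |
    (forall j, deg_le k (G j)) /\
    forall tau : 'I_d -> mpoly.mpoly d R[i], (forall j, deg_le k (tau j)) ->
    \sum_j l2dot (cell T) (peval (G j)) (peval (tau j)) =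
    l2dot (cell T) (peval v.1)
      (fun x => - 'i%C * peval (divergence tau) x -
                \sum_j (A x ord0 j)%:C * peval (tau j) x) -
    'i%C * \sum_(F | face_of T F)
      l2dot (fdom F) (peval (v.2 F)) (normal_trace T F tau)].

Definition a_h (s : cell_ix M -> local_dof -> local_dof -> R[i])
    (V : 'rV[R]_d -> R) (u v : global_dof) (A : 'rV[R]_d -> 'rV[R]_d) : R[i] :=
  \sum_T (\sum_j l2dot (cell T) (peval (cov_gradient T A (restrict_dof T u) j))
                               (peval (cov_gradient T A (restrict_dof T v) j)) +
          s T (restrict_dof T u) (restrict_dof T v) +
          l2dot (cell T) (fun x => (V x)%:C * peval (u.1 T) x)
                        (peval (v.1 T))).

End hho.

(* Main.v *)
Require Import Defs.
From mathcomp Require Import all_boot all_order all_algebra.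
From mathcomp Require Import all_classical all_reals all_analysis.
From mathcomp Require Import measurable_realfun ess_sup_inf.
From mathcomp Require Import complex.
From mathcomp Require Import ring lra.
From mathcomp Require mpoly.
Import (canonicals, coercions) mpoly.

Set Implicit Arguments.
Unset Strict Implicit.
Unset Printing Implicit Defensive.

Import Order.TTheory GRing.Theory Num.Theory numFieldNormedType.Exports.
Local Open Scope classical_set_scope.
Local Open Scope complex_scope.
Local Open Scope ring_scope.

(** The inequality comes from testing the covariant gradient with a gradient.
Fix a cell T and local unknowns v, write p for the potential p_T v and G for
G_T[A] v.  Since p has degree at most k+1, the field grad p is an admissible
test function in the definition of G.  That definition contains the volume
term (v_T, div grad p)_T, which the divergence theorem on T turns into
(grad v_T, grad p)_T and face terms; together with the face terms in v_F they
form exactly the right-hand side of the relation defining p, tested with p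
itself.  The outcome is the identity ([gradient_identity])

  |grad p|^2 = i (G + A v_T, grad p)_T,

whence, by Young's inequality,
|grad p|^2 / 2 <= |G|^2 + |A v_T|^2 ([gradnormsq_potential_le]).  The lower
bound in the equivalence satisfied by a stabilization, divided by two, gives

  |v|_{1,T}^2 / (2 eta) <= |G|^2 + s_T(v, v) + |A|_oo^2 |v_T|^2,

and the term in V costs at most |V|_oo |v_T|^2 ([local_lower_bound]).  Summing
over the cells yields the theorem with alpha = 1 / (2 eta) and gamma = 1.

Three facts support this computation.

The divergence theorem on a polytopal cell ([cell_divergence]).  Fix a
coordinate direction.  Almost every line in this direction meets the boundary
of T at finitely many points, one face at a time and transversally, so the
indicator of T along the line is a step function with unit jumps at exactly
these points, downwards or upwards according to the sign of the slope of the
line with respect to the outward normal ([indic_crossings]).  The fundamental theorem of calculus then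
integrates a derivative over the part of the line inside T
([regular_line_integral]).  Integrating over all parallel lines, and
parametrising those that meet a face by the chart of that face, produces the
Jacobian 1 / |u . n| and hence the component of the normal
([cell_divergence_direction]).  The change of variables rests on the behaviour
of the iterated Lebesgue measure under affine maps ([lebesgue_rV_affine]).

The existence of G ([cov_gradientP]).  G is a selected solution of a square
linear system whose Gram matrix is built on the fields with one monomial
component.  A vector in the kernel of this matrix is a polynomial field with
zero norm on T, so it vanishes on T and on its faces, and the right-hand side
of the system vanishes on it: the system is solvable.

The inclusion of the cells in the domain ([cell_in_domain]), by which the
almost everywhere bounds of A and V on the domain hold on the cells.  A
tessellation only prescribes the closure of the domain; the inclusion holds
because a Lipschitz domain lies on one side of its boundary. *)

(** * Lebesgue measure under affine maps *)

Section affine_line.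
Context {R : realType}.
Local Notation lambda := (@lebesgue_measure R).

Lemma measurable_affine (a b : R) :
  measurable_fun setT (fun t : measurableTypeR R => b + t * a : measurableTypeR R).
Proof.
apply: measurable_funD => //.
exact: measurable_funM.
Qed.

(** Both sides are measures in E, so it is enough to compare them on half-open
intervals, where the sign of a decides which end comes first. *)
Lemma lebesgue_measure_affine (a b : R) (E : set (measurableTypeR R)) :
  a != 0 -> measurable E ->
  (`|a|%:E * lambda ((fun t : measurableTypeR R =>
     (b + t * a)%R : measurableTypeR R) @^-1` E) = lambda E)%E.
Proof.
move=> a0 mE.
pose phi : measurableTypeR R -> measurableTypeR R := fun t => b + t * a.
have mphi : measurable_fun setT phi by exact: measurable_affine.
have an : 0 < `|a| by rewrite normr_gt0.
pose pp : {measure set (measurableTypeR R) -> \bar R} :=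
  [the {measure set _ -> \bar R} of pushforward lambda phi].
pose pm : {measure set (measurableTypeR R) -> \bar R} :=
  [the {measure set _ -> \bar R} of mscale (NngNum (normr_ge0 a)) (pp mphi)].
symmetry.
apply: (@lebesgue_measure_unique R pm) => //= _ [[x y]] _ <- /=.
change (lambda `]x, y]%classic = (`|a|%:E * lambda (phi @^-1` `]x, y]%classic))%E).
have -> : phi @^-1` `]x, y]%classic = if 0 < a
    then `](x - b) / a, (y - b) / a]%classic else `[(y - b) / a, (x - b) / a[%classic.
  apply/seteqP; split=> t /=; rewrite /phi; case: ltP => a0' /=;
    rewrite !in_itv/=; move=> /andP[h1 h2]; apply/andP.
  - by split; rewrite ?ltr_pdivrMr ?ler_pdivlMr//; lra.
  - have a1 : a < 0 by rewrite lt_neqAle a0 a0'.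
    by split; rewrite ?ler_ndivrMr ?ltr_ndivlMr//; lra.
  - by move: h1 h2; rewrite ?ltr_pdivrMr ?ler_pdivlMr// => h1 h2; split; lra.
  - have a1 : a < 0 by rewrite lt_neqAle a0 a0'.
    by move: h1 h2; rewrite ?ler_ndivrMr ?ltr_ndivlMr// => h1 h2; split; lra.
have [xy|yx] := ltP x y; last first.
  rewrite set_itv_ge ?bnd_simp -?leNgt// measure0.
  case: ltP => a0'; rewrite set_itv_ge ?measure0 ?mule0//= bnd_simp -leNgt.
    by rewrite ler_pM2r ?invr_gt0// lerD2r.
  have a1 : a < 0 by rewrite lt_neqAle a0 a0'.
  by rewrite ler_nM2r ?invr_lt0// lerD2r.
case: ltP => a0'.
  rewrite !lebesgue_measure_itv/= !lte_fin xy ltr_pM2r ?invr_gt0// ltrD2r xy.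
  by rewrite -!EFinD -EFinM gtr0_norm//; congr EFin; field.
have a1 : a < 0 by rewrite lt_neqAle a0 a0'.
rewrite !lebesgue_measure_itv/= !lte_fin xy ltr_nM2r ?invr_lt0// ltrD2r xy.
by rewrite -!EFinD -EFinM ltr0_norm//; congr EFin; field.
Qed.

End affine_line.

Section lebesgue_rV_sections.
Context {R : realType}.
Local Notation lambda := (@lebesgue_measure R).

Lemma measurable_rV_affine n m (c : 'rV[R]_m) (C : 'M[R]_(n, m)) :
  measurable_fun setT (fun x : 'rV[R]_n => c + x *m C).
Proof.
apply: measurable_fun_rV => i.
rewrite (_ : _ \o _ = (fun x : 'rV[R]_n =>
   c ord0 i + \sum_j rV_coord j x * C j i : measurableTypeR R)).
  apply: measurable_funD => //.
  apply: measurable_sum => j.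
  apply: measurable_funM => //.
  exact: measurable_rV_coord.
by apply/funext => x; rewrite /= /rV_coord !mxE.
Qed.

Lemma measurable_preimage_affine n m (c : 'rV[R]_m) (C : 'M[R]_(n, m)) E :
  measurable E -> measurable ((fun x : 'rV[R]_n => c + x *m C) @^-1` E).
Proof.
by move=> mE; rewrite -[X in measurable X]setTI; exact: measurable_rV_affine.
Qed.

Lemma measurable_preimage_cons n (E : set 'rV[R]_n.+1) :
  measurable E -> measurable (@cons_rV R n @^-1` E).
Proof.
by move=> mE; rewrite -[X in measurable X]setTI; exact: measurable_cons_rV.
Qed.

Lemma lebesgue_rVS_xsection n (E : set 'rV[R]_n.+1) :
  lebesgue_rV R n.+1 E =
  (\int[lambda]_t lebesgue_rV R n [set x | E (cons_rV (t, x))])%E.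
Proof.
rewrite /= /lebesgue_step /pushforward /=.
rewrite /product_measure1; apply: eq_integral => t _ /=; congr (lebesgue_rV R n _).
by apply/seteqP; split => x /=; rewrite xsectionE/=.
Qed.

(** The order of the two factors is immaterial, by uniqueness of the product
measure. *)
Lemma lebesgue_rVS_ysection n (E : set 'rV[R]_n.+1) : measurable E ->
  lebesgue_rV R n.+1 E =
  (\int[lebesgue_rV R n]_x lambda [set t | E (cons_rV (t, x))])%E.
Proof.
move=> mE; rewrite /= /lebesgue_step /pushforward /=.
rewrite (@product_measure_unique _ _ _ _ R _ _
   [the {measure set _ -> \bar R} of (lambda \x^ lebesgue_rV R n)%E])//=.
- rewrite /product_measure2; apply: eq_integral => t _ /=; congr (lambda _).
  by apply/seteqP; split => x /=; rewrite ysectionE.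
- by move=> A B mA mB; rewrite product_measure2E.
- exact: measurable_preimage_cons.
Qed.

Lemma measurable_lebesgue_rV_xsection n (E : set 'rV[R]_n.+1) : measurable E ->
  measurable_fun setT ((fun t => lebesgue_rV R n [set x | E (cons_rV (t, x))])
    : measurableTypeR R -> \bar R).
Proof.
move=> mE; have mE' := measurable_preimage_cons mE.
rewrite (_ : (fun t => _) = lebesgue_rV R n \o xsection (@cons_rV R n @^-1` E)).
  exact: measurable_fun_xsection.
apply/funext => t /=; congr (lebesgue_rV R n _).
by apply/seteqP; split => x /=; rewrite xsectionE.
Qed.

Lemma measurable_lebesgue_rV_ysection n (E : set 'rV[R]_n.+1) : measurable E ->
  measurable_fun setT ((fun x => lambda [set t | E (cons_rV (t, x))])
    : 'rV[R]_n -> \bar R).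
Proof.
move=> mE; have mE' := measurable_preimage_cons mE.
rewrite (_ : (fun t => _) = lambda \o ysection (@cons_rV R n @^-1` E)).
  exact: measurable_fun_ysection.
apply/funext => t /=; congr (lambda _).
by apply/seteqP; split => x /=; rewrite ysectionE.
Qed.

Lemma measurable_xsection_cons n (E : set 'rV[R]_n.+1) t : measurable E ->
  measurable [set x : 'rV[R]_n | E (cons_rV (t, x))].
Proof.
move=> /measurable_preimage_cons /(measurable_xsection t).
by rewrite xsectionE.
Qed.

Lemma measurable_ysection_cons n (E : set 'rV[R]_n.+1) (x : 'rV[R]_n) : measurable E ->
  measurable [set t : measurableTypeR R | E (cons_rV (t, x))].
Proof.
move=> /measurable_preimage_cons /(measurable_ysection x).
by rewrite ysectionE.
Qed.

End lebesgue_rV_sections.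

Section lebesgue_rV_affine.
Context {R : realType}.
Local Notation lambda := (@lebesgue_measure R).

(** The factor stands on the side of the preimage, so that the property composes
without dividing by determinants. *)
Definition scales_by_det n (c : 'rV[R]_n) (C : 'M[R]_n) := forall E : set 'rV[R]_n,
  measurable E ->
  (`|\det C|%:E * lebesgue_rV R n ((fun x => (c + x *m C)%R) @^-1` E) =
   lebesgue_rV R n E)%E.

Lemma scales_by_det_comp n (c1 c2 : 'rV[R]_n) (C1 C2 : 'M[R]_n) :
  scales_by_det c1 C1 -> scales_by_det c2 C2 ->
  scales_by_det (c2 + c1 *m C2) (C1 *m C2).
Proof.
move=> h1 h2 E mE; rewrite -(h2 _ mE).
rewrite -(h1 ((fun x => c2 + x *m C2) @^-1` E)); last exact: measurable_preimage_affine.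
rewrite det_mulmx normrM mulrC EFinM -muleA; congr (_ * (_ * _))%E.
congr (lebesgue_rV R n _); apply/seteqP; split => x /=;
  by rewrite mulmxDl mulmxA addrA.
Qed.

(** On each line parallel to the first axis this shear acts as an affine map of
slope a. *)
Lemma scales_by_det_lower n (c a : R) (l : 'M[R]_(n, 1)) : a != 0 ->
  @scales_by_det (1 + n) (row_mx c%:M 0) (block_mx a%:M 0 l 1%:M).
Proof.
move=> a0 E mE; rewrite det_lblock det1 mulr1 det_scalar1.
rewrite (lebesgue_rVS_ysection mE) lebesgue_rVS_ysection; last first.
  exact: (@measurable_preimage_affine R (1 + n) (1 + n)).
rewrite -ge0_integralZl//; last first.
  apply: (@measurable_lebesgue_rV_ysection R n).
  exact: (@measurable_preimage_affine R (1 + n) (1 + n)).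
apply: eq_integral => x _.
rewrite -(@lebesgue_measure_affine R a ((c%:M + x *m l) ord0 ord0)
  [set t | E (cons_rV (t, x))])//; last exact: measurable_ysection_cons.
congr (_ * lambda _)%E; apply/seteqP; split => t /=;
 rewrite /cons_rV/= mul_row_block mulmx0 mulmx1 add_row_mx !add0r;
 rewrite addrA (_ : c%:M + _ + _ = const_mx ((c%:M + x *m l) ord0 ord0 + t * a))//;
 by apply/matrixP => i j; rewrite !ord1 mul_mx_scalar !mxE; ring.
Qed.

(** This shear preserves the first coordinate, and acts on each slice as an affine
map of linear part D. *)
Lemma scales_by_det_upper n (b c : 'rV[R]_n) (D : 'M[R]_n) :
  (forall c', scales_by_det c' D) ->
  @scales_by_det (1 + n) (row_mx 0 c) (block_mx 1%:M b 0 D).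
Proof.
move=> hD E mE; rewrite det_ublock det1 mul1r.
rewrite !lebesgue_rVS_xsection.
rewrite -ge0_integralZl//; last first.
  apply: (@measurable_lebesgue_rV_xsection R n).
  exact: (@measurable_preimage_affine R (1 + n) (1 + n)).
apply: eq_integral => t _.
rewrite -(hD (c + t *: b) [set x | E (cons_rV (t, x))])//; last first.
  exact: measurable_xsection_cons.
congr (_ * lebesgue_rV R n _)%E; apply/seteqP; split => x /=;
 rewrite /cons_rV/= mul_row_block mulmx0 mulmx1 add_row_mx addr0 add0r;
 rewrite (_ : const_mx t = t%:M) ?mul_scalar_mx ?addrA//;
 by apply/matrixP => i j; rewrite !ord1 !mxE.
Qed.

(** Block elimination: a matrix whose upper left entry is nonzero is a product of
a lower and an upper shear.  If that entry is 0, a transvection first brings a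
nonzero entry of the first column into its place. *)
Lemma lebesgue_rV_affine n (c : 'rV[R]_n) (C : 'M[R]_n) :
  C \in unitmx -> scales_by_det c C.
Proof.
elim: n c C => [|n IH] c C uC.
  move=> E mE; rewrite det_mx00 normr1 mul1e; congr (lebesgue_rV R 0 _).
  by apply/seteqP; split => x /=; rewrite !thinmx0.
suff pivot (c1 : 'rV[R]_(1 + n)) (C1 : 'M[R]_(1 + n)) : C1 \in unitmx ->
    (ulsubmx C1) ord0 ord0 != 0 -> scales_by_det c1 C1.
  have [a0|a0] := eqVneq ((@ulsubmx R 1 n 1 n C) ord0 ord0) 0; last exact: pivot.
  have [i li] : exists i, (@dlsubmx R 1 n 1 n C) i ord0 != 0.
    apply/existsP; apply: contraLR uC; rewrite negb_exists => /forallP h.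
    rewrite unitmxE -[C](@submxK _ 1 n 1 n).
    rewrite (_ : ulsubmx _ = 0); last first.
      by apply/matrixP => p q; rewrite !ord1 a0 mxE.
    rewrite (_ : dlsubmx _ = 0); last first.
      by apply/matrixP => p q; rewrite ord1; move: (h p); rewrite negbK => /eqP ->; rewrite mxE.
    by rewrite (@det_ublock _ 1 n) det0 mul0r unitr0.
  (* S s adds s times a row of the lower block to the first row. *)
  pose S (s : R) : 'M[R]_(1 + n) := block_mx 1%:M (s *: delta_mx ord0 i) 0 1%:M.
  have detS s : \det (S s) = 1 by rewrite det_ublock !det1 mulr1.
  have SS : S (-1) *m S 1 = 1%:M.
    rewrite /S mulmx_block !mulmx0 !mul0mx !mulmx1 !mul1mx !addr0 add0r.
    by rewrite -scalerDl subrr scale0r -scalar_mx_block.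
  suff : scales_by_det (c + 0 *m (S 1 *m C)) (S (-1) *m (S 1 *m C)).
    by rewrite mul0mx addr0 mulmxA SS mul1mx.
  apply: (@scales_by_det_comp (1 + n)).
    rewrite -[0](@row_mx0 _ 1 1 n); apply: scales_by_det_upper => c' F mF.
    by apply: IH => //; exact: unitmx1.
  apply: pivot.
    by rewrite unitmx_mul uC andbT unitmxE detS unitr1.
  have -> : S 1 *m C = @mulmx R (1 + n) (1 + n) (1 + n) (S 1)
      (block_mx (@ulsubmx R 1 n 1 n C) (@ursubmx R 1 n 1 n C)
                (@dlsubmx R 1 n 1 n C) (@drsubmx R 1 n 1 n C)) by rewrite submxK.
  rewrite /S mulmx_block block_mxKul mul1mx scale1r.
  by rewrite mxE a0 add0r -rowE mxE.
move=> uC1 a0.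
(* D is the Schur complement of a in C1. *)
pose a := (ulsubmx C1) ord0 ord0; pose b := a^-1 *: ursubmx C1.
pose l := dlsubmx C1; pose D := drsubmx C1 - l *m b.
have CE : C1 = block_mx a%:M 0 l 1%:M *m block_mx 1%:M b 0 D.
  rewrite mulmx_block !mulmx0 !mul0mx !mulmx1 !mul1mx !addr0 /D addrC subrK.
  rewrite /b mul_scalar_mx scalerA divff// scale1r -[LHS]submxK; congr block_mx.
  by apply/matrixP => p q; rewrite !ord1 [RHS]mxE.
have uD : D \in unitmx.
  move: uC1; rewrite CE unitmx_mul => /andP[_].
  by rewrite !unitmxE det_ublock det1 mul1r.
pose c0 := lsubmx c1 ord0 ord0.
have cE : c1 = row_mx 0 (rsubmx c1 - c0 *: b) + row_mx c0%:M 0 *m block_mx 1%:M b 0 D.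
  rewrite mul_row_block mulmx1 !mul0mx addr0 addr0 mul_scalar_mx add_row_mx add0r subrK.
  rewrite -[LHS]hsubmxK; congr row_mx.
  by apply/matrixP => p q; rewrite !ord1 [RHS]mxE.
rewrite CE cE; apply: scales_by_det_comp; first exact: scales_by_det_lower.
by apply: scales_by_det_upper => c'; exact: IH.
Qed.

End lebesgue_rV_affine.

(** * Borel sets, balls and hyperplanes *)

Section lebesgue_rV_topology.
Context {R : realType}.

Lemma rV_ballP n (x y : 'rV[R]_n) (r : R) :
  ball x r y <-> 0 < r /\ forall i, `|x ord0 i - y ord0 i| < r.
Proof.
split=> [[r0 h]|[r0 h]]; split=> // i; first exact: h.
by move=> j; rewrite (ord1 i); exact: h.
Qed.

Lemma ord_1addP n (P : 'I_n.+1 -> Prop) :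
  P ord0 -> (forall j : 'I_n, P (rshift 1 j)) -> forall i, P i.
Proof.
move=> P0 Pr i; rewrite -(splitK (i : 'I_(1 + n))).
case: (fintype.split (i : 'I_(1 + n))) => j //=.
by rewrite (_ : lshift n j = ord0)//; apply: val_inj; rewrite /= ord1.
Qed.

Lemma cons_rVE0 n t (y : 'rV[R]_n) : cons_rV (t, y) ord0 ord0 = t.
Proof.
rewrite /cons_rV/= (_ : (ord0 : 'I_n.+1) = lshift n (ord0 : 'I_1)); last exact: val_inj.
by rewrite (@row_mxEl _ 1 1 n) mxE.
Qed.

Lemma cons_rVEr n t (y : 'rV[R]_n) i : cons_rV (t, y) ord0 (rshift 1 i) = y ord0 i.
Proof. by rewrite /cons_rV/= (@row_mxEr _ 1 1 n). Qed.

Lemma measurable_rV_ball n (x : 'rV[R]_n) (r : R) : measurable (ball x r).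
Proof.
have [r0|r0] := ltP 0 r; last first.
  rewrite (_ : ball x r = set0)//; apply/seteqP; split=> // y /rV_ballP[].
  by rewrite ltNge r0.
rewrite (_ : ball x r = \bigcap_(i in [set: 'I_n]) (rV_coord i @^-1` ball (x ord0 i) r)).
  apply: fin_bigcap_measurable => // i _.
  rewrite -[X in measurable X]setTI; apply: measurable_rV_coord => //.
  exact: measurable_ball.
apply/seteqP; split => y; first by move=> /rV_ballP[_ h] i _; exact: h.
by move=> h; apply/rV_ballP; split=> // i; exact: h.
Qed.

(** Balls are those of the sup norm, that is, cubes of side 2 r. *)
Lemma lebesgue_rV_ball n (x : 'rV[R]_n) (r : R) : 0 < r ->
  lebesgue_rV R n (ball x r) = ((r *+ 2) ^+ n)%:E.
Proof.
move=> r0; elim: n x => [|n IH] x.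
  rewrite expr0 /= diracE mem_set//; apply/rV_ballP; split=> // -[]//.
rewrite /= /lebesgue_step /pushforward.
have -> : @cons_rV R n @^-1` ball x r = ball (x ord0 ord0) r `*` ball (@rsubmx R 1 1 n x) r.
  apply/seteqP; split => -[t y] /=.
    move=> /rV_ballP[_ h]; split; first by have := h ord0; rewrite cons_rVE0.
    apply/rV_ballP; split=> // i; have := h (rshift 1 i).
    by rewrite cons_rVEr mxE.
  move=> [h1 /rV_ballP[_ h2]]; apply/rV_ballP; split=> //.
  apply: ord_1addP; first by rewrite cons_rVE0.
  by move=> j; rewrite cons_rVEr; move: (h2 j); rewrite mxE.
rewrite product_measure1E//; [|exact: measurable_ball|exact: measurable_rV_ball].
rewrite IH [X in (X * _)%E](_ : _ = (r *+ 2)%:E); last exact: lebesgue_measure_ball (ltW r0).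
by rewrite -EFinM exprS.
Qed.

(** An open set is the union of the countably many balls with rational centre and
radius 1 / (k + 1) that it contains. *)
Lemma open_measurable_rV n (U : set 'rV[R]_n) : open U -> measurable U.
Proof.
move=> oU.
pose B (p : 'rV[rat]_n * nat) : set 'rV[R]_n := 
  ball (\row_j (ratr (p.1 ord0 j) : R) : 'rV[R]_n) (p.2.+1%:R^-1 : R).
have -> : U = \bigcup_(p in [set p | B p `<=` U]) B p.
  apply/seteqP; split => [x Ux|x [p /= pU Bp]]; last exact: pU.
  have [e /= e0 eU] : exists2 e, 0 < e & ball x e `<=` U.
    by apply/nbhs_ballP; exact: open_nbhs_nbhs.
  have [k ke] : exists k, (k.+1%:R^-1 : R) < e / 2.
    near \oo => k; exists k; near: k.
    exact: near_infty_natSinv_lt (PosNum (divr_gt0 e0 (ltr0Sn _ 1))).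
  have k0 : 0 < (k.+1%:R^-1 : R) by rewrite invr_gt0.
  have [w wE] : exists w : R, w = k.+1%:R^-1 by exists k.+1%:R^-1.
  rewrite -wE in ke k0.
  have /choice[q hq] : forall i, exists q : rat, `|x ord0 i - ratr q| < w.
    move=> i; have : x ord0 i - w < x ord0 i + w by lra.
    move=> /rat_in_itvoo[q]; rewrite in_itv/= => /andP[h1 h2]; exists q.
    by rewrite ltr_norml; lra.
  exists (\row_i q i, k); rewrite /= /B/= -wE.
    move=> y /rV_ballP[_ h]; apply: eU; apply/rV_ballP; split=> // i.
    have := h i; have := hq i; rewrite !mxE => h1 h2.
    rewrite (_ : x ord0 i - _ = (x ord0 i - ratr (q i)) + (ratr (q i) - y ord0 i)); last by ring.
    by apply: le_lt_trans (ler_normD _ _) _; lra.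
  by apply/rV_ballP; split=> // i; rewrite !mxE distrC.
rewrite bigcup_mkcond; apply: countable_bigcupT_measurable => [|p].
  exact: countableP.
by case: ifP => // _; exact: measurable_rV_ball.
Unshelve. all: by end_near. Qed.

Lemma closed_measurable_rV n (U : set 'rV[R]_n) : closed U -> measurable U.
Proof.
by move=> cU; rewrite -[U]setCK; apply: measurableC; apply: open_measurable_rV; rewrite openC.
Qed.

Lemma continuous_measurable_rV n (f : 'rV[R]_n -> R) : continuous f -> measurable_fun setT f.
Proof.
move=> /continuousP cf; apply: (measurability _ (RGenOpens.measurableE R)).
move=> _ [_ [a [b ->] <-]]; rewrite setTI.
by apply: open_measurable_rV; apply: cf; exact: interval_open.
Qed.

Lemma bounded_lebesgue_rV_lty n (D : set 'rV[R]_n) : measurable D -> bounded_set D ->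
  (lebesgue_rV R n D < +oo)%E.
Proof.
move=> mD [M [_ MD]].
have {}MD : D `<=` ball 0 (`|M| + 2).
  move=> x /(MD (`|M| + 1)) h; rewrite mx_norm_ball /ball_ /= sub0r normrN.
  by apply: le_lt_trans (h _) _; rewrite ?ltrD2l ?ltr1n// ltr_pwDr// ler_norm.
apply: (@le_lt_trans _ _ (lebesgue_rV R n (ball (0 : 'rV[R]_n) (`|M| + 2)))).
  by apply: le_measure => //; rewrite inE//; exact: measurable_rV_ball.
by rewrite lebesgue_rV_ball ?ltry// ltr_wpDl.
Qed.

Lemma open_lebesgue_rV_gt0 n (U : set 'rV[R]_n) x : open U -> U x ->
  (0 < lebesgue_rV R n U)%E.
Proof.
move=> oU Ux.
have [e /= e0 eU] : exists2 e, 0 < e & ball x e `<=` U.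
  by apply/nbhs_ballP; exact: open_nbhs_nbhs.
apply: (@lt_le_trans _ _ (lebesgue_rV R n (ball x e))).
  by rewrite lebesgue_rV_ball// lte_fin exprn_gt0// mulrn_wgt0.
apply: le_measure => //; rewrite inE; first exact: measurable_rV_ball.
exact: open_measurable_rV.
Qed.

Lemma measurable_rV_hyperplane n (a : 'cV[R]_n) (c : R) :
  measurable [set x : 'rV[R]_n | (x *m a) ord0 ord0 = c].
Proof.
have mf : measurable_fun setT (@rV_coord R 1 ord0 \o (fun x : 'rV[R]_n => 0 + x *m a)).
  apply: measurableT_comp; [exact: measurable_rV_coord|exact: measurable_rV_affine].
have := mf measurableT [set c] (measurable_set1 c); rewrite setTI; congr measurable.
by apply/seteqP; split=> x; rewrite /= /rV_coord add0r.
Qed.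

(** If only the first coefficient of a is nonzero, each line parallel to the first
axis meets the hyperplane in one point; otherwise every slice is a hyperplane. *)
Lemma lebesgue_rV_hyperplane n (a : 'cV[R]_n) (c : R) : a != 0 ->
  lebesgue_rV R n [set x | (x *m a) ord0 ord0 = c] = 0%E.
Proof.
elim: n a c => [|n IH] a c; first by rewrite flatmx0 eqxx.
rewrite -[a](@vsubmxK _ 1 n).
move: (@usubmx _ 1 n _ a) (@dsubmx _ 1 n _ a) => {a} a0 a'.
have E t (y : 'rV[R]_n) : (cons_rV (t, y) *m col_mx a0 a') ord0 ord0 =
    t * a0 ord0 ord0 + (y *m a') ord0 ord0.
  rewrite /cons_rV/= (@mul_row_col _ 1 1 n) !mxE; congr +%R.
  by rewrite big_ord1 mxE.
move=> an0; have [a'0|a'0] := eqVneq a' 0.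
  rewrite lebesgue_rVS_ysection; last exact: measurable_rV_hyperplane.
  rewrite integral0_eq// => y _ /=.
  rewrite (_ : [set t | _] = [set c / a0 ord0 ord0]) ?lebesgue_measure_set1//.
  have a00 : a0 ord0 ord0 != 0.
    apply: contra_neq an0 => a00; rewrite a'0 (_ : a0 = 0) ?col_mx0//.
    by apply/matrixP => i j; rewrite !ord1 a00 mxE.
  apply/seteqP; split => t /=; rewrite E a'0 mulmx0 mxE addr0 => h.
    by rewrite -h mulfK.
  by rewrite h divfK.
rewrite lebesgue_rVS_xsection integral0_eq// => t _.
rewrite (_ : [set y | _] = [set y | (y *m a') ord0 ord0 = c - t * a0 ord0 ord0]).
  exact: IH.
by apply/seteqP; split => y /=; rewrite E => h; lra.
Qed.

End lebesgue_rV_topology.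

(** * Change of variables and iterated integrals *)

Section lebesgue_rV_integral.
Context {R : realType}.
Local Notation lambda := (@lebesgue_measure R).

(** Lebesgue measure is a multiple of its own pushforward by the affine map. *)
Lemma ge0_integral_rV_affine n (c : 'rV[R]_n) (C : 'M[R]_n) (f : 'rV[R]_n -> \bar R) :
  C \in unitmx -> measurable_fun setT f -> (forall x, (0 <= f x)%E) ->
  (\int[lebesgue_rV R n]_x f x =
   `|\det C|%:E * \int[lebesgue_rV R n]_x f (c + x *m C)%R)%E.
Proof.
move=> uC mf f0.
pose mu : {measure set 'rV[R]_n -> \bar R} := lebesgue_rV R n.
pose phi (x : 'rV[R]_n) := c + x *m C.
have mphi : measurable_fun setT phi by exact: measurable_rV_affine.
pose pp : {measure set 'rV[R]_n -> \bar R} :=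
  [the {measure set _ -> \bar R} of pushforward mu phi].
transitivity (\int[mscale (NngNum (normr_ge0 (\det C))) (pp mphi)]_x f x)%E.
  apply: eq_measure_integral => A mA _.
  exact/esym/(lebesgue_rV_affine c uC mA).
rewrite ge0_integral_mscale//=; congr (_ * _)%E.
by rewrite (@ge0_integral_pushforward _ _ _ _ R phi mphi mu)//.
Qed.

Lemma integrable_rV_affine n (c : 'rV[R]_n) (C : 'M[R]_n) (f : 'rV[R]_n -> \bar R) :
  C \in unitmx -> (lebesgue_rV R n).-integrable setT f ->
  (lebesgue_rV R n).-integrable setT (fun x => f (c + x *m C)).
Proof.
move=> uC /integrableP[mf foo]; apply/integrableP; split.
  by apply: measurableT_comp => //; exact: measurable_rV_affine.
move: foo; rewrite (@ge0_integral_rV_affine n c C (fun x => `|f x|)%E)//; last first.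
  exact: measurableT_comp.
have : (0 <= \int[lebesgue_rV R n]_x `|f (c + x *m C)%R|)%E by exact: integral_ge0.
move: (integral _ _ _) => I I0.
have d0 : 0 < `|\det C| by rewrite normr_gt0 -unitfE -unitmxE.
by case: I I0 => [r| |]//= _; rewrite ?ltry// gt0_muley ?lte_fin.
Qed.

Lemma integral_rV_affine n (c : 'rV[R]_n) (C : 'M[R]_n) (f : 'rV[R]_n -> \bar R) :
  C \in unitmx -> (lebesgue_rV R n).-integrable setT f ->
  (\int[lebesgue_rV R n]_x f x =
   `|\det C|%:E * \int[lebesgue_rV R n]_x f (c + x *m C)%R)%E.
Proof.
move=> uC intf; have intf' := integrable_rV_affine c uC intf.
have mf := measurable_int _ intf.
rewrite integralE [in RHS]integralE muleBr//; last first.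
  rewrite fin_num_adde_defr// ge0_fin_numE; last exact: integral_ge0.
  exact: integral_funepos_lt_pinfty.
under [X in (_ = _ * X - _)%E]eq_integral do rewrite (funepos_comp f (fun x => c + x *m C)).
under [X in (_ = _ - _ * X)%E]eq_integral do rewrite (funeneg_comp f (fun x => c + x *m C)).
congr (_ - _)%E.
  apply: (@ge0_integral_rV_affine n c C f^\+%E) => //; exact: measurable_funepos.
apply: (@ge0_integral_rV_affine n c C f^\-%E) => //; exact: measurable_funeneg.
Qed.

Lemma negligible_rV_affine n (c : 'rV[R]_n) (C : 'M[R]_n) (N : set 'rV[R]_n) :
  C \in unitmx -> (lebesgue_rV R n).-negligible N ->
  (lebesgue_rV R n).-negligible ((fun x => c + x *m C) @^-1` N).
Proof.
move=> uC [A [mA A0 NA]].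
exists ((fun x => c + x *m C) @^-1` A); split => //.
- exact: measurable_preimage_affine.
- move: A0; rewrite -(lebesgue_rV_affine c uC mA) => /eqP.
  rewrite mule_eq0 => /orP[|/eqP//].
  by rewrite eqe normr_eq0 -[_ == 0]negbK -unitfE -unitmxE uC.
- by move=> x /NA.
Qed.

Lemma integrable_cons_rV n (f : 'rV[R]_n.+1 -> \bar R) :
  (lebesgue_rV R n.+1).-integrable setT f ->
  (lambda \x lebesgue_rV R n)%E.-integrable setT (f \o @cons_rV R n).
Proof.
move=> /integrableP[mf foo]; have mc := @measurable_cons_rV R n.
pose mu : {measure set (measurableTypeR R * 'rV[R]_n)%type -> \bar R} :=
  (lambda \x lebesgue_rV R n)%E.
apply/integrableP; split; first exact: measurableT_comp.
move: foo; congr (_ < _)%E.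
rewrite (@ge0_integral_pushforward _ _ _ _ R (@cons_rV R n) mc mu)//.
exact: measurableT_comp.
Qed.

Lemma integral_rV_fubini n (f : 'rV[R]_n.+1 -> \bar R) :
  (lebesgue_rV R n.+1).-integrable setT f ->
  (\int[lebesgue_rV R n.+1]_x f x =
   \int[lebesgue_rV R n]_x \int[lambda]_t f (cons_rV (t, x)))%E.
Proof.
move=> intf; have intc := integrable_cons_rV intf.
pose mu : {measure set (measurableTypeR R * 'rV[R]_n)%type -> \bar R} :=
  (lambda \x lebesgue_rV R n)%E.
rewrite [LHS](@integral_pushforward _ _ _ _ R _ (@measurable_cons_rV R n) mu)//.
  by rewrite preimage_setT -integral21_prod_meas1.
exact: measurable_int intf.
Qed.

Lemma measurable_rV_fubini n (f : 'rV[R]_n.+1 -> \bar R) :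
  (lebesgue_rV R n.+1).-integrable setT f ->
  measurable_fun setT (fun x : 'rV[R]_n => (\int[lambda]_t f (cons_rV (t, x)))%E).
Proof.
move=> /integrable_cons_rV.
exact: (measurable_fubini_G (m1 := lambda) (m2 := lebesgue_rV R n)).
Qed.

End lebesgue_rV_integral.

(** * Integration along a line cut at finitely many points *)

Section line_integral.
Context {R : realType}.

(** The points x such that D vanishes near x, except perhaps at x, form a closed
and open set: near any point D is constant up to the value at that point, and
two punctured neighbourhoods that overlap carry the same constant.  The set
contains all large x, and the line is connected. *)
Lemma eventually_zero_punctured (D : R -> R) (K : R) :
  (forall x, exists c, \forall y \near x^', D y = c) ->
  (forall y, K < y -> D y = 0) ->
  forall x, \forall y \near x^', D y = 0.
Proof.
move=> Dc DK.
pose E := [set x | \forall y \near x^', D y = 0].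
suff ET : E = setT by move=> x; have : E x by rewrite ET.
have near_ball (x c : R) : (\forall y \near x^', D y = c) ->
    exists2 e, 0 < e & forall x', ball x e x' -> \forall y \near x'^', D y = c.
  move=> /nbhs_ballP[e /= e0 he]; exists e => // x' xx'.
  have [->|x'x] := eqVneq x' x; first by apply/nbhs_ballP; exists e.
  apply/nbhs_ballP; exists (Num.min (e - `|x - x'|) `|x - x'|) => /=.
    rewrite lt_min subr_gt0 normr_gt0 subr_eq0 eq_sym x'x andbT.
    by move: xx'; rewrite -ball_normE.
  move=> y; rewrite -ball_normE /ball_/= lt_min => /andP[h1 h2] yx'.
  apply: he; rewrite -?ball_normE /ball_/=.
    rewrite (_ : x - y = (x - x') + (x' - y)); last by ring.
    by apply: le_lt_trans (ler_normD _ _) _; lra.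
  apply: contraTneq h2 => ->; rewrite distrC ltxx//.
have punctured_proper (x c c' : R) : (\forall y \near x^', D y = c) ->
    (\forall y \near x^', D y = c') -> c = c'.
  by move=> h1 h2; have [y [<- <-]] := @filter_ex _ _ (Proper_dnbhs_numFieldType x) _ (filterI h1 h2).
have cT : connected [set: R] by apply/connected_intervalP.
apply: cT.
- exists (K + 1); apply/nbhs_ballP; exists 1 => //= y.
  rewrite -ball_normE /ball_/= => h _; apply: DK; move: h; rewrite ltr_norml; lra.
- exists E; last by rewrite setTI.
  rewrite openE => x /= Ex; have [e e0 he] := near_ball _ _ Ex.
  by apply/nbhs_ballP; exists e.
- exists E; last by rewrite setTI.
  rewrite -openC openE => x /= Ex; have [c hc] := Dc x.
  have [e e0 he] := near_ball _ _ hc; apply/nbhs_ballP; exists e => //= x' /he hx'.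
  move=> Ex'; apply: Ex; rewrite /E/=.
  by rewrite -(punctured_proper _ _ _ hx' Ex').
Qed.

Variables (I : finType) (P : pred I) (t sg : I -> R) (S : set R).

(** The sign s is the outward normal of S at its end point x. *)
Definition crossing (s : R) (x : R) : Prop :=
  (s = 1 /\ (\forall y \near x^'-, S y) /\ (\forall y \near x^'+, ~ S y)) \/
  (s = -1 /\ (\forall y \near x^'-, ~ S y) /\ (\forall y \near x^'+, S y)).

Hypothesis locS : forall x, (forall i, P i -> t i != x) ->
  (\forall y \near x, S y) \/ (\forall y \near x, ~ S y).
Hypothesis injt : forall i j, P i -> P j -> t i = t j -> i = j.
Hypothesis crossS : forall i, P i -> crossing (sg i) (t i).

(** Away from the points t i both sides are locally constant, and at t i they have
the same jump.  Their difference is thus locally constant up to finitely many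
values, and it vanishes to the right of all crossings. *)
Lemma indic_crossings (K : R) : (forall y, S y -> y <= K) ->
  forall x, (forall i, P i -> t i != x) ->
  \1_S x = \sum_(i | P i) sg i * (x < t i)%R%:R :> R.
Proof.
move=> SK.
pose D x : R := \1_S x - \sum_(i | P i) sg i * (x < t i)%R%:R.
have step (i : I) x : t i != x -> \forall y \near x, (y < t i) = (x < t i).
  rewrite neq_lt => /orP[h|h].
    near=> y; rewrite (ltNge x) (ltW h) ltNge; apply/negbF/ltW; near: y.
    exact: lt_nbhsr.
  near=> y; rewrite h; near: y; exact: lt_nbhsl.
have sumc (Q : pred I) x : (forall i, Q i -> t i != x) -> \forall y \near x,
    \sum_(i | Q i) sg i * (y < t i)%R%:R = \sum_(i | Q i) sg i * (x < t i)%R%:R.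
  move=> h.
  have : \forall y \near x, forall i, Q i -> (y < t i) = (x < t i).
    apply: (@filter_forall R I (fun i y => Q i -> (y < t i) = (x < t i)) (nbhs x) _) => i.
    case: (boolP (Q i)) => [/h/step|_].
      by apply: filterS.
    by apply: nearW.
  by apply: filterS => y hy; apply: eq_bigr => i /hy ->.
have indc x : (\forall y \near x, S y) \/ (\forall y \near x, ~ S y) ->
    \forall y \near x, \1_S y = \1_S x :> R.
  case=> h; have hx := nbhs_singleton h; apply: filterS h => y Sy.
    by rewrite !indicE !mem_set.
  by rewrite !indicE !memNset.
have Dnohit x : (forall i, P i -> t i != x) -> \forall y \near x, D y = D x.
  move=> hx; have h1 := indc _ (locS hx); have h2 := sumc _ _ hx.
  by near=> y; rewrite /D (near h1)// (near h2).
have DK : forall y, Num.max K (\sum_(i | P i) `|t i|) < y -> D y = 0.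
  move=> y; rewrite gt_max => /andP[Ky ty].
  rewrite /D indicE memNset; last by move=> /SK; rewrite leNgt Ky.
  rewrite big1 ?subr0// => i Pi; rewrite ltNge (_ : t i <= y) ?mulr0//.
  apply: le_trans (ltW ty); apply: le_trans (ler_norm _) _.
  by rewrite (bigD1 i)//= lerDl sumr_ge0.
have D0 : forall x, \forall y \near x^', D y = 0.
  apply: eventually_zero_punctured DK => x.
  have [hx|] := pselect (forall i, P i -> t i != x).
    by exists (D x); apply: nbhs_dnbhs; exact: Dnohit.
  move=> /existsNP[i /not_implyP[Pi /negP/negPn/eqP tix]].
  have hother j : P j && (j != i) -> t j != x.
    by move=> /andP[Pj ji]; rewrite -tix; apply: contraNneq ji => /injt ->.
  have h2 := sumc (fun j => P j && (j != i)) x hother.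
  (* On both sides of t i the indicator minus the i-th term is 0 if S ends there,
     and 1 if S begins there. *)
  exists ((sg i == -1)%R%:R - \sum_(j | P j && (j != i)) sg j * (x < t j)%R%:R).
  have {}h2 := nbhs_dnbhs h2.
  suff h1 : \forall y \near x^', \1_S y - sg i * (y < t i)%R%:R = (sg i == -1)%R%:R :> R.
    near=> y; rewrite /D (bigD1 i)//= (near h2)// opprD addrA; congr (_ - _).
    by near: y.
  have N11 : (1 == -1 :> R) = false by apply/eqP => h; lra.
  have near_lt (Q : set R) : (\forall y \near x^'-, Q y) ->
    \forall y \near x^', y < x -> Q y by move=> h; exact: nbhs_dnbhs h.
  have near_gt (Q : set R) : (\forall y \near x^'+, Q y) ->
    \forall y \near x^', x < y -> Q y by move=> h; exact: nbhs_dnbhs h.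
  have := crossS Pi; rewrite tix.
  move=> -[] [sE [/near_lt hl /near_gt hr]]; rewrite {}sE.
    near=> y; rewrite N11.
    have : y != x by near: y; exact: nbhs_dnbhs_neq.
    rewrite neq_lt => /orP[yx|yx].
      rewrite yx indicE mem_set ?mulr1 ?subrr//.
      by move: yx; near: y.
    rewrite (ltNge y) (ltW yx) mulr0 subr0 indicE memNset//.
    by move: yx; near: y.
  near=> y; rewrite eqxx.
  have : y != x by near: y; exact: nbhs_dnbhs_neq.
  rewrite neq_lt => /orP[yx|yx].
    rewrite yx indicE memNset ?mulr1 ?opprK ?add0r//.
    by move: yx; near: y.
  rewrite (ltNge y) (ltW yx) mulr0 subr0 indicE mem_set//.
  by move: yx; near: y.
move=> x hx; apply/eqP; rewrite -subr_eq0; apply/eqP; rewrite -/(D x).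
have h1 := nbhs_dnbhs (Dnohit x hx).
have [y [<- <-]] := @filter_ex _ _ (Proper_dnbhs_numFieldType x) _ (filterI h1 (D0 x)).
by [].
Unshelve. all: by end_near. Qed.

End line_integral.

Section line_integral_crossings.
Context {R : realType}.
Local Notation lambda := (@lebesgue_measure R).

Lemma ftc_segment (f g : R -> R) (a b : R) : a <= b -> continuous g ->
  (forall x : R, is_derive x (1 : R) f (g x)) ->
  (\int[lambda]_(x in `[a, b]) (g x)%:E = (f b - f a)%:E)%E.
Proof.
rewrite le_eqVlt => /orP[/eqP -> _ _|ab cg dfg].
  by rewrite set_itv1 integral_set1 subrr.
have cf : continuous f.
  by move=> x; apply: differentiable_continuous; apply/derivable1_diffP; have [] := dfg x.
rewrite (@continuous_FTC2 _ g f)//.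
- exact: continuous_subspaceT.
- split; first by move=> x _; have [] := dfg x.
  + by apply: cvg_at_right_filter; exact: cf.
  + by apply: cvg_at_left_filter; exact: cf.
- by move=> x _; rewrite derive1E; apply: derive_val.
Qed.

(** Integrating the step function of [indic_crossings] from a point a to the left
of S and of all crossings gives the sum of sg i * (f (t i) - f a).  The terms
in f a cancel: the step function vanishes at a, so the signs sum to 0. *)
Lemma integral_crossings (I : finType) (P : pred I) (t sg : I -> R) (S : set R)
    (K : R) (f g : R -> R) :
  (forall x, (forall i, P i -> t i != x) ->
    (\forall y \near x, S y) \/ (\forall y \near x, ~ S y)) ->
  (forall i j, P i -> P j -> t i = t j -> i = j) ->
  (forall i, P i -> crossing S (sg i) (t i)) ->
  measurable (S : set (measurableTypeR R)) ->
  (forall y, S y -> `|y| <= K) ->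
  continuous g -> (forall x : R, is_derive x (1 : R) f (g x)) ->
  (\int[lambda]_x (\1_S x * g x)%:E = (\sum_(i | P i) sg i * f (t i))%:E)%E.
Proof.
move=> locS injt crossS mS SK cg dfg.
have indS := indic_crossings locS injt crossS (fun y Sy => le_trans (ler_norm y) (SK y Sy)).
pose a := - (`|K| + \sum_(i | P i) `|t i| + 1).
have at_ i : P i -> a < t i.
  move=> Pi; rewrite /a (bigD1 i)//=; set s := \sum_(_ | _) _.
  have : 0 <= s by exact: sumr_ge0.
  have := normr_ge0 K; have := ler_norm (- t i); rewrite normrN; lra.
have aS x : S x -> a < x.
  move=> /SK Sx; have : 0 <= \sum_(i | P i) `|t i| by exact: sumr_ge0.
  have := ler_norm K; have := ler_norm (- x); rewrite normrN /a; lra.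
have sum0 : \sum_(i | P i) sg i = 0.
  have := indS a; rewrite indicE memNset; last by move=> /aS; rewrite ltxx.
  rewrite (eq_bigr sg) => [|i Pi]; last by rewrite at_// mulr1.
  by move=> <-// i Pi; rewrite gt_eqF// at_.
have intg i : lambda.-integrable setT (fun x => (sg i * (\1_`[a, t i] x * g x))%:E).
  under eq_fun do rewrite EFinM.
  apply: integrableZl => //.
  rewrite (_ : (fun x => _) = (EFin \o g) \_ `[a, t i]).
    rewrite -integrable_mkcond; last exact: measurable_itv.
    apply: continuous_compact_integrable; first exact: segment_compact.
    exact: continuous_subspaceT.
  apply/funext => x; rewrite patchE indicE; case: ifP => _; rewrite ?mul1r ?mul0r//.
transitivity (\int[lambda]_x (\sum_(i | P i) (sg i * (\1_`[a, t i] x * g x))%:E)%E)%E.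
  apply: ae_eq_integral => //.
  - apply/measurable_EFinP; apply: measurable_funM => //.
    exact: continuous_measurable_fun.
  - by apply: (measurable_int lambda); apply: integrable_sum.
  (* The integrands agree except at the finitely many crossings. *)
  exists (t @` [set i | P i]); split.
  - apply: countable_measurable => [//|]; apply: finite_set_countable.
    exact: finite_image.
  - apply: countable_lebesgue_measure0; apply: finite_set_countable.
    exact: finite_image.
  move=> x /= /not_implyP[_ neq]; apply: contrapT => nhit; apply: neq.
  have hx i : P i -> t i != x.
    by move=> Pi; apply: contra_notN nhit => /eqP <-; exists i.
  rewrite sumEFin; congr EFin.
  have [xa|ax] := ltP x a.
    rewrite indicE memNset; last by move=> /aS; rewrite ltNge (ltW xa).
    rewrite mul0r big1// => i Pi; rewrite indicE memNset ?mul0r ?mulr0//=.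
    by rewrite in_itv/= leNgt xa.
  rewrite indS// mulr_suml; apply: eq_bigr => i Pi; rewrite mulrA; congr (_ * _ * _).
  rewrite indicE; congr (_%:R); rewrite (_ : (x \in _) = (x \in `[a, t i])).
    by rewrite in_itv/= ax le_eqVlt eq_sym (negbTE (hx _ Pi)).
  by rewrite mem_setE.
rewrite integral_sum//.
transitivity (\sum_(i | P i) (sg i * (f (t i) - f a))%:E)%E.
  apply: eq_bigr => i Pi.
  transitivity (\int[lambda]_x ((sg i)%:E * ((EFin \o g) \_ `[a, t i]) x))%E.
    apply: eq_integral => x _; rewrite patchE indicE.
    by case: ifP => _; rewrite ?mul1r ?mul0r ?mulr0 ?mule0 -?EFinM.
  rewrite integralZl//; last first.
    rewrite -integrable_mkcond; last exact: measurable_itv.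
    apply: continuous_compact_integrable; first exact: segment_compact.
    exact: continuous_subspaceT.
  by rewrite -integral_mkcond (ftc_segment (ltW (at_ _ Pi)) cg dfg) -EFinM.
rewrite sumEFin; congr EFin.
under eq_bigr do rewrite mulrBr.
by rewrite sumrB -mulr_suml sum0 mul0r subr0.
Qed.

End line_integral_crossings.

(** * Orthonormal frames and affine maps *)

Section orthonormal_frames.
Context {R : realType}.

Lemma dotvE n (x y : 'rV[R]_n) : dotv x y = (x *m y^T) ord0 ord0.
Proof. by rewrite /dotv !mxE; apply: eq_bigr => i _; rewrite mxE. Qed.

Lemma dotvDl n (x y z : 'rV[R]_n) : dotv (x + y) z = dotv x z + dotv y z.
Proof. by rewrite !dotvE mulmxDl mxE. Qed.

Lemma dotvBl n (x y z : 'rV[R]_n) : dotv (x - y) z = dotv x z - dotv y z.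
Proof. by rewrite !dotvE mulmxBl !mxE. Qed.

Lemma dotvZl n (a : R) (x z : 'rV[R]_n) : dotv (a *: x) z = a * dotv x z.
Proof. by rewrite !dotvE -scalemxAl mxE. Qed.

Lemma dotvC n (x y : 'rV[R]_n) : dotv x y = dotv y x.
Proof. by rewrite /dotv; apply: eq_bigr => i _; rewrite mulrC. Qed.

Lemma dotv_delta n (x : 'rV[R]_n) j : dotv (delta_mx ord0 j) x = x ord0 j.
Proof.
rewrite /dotv (bigD1 j)//= big1 ?addr0; first by rewrite mxE !eqxx mul1r.
by move=> i ij; rewrite mxE eqxx (negbTE ij) mul0r.
Qed.

Variables (n : nat) (e : 'rV[R]_n.+1) (B : 'M[R]_(n, n.+1)).
Hypothesis eB : @orthonormal_frame R n.+1 e B.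
Let O : 'M[R]_(1 + n) := @col_mx R 1 n n.+1 e B.

Let eeT : e *m e^T = 1%:M.
Proof.
by case: eB => h _ _; apply/matrixP => i j; rewrite !ord1 -dotvE h mxE.
Qed.

Let OOT : O *m O^T = 1%:M.
Proof.
rewrite /O (@tr_col_mx _ 1 n (1 + n)) mul_col_row; case: eB => _ BB eB0.
have Be : B *m e^T = 0 by rewrite -[LHS]trmxK trmx_mul trmxK eB0 trmx0.
by rewrite eeT Be [e *m _]eB0 [B *m _]BB -scalar_mx_block.
Qed.

Lemma dotv_frame (y : 'rV[R]_n) : dotv (y *m B) e = 0.
Proof.
case: eB => _ _ eB0.
by rewrite dotvC dotvE trmx_mul mulmxA [e *m _]eB0 mul0mx mxE.
Qed.

Lemma frame_decomposition (w : 'rV[R]_n.+1) : w = dotv w e *: e + (w *m B^T) *m B.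
Proof.
have OTO : O^T *m O = 1%:M by exact: mulmx1C.
rewrite -[LHS]mulmx1 -OTO mulmxA /O (@tr_col_mx _ 1 n (1 + n)) mul_mx_row.
rewrite (@mul_row_col _ 1 1 n (1 + n)); congr (_ + _).
rewrite -mul_scalar_mx dotvE; congr (_ *m _).
by apply/matrixP => i j; rewrite !ord1 [RHS]mxE.
Qed.

Lemma det_frame : `|\det O| = 1.
Proof.
have := congr1 determinant OOT; rewrite det_mulmx det_tr det1 => h.
by apply/eqP; rewrite -sqrp_eq1// -normrX expr2 h normr1.
Qed.

(** Expanding u in the orthonormal basis (e, B) factors the matrix into a block
triangular one, with diagonal blocks dotv u e and 1, and an orthogonal one. *)
Lemma det_col_frame (u : 'rV[R]_n.+1) :
  `|\det (@col_mx R 1 n n.+1  u B)| = `|dotv u e|.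
Proof.
have -> : @col_mx R 1 n n.+1 u B =
    block_mx (dotv u e)%:M (u *m B^T) 0 1%:M *m O.
  rewrite /O mul_block_col !mul_scalar_mx mul0mx add0r scale1r.
  by rewrite -frame_decomposition.
by rewrite det_mulmx det_ublock det1 mulr1 det_scalar1 normrM det_frame mulr1.
Qed.

End orthonormal_frames.

Section affine_topology.
Context {R : realType}.

Lemma continuous_coord n (i : 'I_n) : continuous (fun x : 'rV[R]_n => x ord0 i).
Proof. exact: coord_continuous. Qed.

Lemma continuous_rV_affine n m (c : 'rV[R]_m) (B : 'M[R]_(n, m)) :
  continuous (fun x : 'rV[R]_n => c + x *m B).
Proof.
under eq_fun do rewrite mulmx_sum_row.
move=> x; apply: continuousD; first exact: cst_continuous.
apply: continuous_big => [|i _]; first exact: add_continuous.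
by move=> y; apply: continuousZr_tmp; exact: coord_continuous.
Qed.

Lemma continuous_line n (a v : 'rV[R]_n) : continuous (fun s : R => a + s *: v).
Proof.
move=> s; apply: (@continuousD R 'rV[R]_n R (fun=> a) (fun s => s *: v)).
  exact: cst_continuous.
by apply: continuousZr_tmp; exact: cvg_id.
Qed.

Lemma continuous_dotv n (a e : 'rV[R]_n) : continuous (fun x : 'rV[R]_n => dotv (x - a) e).
Proof.
rewrite (_ : (fun x => _) =
    (fun y : 'rV[R]_1 => y ord0 ord0) \o (fun x => - (a *m e^T) + x *m e^T)); last first.
  by apply/funext => x /=; rewrite dotvE mulmxBl addrC.
by move=> x; apply: continuous_comp; [exact: continuous_rV_affine|exact: continuous_coord].
Qed.

Lemma open_boundary n (T : set 'rV[R]_n) : open T -> boundary T = closure T `\` T.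
Proof. by move=> /interior_id oT; rewrite /boundary oT. Qed.

(** The parameters at which the segment is in T form a subset of [0, 1] which is
open because T is, and closed because a point of the closure of T that is not
in T is on the boundary. *)
Lemma segment_avoiding_boundary n (T : set 'rV[R]_n) (a b : 'rV[R]_n) :
  open T -> T a -> (forall s, 0 <= s <= 1 -> ~ boundary T (a + s *: (b - a))) -> T b.
Proof.
move=> oT Ta hseg; pose p s := a + s *: (b - a).
have cp : continuous p by exact: continuous_line.
pose E := [set s | `[0, 1]%classic s /\ T (p s)].
have EI : E = `[0, 1]%classic.
  apply: (@segment_connected R 0 1).
  - by exists 0; split; rewrite /= ?in_itv/= ?lexx ?ler01// /p scale0r addr0.
  - exists (p @^-1` T); first by apply: open_comp => // s _; exact: cp.
    by apply/seteqP; split.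
  - exists (p @^-1` closure T).
      by apply: closed_comp => [s _|]; [exact: cp|exact: closed_closure].
    apply/seteqP; split => s [sI Ts]; split => //; first exact: subset_closure.
    apply: contrapT => nTs; move: sI; rewrite /= in_itv/= => /hseg; apply.
    by rewrite open_boundary.
have : E 1 by rewrite EI /= in_itv/= lexx ler01.
by rewrite /E/= /p scale1r addrC subrK => -[].
Qed.

End affine_topology.

(** * Geometry of a cell near its faces *)

Lemma bounded_setP {R : realType} n (D : set 'rV[R]_n) :
  bounded_set D <-> exists K, forall x, D x -> `|x| <= K.
Proof.
split=> [[K [_ DK]]|[K DK]].
  by exists (K + 1) => x Dx; apply: (DK (K + 1)) => //; rewrite ltrDl.
by exists K; split; [exact: num_real|move=> y Ky x /DK /le_trans; apply; exact: ltW].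
Qed.

Lemma bounded_closure {R : realType} n (D : set 'rV[R]_n) :
  bounded_set D -> bounded_set (closure D).
Proof.
move=> /bounded_setP[K DK]; apply/bounded_setP; exists (K + 1) => x.
move=> /(_ (ball x 1) (nbhsx_ballx _ _ ltr01)) [y [/DK yK]].
rewrite mx_norm_ball /ball_/= => xy.
rewrite -[x](subrK y); apply: le_trans (ler_normD _ _) _.
by rewrite addrC lerD// ltW.
Qed.

Section cell_geometry.
Context {R : realType} (n : nat) (Om : set 'rV[R]_n.+1) (M : mesh R n.+1).
Hypothesis tess : polytopal_tessellation Om M.
Variable T : cell_ix M.

Lemma cell_open : open (cell T).
Proof.
by case: (cell_polytope tess T) => _ _ [N [p [_ ->]]]; exact: open_interior.
Qed.

Lemma cell_bounded : bounded_set (cell T).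
Proof.
case: (cell_polytope tess T) => _ _ [N [p [_ ->]]]; apply/bounded_setP.
exists (\sum_i \sum_l `|p i l|) => x /interior_subset[i _ [t [t0 _ t1 ->]]].
apply: (@le_trans _ _ (\sum_l `|p i l|)); last first.
  by rewrite (bigD1 i)//= lerDl sumr_ge0// => j _; exact: sumr_ge0.
apply: le_trans (ler_norm_sum _ _ _) _; apply: ler_sum => l _.
rewrite normrZ ger0_norm// ler_piMl//.
by rewrite -t1 (bigD1 l)//= lerDl sumr_ge0.
Qed.

Variable F : face_ix M.
Hypothesis FT : face_of T F.

Lemma face_in_closure : face F `<=` closure (cell T).
Proof. by move=> x; move: FT => /asboolP FT' /FT'[]. Qed.

Lemma face_frame : orthonormal_frame (fnormal T F) (fframe F).
Proof. by case: (face_normal tess FT). Qed.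

Lemma fchartE x : face F x -> exists y, x = fchart F y.
Proof. by case: (face_hyperplanar tess F) => _ h /h[y _ <-]; exists y. Qed.

Lemma fchart_coord y : y = (fchart F y - fbase F) *m (fframe F)^T.
Proof.
rewrite /fchart (addrC (fbase F)) addrK -mulmxA.
by case: (face_hyperplanar tess F) => -> _; rewrite mulmx1.
Qed.

Lemma fchart_continuous : continuous (@fchart R n.+1 M F).
Proof. exact: continuous_rV_affine. Qed.

Lemma fdom_closed : closed (fdom F).
Proof.
apply: closed_comp => [y _|]; first exact: fchart_continuous.
exact: face_closed tess F.
Qed.

(** The frame has orthonormal rows, so the chart coordinates of a point depend on
it linearly. *)
Lemma fdom_bounded : bounded_set (fdom F).
Proof.
have /bounded_setP[K TK] := bounded_closure cell_bounded.
apply/bounded_setP.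
exists ((K + `|fbase F|) * \sum_i \sum_j `|(fframe F)^T i j|) => y Fy.
have bd x : face F x -> forall i, `|(x - fbase F) ord0 i| <= K + `|fbase F|.
  move=> /face_in_closure /TK xK i.
  apply: (@le_trans _ _ `|x - fbase F|).
    rewrite [leRHS]/Num.norm/= mx_normrE.
    by apply/bigmax_geP; right => /=; exists (ord0, i).
  by apply: le_trans (ler_normB _ _) _; rewrite lerD2r.
have K0 : 0 <= K + `|fbase F|.
  exact: le_trans (normr_ge0 _) (bd _ Fy ord0).
rewrite [leLHS]/Num.norm/= mx_normrE; apply/bigmax_leP; split.
  by apply: mulr_ge0 => //; apply: sumr_ge0 => i _; exact: sumr_ge0.
move=> -[i j] _ /=; rewrite ord1 (fchart_coord y) mxE.
apply: le_trans (ler_norm_sum _ _ _) _; rewrite mulr_sumr.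
apply: ler_sum => l _; rewrite normrM; apply: ler_pM => //; first exact: bd.
by rewrite (bigD1 j)//= lerDl sumr_ge0.
Qed.

End cell_geometry.
Arguments cell_open {R n Om M} tess T.
Arguments fdom_closed {R n Om M} tess F.

Section half_space.
Context {R : realType} (n : nat) (Om : set 'rV[R]_n.+1) (M : mesh R n.+1).
Hypothesis tess : polytopal_tessellation Om M.
Variable T : cell_ix M.

(** Near such a point of F the boundary of T is contained in the hyperplane of F,
and T lies on one side of it. *)
Definition regular_face_point (F : face_ix M) (y : 'rV[R]_n) : Prop :=
  (forall F', F' != F -> ~ face F' (fchart F y)) /\
  \forall e \near 0^'+, cell T (fchart F y - e *: fnormal T F) /\
                        ~ cell T (fchart F y + e *: fnormal T F).

Variable F : face_ix M.
Hypothesis FT : face_of T F.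

Lemma ae_regular_face_point :
  \forall y \ae lebesgue_rV R n, fdom F y -> regular_face_point F y.
Proof.
have h1 : \forall y \ae lebesgue_rV R n, forall F', F' != F -> fdom F y ->
    ~ face F' (fchart F y).
  apply: filter_forall => F'; have [->|F'F] := eqVneq F' F.
    by apply: aeW.
  have : surface_null F (face F') by apply: (face_overlap tess); rewrite eq_sym.
  apply: negligibleS => y /= h; split; apply: contrapT => h'; exact: h.
have h2 : \forall y \ae lebesgue_rV R n, fdom F y ->
    \forall e \near 0^'+, cell T (fchart F y - e *: fnormal T F) /\
                          ~ cell T (fchart F y + e *: fnormal T F).
  case: (face_normal tess FT) => _; apply: negligibleS => y /= /not_implyP[Fy h].
  by split.
by apply: filterS2 h1 h2 => y h1 h2 Fy; split; [move=> F' /h1; exact|exact: h2].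
Qed.

(** In a small ball the boundary of T is contained in the hyperplane of F.  Each
open half of the ball is convex and avoids the boundary, so it is in T as soon
as one of its points is; the points on the normal line decide. *)
Lemma face_half_space y : fdom F y -> regular_face_point F y ->
  exists2 r, 0 < r & forall z, ball (fchart F y) r z ->
    (dotv (z - fchart F y) (fnormal T F) < 0 -> cell T z) /\
    (0 < dotv (z - fchart F y) (fnormal T F) -> ~ cell T z).
Proof.
move=> Fy [notF' normF]; set x := fchart F y; set nu := fnormal T F.
have oT : open (cell T) by exact: (cell_open tess T).
have [r /= r0 hr] : exists2 r, 0 < r & ball x r `<=`
    [set z | forall F', F' != F -> ~ face F' z].
  apply/nbhs_ballP.
  apply: (@filter_forall _ _ (fun F' z => F' != F -> ~ face F' z) (nbhs x) _) => F'.
  have [->|F'F] := eqVneq F' F; first by apply: nearW.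
  suff : nbhs x (~` face F') by apply: filterS => z.
  apply: open_nbhs_nbhs; split; last exact: notF'.
  by apply: closed_openC; exact: face_closed tess F'.
have avoid z : ball x r z -> dotv (z - x) nu != 0 -> ~ boundary (cell T) z.
  move=> xz; apply: contra_neq_not; rewrite (face_cover tess) => -[F' _ F'z].
  have [F'E|F'F] := eqVneq F' F; last by case: (hr z xz F' F'F).
  move: F'z; rewrite F'E => /(fchartE tess)[y' ->].
  rewrite /x /fchart opprD addrACA subrr add0r -mulmxBl.
  exact: dotv_frame (face_frame tess FT) _.
have conv (z0 z : 'rV[R]_n.+1) (s : R) : ball x r z0 -> ball x r z -> 0 <= s <= 1 ->
    ball x r (z0 + s *: (z - z0)).
  rewrite !mx_norm_ball /ball_/= => h0 h1 /andP[s0 s1].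
  have -> : x - (z0 + s *: (z - z0)) = (1 - s) *: (x - z0) + s *: (x - z).
    by apply/rowP => i; rewrite !mxE; ring.
  apply: le_lt_trans (ler_normD _ _) _; rewrite !normrZ !ger0_norm ?subr_ge0//.
  move: s1; rewrite le_eqVlt => /orP[/eqP ->|s1].
    by rewrite subrr mul0r add0r mul1r.
  have : (1 - s) * `|x - z0| < (1 - s) * r by rewrite ltr_pM2l// subr_gt0.
  have : s * `|x - z| <= s * r by rewrite ler_wpM2l// ltW.
  lra.
have dot_seg (z0 z : 'rV[R]_n.+1) (s : R) :
    dotv (z0 + s *: (z - z0) - x) nu = (1 - s) * dotv (z0 - x) nu + s * dotv (z - x) nu.
  rewrite (_ : z0 + s *: (z - z0) - x = (1 - s) *: (z0 - x) + s *: (z - x)).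
    by rewrite [LHS]dotvDl !dotvZl.
  by apply/rowP => i; rewrite !mxE; ring.
have nn : dotv nu nu = 1 by case: (face_frame tess FT).
have nearr (v : 'rV[R]_n.+1) : \forall e \near (0 : R)^'+, ball x r (x + e *: v).
  have : (fun e : R => x + e *: v) @ (0 : R)^'+ --> x + 0 *: v.
    by apply: cvg_at_right_filter; exact: continuous_line.
  by rewrite scale0r addr0 => h; exact: (h (ball x r) (nbhsx_ballx _ _ r0)).
have [e [[[Tm nTp] [bm bp]] e0]] : exists e : R,
    (((cell T (x - e *: nu)) /\ ~ cell T (x + e *: nu)) /\
    ball x r (x + e *: - nu) /\ ball x r (x + e *: nu)) /\ 0 < e.
  apply: (@filter_ex _ (0 : R)^'+).
  apply: filterI; last exact: nbhs_right_gt.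
  by apply: filterI => //; apply: filterI; exact: nearr.
rewrite scalerN in bm.
have dm : dotv (x - e *: nu - x) nu = - e.
  by rewrite addrAC subrr add0r -scaleNr dotvZl nn mulr1.
have dp : dotv (x + e *: nu - x) nu = e.
  by rewrite addrAC subrr add0r dotvZl nn mulr1.
exists r => // z xz; split => [zneg|zpos].
  apply: (segment_avoiding_boundary oT Tm) => s s01; apply: avoid; first exact: conv.
  rewrite dot_seg dm lt_eqF//; case/andP: s01 => s0 s1.
  have : (1 - s) * - e <= 0 by rewrite mulrN oppr_le0 mulr_ge0 ?subr_ge0// ltW.
  move: s0; rewrite le_eqVlt => /orP[/eqP <-|s0].
    by rewrite subr0 mul1r mul0r addr0 oppr_lt0.
  have : s * dotv (z - x) nu < 0 by rewrite pmulr_rlt0.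
  lra.
move=> Tz; apply: nTp.
apply: (segment_avoiding_boundary oT Tz) => s s01; apply: avoid; first exact: conv.
rewrite dot_seg dp gt_eqF//; case/andP: s01 => s0 s1.
have : 0 <= s * e by rewrite mulr_ge0// ltW.
move: s1; rewrite le_eqVlt => /orP[/eqP ->|s1].
  by rewrite subrr mul0r mul1r add0r.
have : 0 < (1 - s) * dotv (z - x) nu by rewrite mulr_gt0// subr_gt0.
lra.
Qed.

End half_space.

(** * Lines crossing a cell *)

Section divergence_along_lines.
Context {R : realType} (n : nat) (Om : set 'rV[R]_n.+1) (M : mesh R n.+1).
Local Notation mu := (lebesgue_rV R).
Hypothesis tess : polytopal_tessellation Om M.
Variables (T : cell_ix M) (u : 'rV[R]_n.+1) (Qd : 'M[R]_(n, n.+1)).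
Let Q : 'M[R]_(1 + n) := @col_mx R 1 n n.+1 u Qd.
Hypothesis detQ : `|\det Q| = 1.

Definition line_pt (z : 'rV[R]_n) (t : R) : 'rV[R]_n.+1 := z *m Qd + t *: u.

Lemma cons_rV_mul t (z : 'rV[R]_n) : cons_rV (t, z) *m Q = line_pt z t.
Proof.
rewrite /cons_rV/= /Q (@mul_row_col _ 1 1 n (1 + n)) addrC; congr (_ + _).
rewrite -mul_scalar_mx; congr (_ *m _).
by apply/matrixP => a b; rewrite !ord1 !mxE.
Qed.

Definition slope (F : face_ix M) : R := dotv u (fnormal T F).

Let K (F : face_ix M) : 'M[R]_(1 + n) := invmx (@col_mx R 1 n n.+1 u (fframe F)).

(** A line of direction u transverse to F meets the hyperplane of F in one point.
The matrix K F, which inverts the basis (u, frame of F), yields the parameter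
of this point on the line and its chart coordinates, both affine in z. *)
Definition hit_chart (F : face_ix M) : 'M[R]_n := @rsubmx R n 1 n (Qd *m K F).
Definition hit_base (F : face_ix M) : 'rV[R]_n := - @rsubmx R 1 1 n (fbase F *m K F).
Definition hit_coord (F : face_ix M) (z : 'rV[R]_n) : 'rV[R]_n :=
  hit_base F + z *m hit_chart F.
Definition hit_time (F : face_ix M) (z : 'rV[R]_n) : R :=
  - (@lsubmx R 1 1 n ((z *m Qd - fbase F) *m K F)) ord0 ord0.

Section one_face.
Variable F : face_ix M.
Hypothesis (FT : face_of T F) (slopeF : slope F != 0).

Let frameF := face_frame tess FT.

Let unitK : @col_mx R 1 n n.+1 u (fframe F) \in unitmx.
Proof. by rewrite unitmxE unitfE -normr_eq0 (det_col_frame frameF) normr_eq0. Qed.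

Lemma hit_coordE z : hit_coord F z = @rsubmx R 1 1 n ((z *m Qd - fbase F) *m K F).
Proof.
rewrite /hit_coord /hit_base /hit_chart mulmxBl -mulmxA addrC.
by apply/rowP => i; rewrite !mxE; congr (_ - _); apply: eq_bigr => k _; rewrite !mxE.
Qed.

Lemma line_hits_face z t y :
  line_pt z t = fchart F y <-> t = hit_time F z /\ y = hit_coord F z.
Proof.
have E : line_pt z t = fchart F y <->
    (z *m Qd - fbase F) *m K F = row_mx (- t)%:M y.
  have EK : row_mx (- t)%:M y *m @col_mx R 1 n n.+1 u (fframe F) = - t *: u + y *m fframe F.
    by rewrite mul_row_col mul_scalar_mx.
  split=> h.
    rewrite -[RHS]mulmx1 -(mulmxV unitK) mulmxA EK; congr (_ *m _).
    move: h; rewrite /line_pt /fchart => h.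
    rewrite scaleNr addrC -[z *m Qd](addrK (t *: u)) h.
    by apply/rowP => i; rewrite !mxE; ring.
  have := congr1 (mulmx^~ (@col_mx R 1 n n.+1 u (fframe F))) h.
  rewrite /= -mulmxA mulVmx// mulmx1 EK /line_pt /fchart => h'.
  rewrite -[z *m Qd](subrK (fbase F)) h' scaleNr.
  by apply/rowP => i; rewrite !mxE; ring.
rewrite E hit_coordE /hit_time; split=> [->|[-> ->]].
  by rewrite row_mxKl row_mxKr mxE opprK.
rewrite opprK -[LHS]hsubmxK; congr row_mx.
by apply/matrixP => a b; rewrite !ord1 [RHS]mxE.
Qed.

(** The projection along u contracts the areas of F by the factor |slope F|, and
[hit_coord] inverts that projection. *)
Lemma det_hit_chart : `|\det (hit_chart F)| = `|slope F|^-1.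
Proof.
have E : Q *m K F = block_mx 1%:M 0 (@lsubmx R n 1 n (Qd *m K F)) (hit_chart F).
  rewrite /Q (@mul_col_mx _ 1 n (1 + n)) block_mxEv; congr col_mx; last by rewrite hsubmxK.
  have : @col_mx R 1 n n.+1 u (fframe F) *m K F = 1%:M by rewrite mulmxV.
  by rewrite (@mul_col_mx _ 1 n (1 + n)) (@scalar_mx_block _ 1 n) block_mxEv => /(@eq_col_mx _ 1 n)[].
have := congr1 (fun A => `|\det A|) E.
rewrite /= det_mulmx det_lblock det1 mul1r => <-.
by rewrite normrM detQ mul1r det_inv normfV (det_col_frame frameF).
Qed.

Lemma hit_chart_unit : hit_chart F \in unitmx.
Proof.
by rewrite unitmxE unitfE -normr_eq0 det_hit_chart invr_eq0 normr_eq0.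
Qed.

End one_face.

(** The condition under which the line crosses the boundary of T transversally and
one face at a time. *)
Definition regular_line (z : 'rV[R]_n) : Prop := forall F, face_of T F ->
  (slope F = 0 -> forall t, ~ face F (line_pt z t)) /\
  (slope F != 0 -> fdom F (hit_coord F z) -> regular_face_point T F (hit_coord F z)).

(** A face parallel to u is projected along u into a hyperplane, which is null.
For a transverse face, the lines hitting it at a bad point are the preimage of
a null set by an invertible affine map. *)
Lemma ae_regular_line : \forall z \ae mu n, regular_line z.
Proof.
apply: filter_forall => F.
have [FT|nFT] := boolP (face_of T F); last by apply: aeW.
have [s0|s0] := eqVneq (slope F) 0.
  pose a := Qd *m (fnormal T F)^T.
  have a0 : a != 0.
    apply/eqP => a0; have : Q *m (fnormal T F)^T = 0.
      rewrite /Q (@mul_col_mx _ 1 n (1 + n)) -/a a0.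
      rewrite (_ : u *m _ = 0) ?col_mx0//.
      by apply/matrixP => p q; rewrite !ord1 -dotvE [RHS]mxE.
    have uQ : Q \in unitmx by rewrite unitmxE unitfE -normr_eq0 detQ oner_eq0.
    move=> /(congr1 (mulmx (invmx Q))); rewrite mulmxA mulVmx// mul1mx mulmx0 => /eqP.
    rewrite trmx_eq0 => /eqP n0.
    case: (face_frame tess FT) => h _ _; move: h; rewrite dotvE n0 mul0mx mxE.
    by move/eqP; rewrite eq_sym oner_eq0.
  exists [set z | (z *m a) ord0 ord0 = dotv (fbase F) (fnormal T F)]; split.
  - exact: measurable_rV_hyperplane.
  - exact: lebesgue_rV_hyperplane.
  move=> z /= /not_implyP[_ h]; apply: contrapT => hz; apply: h; split => // _ t Ft.
  apply: hz; have [y] := fchartE tess Ft; rewrite /line_pt /fchart => h.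
  rewrite /a mulmxA -dotvE -[z *m Qd](addrK (t *: u)) h dotvBl dotvDl.
  by rewrite (dotv_frame (face_frame tess FT)) dotvZl -/(slope F) s0 mulr0 addr0 subr0.
have := negligible_rV_affine (hit_base F) (hit_chart_unit FT s0) (ae_regular_face_point tess FT).
apply: negligibleS => z /= /not_implyP[_ h].
move=> hz; apply: h; split=> [s0'|_ Fz]; first by rewrite s0' eqxx in s0.
exact: hz.
Qed.

End divergence_along_lines.

(** * The divergence theorem on a cell *)

Lemma continuous_bounded_on {R : realType} n (D : set 'rV[R]_n) (f : 'rV[R]_n -> R) :
  bounded_set D -> continuous f -> exists K, forall x, D x -> `|f x| <= K.
Proof.
move=> bD cf.
have cD : compact (closure D).
  by apply: bounded_closed_compact; [exact: bounded_closure|exact: closed_closure].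
have : compact (f @` closure D).
  by apply: continuous_compact => //; exact: continuous_subspaceT.
move=> /compact_bounded[K [_ hK]]; exists (K + 1) => x Dx.
apply: (hK (K + 1)); first by rewrite ltrDl.
by exists x => //; exact: subset_closure.
Qed.

Lemma continuous_integrable_rV {R : realType} n (D : set 'rV[R]_n) (f : 'rV[R]_n -> R) :
  measurable D -> bounded_set D -> continuous f ->
  (lebesgue_rV R n).-integrable D (EFin \o f).
Proof.
move=> mD bD cf; apply: measurable_bounded_integrable => //.
- exact: bounded_lebesgue_rV_lty.
- by apply: measurable_funTS; exact: continuous_measurable_rV.
have [K hK] := continuous_bounded_on bD cf.
exists K; split; first exact: num_real.
by move=> y Ky x /= /hK /le_trans; apply; exact: ltW.
Qed.

Section divergence_theorem_direction.
Context {R : realType} (n : nat) (Om : set 'rV[R]_n.+1) (M : mesh R n.+1).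
Local Notation lambda := (@lebesgue_measure R).
Local Notation mu := (lebesgue_rV R).
Hypothesis tess : polytopal_tessellation Om M.
Variables (T : cell_ix M) (u : 'rV[R]_n.+1) (Qd : 'M[R]_(n, n.+1)).
Hypothesis detQ : `|\det (@col_mx R 1 n n.+1 u Qd)| = 1.
Variables (f g : 'rV[R]_n.+1 -> R).
Hypotheses (cf : continuous f) (cg : continuous g).
Hypothesis dfg : forall x (s : R),
  is_derive s (1 : R) (fun t : R => f (x + t *: u)) (g (x + s *: u)).

(** Along the line, the signed distance to the hyperplane of F is
(t - hit_time) * slope, so [face_half_space] tells on which side of the hitting
time the line is in T. *)
Lemma regular_line_crossing z F : regular_line T u Qd z -> face_of T F ->
  slope T u F != 0 -> fdom F (hit_coord u Qd F z) ->
  crossing [set t | cell T (line_pt u Qd z t)] (Num.sg (slope T u F)) (hit_time u Qd F z).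
Proof.
move=> rz FT sF Fz; have [_ /(_ sF Fz) regF] := rz F FT.
have [r r0 hr] := face_half_space tess FT Fz regF.
set t0 := hit_time u Qd F z.
have hx : line_pt u Qd z t0 = fchart F (hit_coord u Qd F z).
  exact/(line_hits_face tess Qd FT sF).
rewrite -{}hx in hr.
have dotl t : dotv (line_pt u Qd z t - line_pt u Qd z t0) (fnormal T F) = (t - t0) * slope T u F.
  rewrite /line_pt opprD addrACA subrr add0r -scalerBl.
  exact: dotvZl.
have nb : \forall t \near t0, ball (line_pt u Qd z t0) r (line_pt u Qd z t).
  exact: (@continuous_line R _ (z *m Qd) u t0 (ball _ r) (nbhsx_ballx _ _ r0)).
have nl (P : R -> Prop) : (forall t, t < t0 -> ball (line_pt u Qd z t0) r (line_pt u Qd z t) -> P t) ->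
    \forall t \near t0^'-, P t.
  move=> h; rewrite near_withinE; apply: filterS nb => t tb tt0; exact: h.
have nr (P : R -> Prop) : (forall t, t0 < t -> ball (line_pt u Qd z t0) r (line_pt u Qd z t) -> P t) ->
    \forall t \near t0^'+, P t.
  move=> h; rewrite near_withinE; apply: filterS nb => t tb tt0; exact: h.
have [s0|s0|s0] := ltgtP (slope T u F) 0; last by rewrite s0 eqxx in sF.
  right; rewrite ltr0_sg//; split=> //; split.
    apply: nl => t tt0 /hr[_]; apply; rewrite dotl nmulr_lgt0// subr_lt0//.
  apply: nr => t tt0 /hr[+ _]; apply; rewrite dotl nmulr_llt0// subr_gt0//.
left; rewrite gtr0_sg//; split=> //; split.
  apply: nl => t tt0 /hr[+ _]; apply; rewrite dotl pmulr_llt0// subr_lt0//.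
apply: nr => t tt0 /hr[_]; apply; rewrite dotl pmulr_lgt0// subr_gt0//.
Qed.

(** Between crossings the line avoids the boundary of T, hence stays locally in T
or out of T; distinct faces are crossed at distinct times because a regular
point lies on a single face. *)
Lemma regular_line_integral z : regular_line T u Qd z ->
  (\int[lambda]_t (\1_(cell T) (line_pt u Qd z t) * g (line_pt u Qd z t))%:E =
   (\sum_(F | [&& face_of T F, slope T u F != 0 & `[< fdom F (hit_coord u Qd F z) >]])
     Num.sg (slope T u F) * f (fchart F (hit_coord u Qd F z)))%:E)%E.
Proof.
move=> rz; pose P : pred (face_ix M) := fun F =>
  [&& face_of T F, slope T u F != 0 & `[< fdom F (hit_coord u Qd F z) >]].
rewrite (eq_bigl P)//.
have cl : continuous (line_pt u Qd z) by exact: continuous_line.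
have hitE F : P F -> fchart F (hit_coord u Qd F z) = line_pt u Qd z (hit_time u Qd F z).
  by move=> /and3P[FT sF _]; symmetry; exact/(line_hits_face tess Qd FT sF).
rewrite [in RHS](eq_bigr (fun F => Num.sg (slope T u F) *
    (f \o line_pt u Qd z) (hit_time u Qd F z))); last by move=> F PF; rewrite hitE.
pose S := [set t | cell T (line_pt u Qd z t)].
have u0 : 0 < `|u|.
  rewrite normr_gt0; apply/eqP => u0; move: detQ.
  rewrite u0 -[Qd](@hsubmxK _ n 1 n) -(@row_mx0 _ 1 1 n) -/(block_mx _ _ _ _).
  by rewrite det_lblock det_mx11 mxE mul0r normr0 => /esym/eqP; rewrite oner_eq0.
have [K TK] := (bounded_setP _).1 (cell_bounded tess T).
have mS : measurable (S : set (measurableTypeR R)).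
  by apply: open_measurable; apply: open_comp => [t _|]; [exact: cl|exact: cell_open tess T].
rewrite -(@integral_crossings R _ P (fun F => hit_time u Qd F z)
  (fun F => Num.sg (slope T u F)) S ((K + `|z *m Qd|) / `|u|) (f \o line_pt u Qd z) (g \o line_pt u Qd z))//.
- move=> t nhit.
  have nb : ~ boundary (cell T) (line_pt u Qd z t).
    rewrite (face_cover tess) => -[F FT Ft]; have [h1 h2] := rz F FT.
    have [s0|s0] := eqVneq (slope T u F) 0; first exact: (h1 s0 t Ft).
    have [y] := fchartE tess Ft; move=> /[dup] hy /(line_hits_face tess Qd FT s0)[tE yE].
    have PF : P F.
      by rewrite /P FT s0/=; apply/asboolP; rewrite -yE /fdom/= -hy.
    by have := nhit F PF; rewrite tE eqxx.
  have [Tt|nTt] := pselect (cell T (line_pt u Qd z t)).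
    left; apply: (cl t (cell T)); apply: open_nbhs_nbhs; split => //; exact: cell_open tess T.
  right; have : nbhs (line_pt u Qd z t) (~` closure (cell T)).
    apply: open_nbhs_nbhs; split; first by apply: closed_openC; exact: closed_closure.
    by move=> clT; apply: nb; rewrite open_boundary//; exact: cell_open tess T.
  move=> ncl; have : \forall s \near t, (~` closure (cell T)) (line_pt u Qd z s).
    exact: cl.
  by apply: filterS => s /= hs Ts; apply: hs; exact: subset_closure.
- move=> F F' PF PF' tt; apply/eqP/negPn/negP => FF'.
  case/and3P: (PF) => FT sF /asboolP Fz; have [_ /(_ sF Fz)[+ _]] := rz F FT.
  rewrite eq_sym in FF'; move=> /(_ F' FF'); apply.
  rewrite hitE// tt -hitE//.
  by case/and3P: PF' => _ _ /asboolP.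
- by move=> F /and3P[FT sF /asboolP Fz]; exact: regular_line_crossing.
- move=> t /TK h; rewrite ler_pdivlMr// -normrZ.
  rewrite (_ : t *: u = line_pt u Qd z t - z *m Qd); last first.
    by rewrite /line_pt addrC addrA addNr add0r.
  by apply: le_trans (ler_normB _ _) _; rewrite lerD2r.
- by move=> t; apply: continuous_comp; [exact: cl|exact: cg].
Qed.

Let Q : 'M[R]_(1 + n) := @col_mx R 1 n n.+1 u Qd.

(** Integrate [regular_line_integral] over the lines.  For each face the change of
variables y = hit_coord z brings the factor |slope|, which turns the sign of
the crossing into the slope. *)
Lemma cell_divergence_direction :
  (\int[mu n.+1]_(x in cell T) (g x)%:E =
   (\sum_(F | face_of T F) slope T u F * \int[mu n]_(y in fdom F) f (fchart F y))%:E)%E.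
Proof.
have mT : measurable (cell T) by exact: open_measurable_rV (cell_open tess T).
pose h x : \bar R := (\1_(cell T) x * g x)%:E.
have hE : h = (EFin \o g) \_ (cell T).
  by apply/funext => x; rewrite /h patchE indicE; case: ifP; rewrite ?mul1r ?mul0r.
have inth : (mu n.+1).-integrable setT h.
  rewrite hE -integrable_mkcond//.
  exact: continuous_integrable_rV mT (cell_bounded tess T) cg.
have uQ : Q \in unitmx by rewrite unitmxE unitfE -normr_eq0 detQ oner_eq0.
rewrite integral_mkcond -hE (@integral_rV_affine R n.+1 0 Q h)// detQ mul1e.
have inthQ := @integrable_rV_affine R n.+1 0 Q h uQ inth.
rewrite (integral_rV_fubini inthQ).
pose phi (F : face_ix M) (y : 'rV[R]_n) : \bar R := (\1_(fdom F) y * f (fchart F y))%:E.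
have phiE F : phi F = (EFin \o (f \o @fchart R n.+1 M F)) \_ (fdom F).
  by apply/funext => x; rewrite /phi patchE indicE; case: ifP; rewrite ?mul1r ?mul0r.
have intF F : face_of T F -> (mu n).-integrable (fdom F) (EFin \o (f \o @fchart R n.+1 M F)).
  move=> FT; apply: continuous_integrable_rV.
  - exact: closed_measurable_rV (fdom_closed tess F).
  - exact (fdom_bounded tess FT).
  - by move=> y; apply: continuous_comp; [exact: fchart_continuous|exact: cf].
have intphi F : face_of T F -> (mu n).-integrable setT (phi F).
  move=> FT; rewrite phiE -integrable_mkcond; first exact: intF.
  exact: closed_measurable_rV (fdom_closed tess F).
pose P : pred (face_ix M) := fun F => face_of T F && (slope T u F != 0).
pose psi (F : face_ix M) (z : 'rV[R]_n) : \bar R :=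
  if P F then ((Num.sg (slope T u F))%:E * phi F (hit_base u F + z *m hit_chart u Qd F)%R)%E else 0%E.
have intpsi F : (mu n).-integrable setT (psi F).
  rewrite /psi; case: (boolP (P F)) => [/andP[FT sF]|_]; last exact: integrable0.
  apply: integrableZl => //.
  by apply: integrable_rV_affine; [exact (hit_chart_unit tess detQ FT sF)|exact: intphi].
transitivity (\int[mu n]_z (\sum_(F : face_ix M) psi F z)%E)%E.
  apply: ae_eq_integral => //.
  - exact: measurable_rV_fubini inthQ.
  - by apply: (measurable_int (mu n)); apply: integrable_sum => [|F _]; [by []|exact: intpsi].
  apply: filterS (ae_regular_line tess T detQ) => z rz _.
  transitivity (\int[lambda]_t (\1_(cell T) (line_pt u Qd z t) * g (line_pt u Qd z t))%:E)%E.
    by apply: eq_integral => t _; rewrite /h add0r cons_rV_mul.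
  rewrite (regular_line_integral rz).
  rewrite -sumEFin big_mkcond /=; apply: eq_bigr => F _.
  rewrite /psi /P andbA; case: ifPn => /=.
    move=> /andP[-> /asboolP Fz]; rewrite /phi indicE mem_set// mul1r//.
  rewrite negb_and => /orP[/negbTE -> //|/asboolP Fz].
  by case: ifP => // _; rewrite /phi indicE memNset// mul0r mule0.
rewrite integral_sum//.
rewrite -sumEFin [RHS]big_mkcond/=; apply: eq_bigr => F _.
rewrite /psi /P; have [FT|nFT] := boolP (face_of T F); last by rewrite integral0.
have [s0|sF] := eqVneq (slope T u F) 0; first by rewrite integral0 s0 mul0r.
rewrite /= integralZl//; last first.
  by apply: integrable_rV_affine; [exact (hit_chart_unit tess detQ FT sF)|exact: intphi].
have := @integral_rV_affine R n (hit_base u F) (hit_chart u Qd F) (phi F)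
  (hit_chart_unit tess detQ FT sF) (intphi F FT).
rewrite (det_hit_chart tess detQ FT sF).
rewrite [in X in X -> _]phiE -integral_mkcond => E.
have -> : (\int[mu n]_x phi F (hit_base u F + x *m hit_chart u Qd F)%R =
   `|slope T u F|%:E * \int[mu n]_(y in fdom F) (f (fchart F y))%:E)%E.
  rewrite [X in (_ * X)%E](_ : _ = \int[mu n]_(x in fdom F) (EFin \o (f \o @fchart R n.+1 M F)) x)%E//.
  by rewrite phiE E muleA -EFinM mulfV ?normr_eq0// mul1e.
rewrite muleA -EFinM -[X in (X%:E * _)%E]numEsg EFinM; congr (_ * _)%E.
rewrite /Rintegral fineK//; apply: (integrable_fin_num _ (intF F FT)).
exact: closed_measurable_rV (fdom_closed tess F).
Qed.

End divergence_theorem_direction.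

(** Exchanging the rows 0 and j of the identity completes the j-th unit vector into
a matrix of determinant 1 or -1. *)
Lemma cell_divergence {R : realType} n (Om : set 'rV[R]_n.+1) (M : mesh R n.+1)
    (tess : polytopal_tessellation Om M) (T : cell_ix M) (j : 'I_n.+1)
    (f g : 'rV[R]_n.+1 -> R) : continuous f -> continuous g ->
  (forall x (s : R),
    is_derive s (1 : R) (fun t : R => f (x + t *: delta_mx ord0 j)) (g (x + s *: delta_mx ord0 j))) ->
  \int[lebesgue_rV R n.+1]_(x in cell T) g x =
  \sum_(F | face_of T F) fnormal T F ord0 j * \int[lebesgue_rV R n]_(y in fdom F) f (fchart F y).
Proof.
move=> cf cg dfg.
pose Q : 'M[R]_(1 + n) := perm_mx (perm.tperm ord0 j).
have uQ : @usubmx R 1 n n.+1 Q = delta_mx ord0 j.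
  apply/rowP => k; rewrite !mxE ord1 eqxx/= (_ : lshift n ord0 = ord0); last exact: val_inj.
  by rewrite perm.tpermL eq_sym.
have detQ : `|\det (@col_mx R 1 n n.+1 (delta_mx ord0 j) (@dsubmx R 1 n n.+1 Q))| = 1.
  by rewrite -uQ vsubmxK det_perm normrX normrN normr1 expr1n.
have := cell_divergence_direction tess T detQ cf cg dfg.
rewrite /Rintegral => ->; apply: eq_bigr => F _.
by rewrite /slope dotv_delta.
Qed.

(** * Essentially bounded functions and the complex L2 product *)

Section complex_integral.
Context {R : realType} (n : nat).
Implicit Types (D : set 'rV[R]_n) (f g : 'rV[R]_n -> R) (u v : 'rV[R]_n -> R[i]).
Local Notation mu := (lebesgue_rV R n).

(** A class of functions closed under products, integrable on sets of finite
measure, to which belong polynomials on bounded sets and the coefficients A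
and V. *)
Definition ess_bounded D f : Prop := measurable_fun D f /\
  exists C, \forall x \ae mu, D x -> `|f x| <= C.

Lemma ess_bounded_cst D c : ess_bounded D (fun=> c).
Proof. by split => //; exists `|c|; apply: aeW. Qed.

Lemma ess_boundedD D f g : ess_bounded D f -> ess_bounded D g ->
  ess_bounded D (fun x => f x + g x).
Proof.
move=> [mf [C hC]] [mg [C' hC']]; split; first exact: measurable_funD.
exists (C + C'); apply: filterS2 hC hC' => x h h' Dx.
by apply: le_trans (ler_normD _ _) _; rewrite lerD ?h ?h'.
Qed.

Lemma ess_boundedM D f g : ess_bounded D f -> ess_bounded D g ->
  ess_bounded D (fun x => f x * g x).
Proof.
move=> [mf [C hC]] [mg [C' hC']]; split; first exact: measurable_funM.
exists (C * C'); apply: filterS2 hC hC' => x h h' Dx.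
by rewrite normrM ler_pM ?h ?h'.
Qed.

Lemma ess_boundedN D f : ess_bounded D f -> ess_bounded D (fun x => - f x).
Proof.
move=> /(ess_boundedM (ess_bounded_cst D (-1))).
by under eq_fun do rewrite mulN1r.
Qed.

Lemma ess_bounded_sub D D' f : measurable D -> D' `<=` D ->
  ess_bounded D f -> ess_bounded D' f.
Proof.
move=> mD DD' [mf [C hC]]; split; first exact: measurable_funS mf.
by exists C; apply: filterS hC => x h /DD'.
Qed.

Lemma ess_bounded_integrable D f : measurable D -> (mu D < +oo)%E ->
  ess_bounded D f -> mu.-integrable D (EFin \o f).
Proof.
move=> mD Doo [mf [C hC]]; apply/integrableP; split; first exact/measurable_EFinP.
apply: (@le_lt_trans _ _ (`|C|%:E * mu D)%E); last by rewrite lte_mul_pinfty.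
apply: integral_le_bound => //; first exact/measurable_EFinP.
by apply: filterS hC => x h Dx; rewrite lee_fin (le_trans (h Dx))// ler_norm.
Qed.

Lemma ess_bounded_continuous D f : measurable D -> bounded_set D -> continuous f ->
  ess_bounded D f.
Proof.
move=> mD bD cf; split; first by apply: measurable_funTS; exact: continuous_measurable_rV.
by have [K hK] := continuous_bounded_on bD cf; exists K; apply: aeW.
Qed.

Definition cess_bounded D u : Prop :=
  ess_bounded D (fun x => complex.Re (u x)) /\ ess_bounded D (fun x => complex.Im (u x)).

Lemma eq_cess_bounded D u v : u =1 v -> cess_bounded D u -> cess_bounded D v.
Proof. by move=> /funext ->. Qed.

Lemma cess_bounded_cst D c : cess_bounded D (fun=> c).
Proof. by split; exact: ess_bounded_cst. Qed.

Lemma cess_boundedD D u v : cess_bounded D u -> cess_bounded D v ->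
  cess_bounded D (fun x => u x + v x).
Proof.
move=> [u1 u2] [v1 v2]; split.
  rewrite (_ : (fun x => _) = fun x => complex.Re (u x) + complex.Re (v x)).
    exact: ess_boundedD.
  by apply/funext => x; case: (u x) (v x) => a b [c e].
rewrite (_ : (fun x => _) = fun x => complex.Im (u x) + complex.Im (v x)).
  exact: ess_boundedD.
by apply/funext => x; case: (u x) (v x) => a b [c e].
Qed.

Lemma cess_boundedM D u v : cess_bounded D u -> cess_bounded D v ->
  cess_bounded D (fun x => u x * v x).
Proof.
move=> [u1 u2] [v1 v2]; split.
  rewrite (_ : (fun x => _) = fun x => complex.Re (u x) * complex.Re (v x) +
     - (complex.Im (u x) * complex.Im (v x))).
    by apply: ess_boundedD; [|apply: ess_boundedN]; exact: ess_boundedM.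
  by apply/funext => x; case: (u x) (v x) => a b [c e].
rewrite (_ : (fun x => _) = fun x => complex.Re (u x) * complex.Im (v x) +
     (complex.Im (u x) * complex.Re (v x))).
  by apply: ess_boundedD; exact: ess_boundedM.
by apply/funext => x; case: (u x) (v x) => a b [c e].
Qed.

Lemma cess_bounded_conj D u : cess_bounded D u -> cess_bounded D (fun x => (u x)^*%C).
Proof.
move=> [u1 u2]; split.
  by rewrite (_ : (fun x => _) = fun x => complex.Re (u x))//; apply/funext => x; case: (u x).
rewrite (_ : (fun x => _) = fun x => - complex.Im (u x)); first exact: ess_boundedN.
by apply/funext => x; case: (u x).
Qed.

Lemma cess_bounded_sum (I : Type) (s : seq I) (P : pred I) D (u : I -> 'rV[R]_n -> R[i]) :
  (forall i, P i -> cess_bounded D (u i)) -> cess_bounded D (fun x => \sum_(i <- s | P i) u i x).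
Proof.
move=> h; elim: s => [|i s IH].
  by apply: eq_cess_bounded (cess_bounded_cst D 0) => x; rewrite big_nil.
have [Pi|nPi] := boolP (P i).
  by apply: eq_cess_bounded (cess_boundedD (h i Pi) IH) => x; rewrite big_cons Pi.
by apply: eq_cess_bounded IH => x; rewrite big_cons (negbTE nPi).
Qed.

Lemma cess_bounded_real D f : ess_bounded D f -> cess_bounded D (fun x => (f x)%:C).
Proof. by move=> hf; split => //; exact: ess_bounded_cst. Qed.

Definition cint D u : R[i] :=
  (\int[mu]_(x in D) complex.Re (u x)) +i* (\int[mu]_(x in D) complex.Im (u x)).

Lemma l2dotE D u v : l2dot D u v = cint D (fun x => u x * (v x)^*%C).
Proof. by []. Qed.

Lemma eq_cint D u v : (forall x, D x -> u x = v x) -> cint D u = cint D v.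
Proof.
by move=> uv; congr (_ +i* _); apply: eq_Rintegral => x; rewrite inE => /uv ->.
Qed.

Variable D : set 'rV[R]_n.
Hypotheses (mD : measurable D) (Doo : (mu D < +oo)%E).
Let intD f : ess_bounded D f -> mu.-integrable D (EFin \o f).
Proof. exact: ess_bounded_integrable. Qed.

Lemma cintD u v : cess_bounded D u -> cess_bounded D v ->
  cint D (fun x => u x + v x) = cint D u + cint D v.
Proof.
move=> [/intD u1 /intD u2] [/intD v1 /intD v2].
rewrite /cint; apply/eqP; rewrite eq_complex /= -!RintegralD//.
by apply/andP; split; apply/eqP; apply: eq_Rintegral => x _; case: (u x) (v x) => a b [c e].
Qed.

Lemma cintZ (c : R[i]) u : cess_bounded D u -> cint D (fun x => c * u x) = c * cint D u.
Proof.
move=> [u1 u2]; case: c => a b.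
have hZ f k : ess_bounded D f -> mu.-integrable D (EFin \o (fun x => k * f x)).
  by move=> hf; apply: intD; apply: ess_boundedM => //; exact: ess_bounded_cst.
rewrite /cint; apply/eqP; rewrite eq_complex /= -!RintegralZl//; try exact: intD.
rewrite -RintegralB ?hZ// -RintegralD ?hZ//.
by apply/andP; split; apply/eqP; apply: eq_Rintegral => x _; case: (u x) => c e.
Qed.

Lemma cint_sum (I : Type) (s : seq I) (P : pred I) (u : I -> 'rV[R]_n -> R[i]) :
  (forall i, P i -> cess_bounded D (u i)) ->
  cint D (fun x => \sum_(i <- s | P i) u i x) = \sum_(i <- s | P i) cint D (u i).
Proof.
move=> h; elim: s => [|i s IH].
  rewrite big_nil (@eq_cint _ _ (fun=> 0 * 0)); last by move=> x _; rewrite big_nil mulr0.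
  by rewrite cintZ ?mul0r//; exact: cess_bounded_cst.
rewrite big_cons -IH; have [Pi|nPi] := boolP (P i).
  rewrite -cintD; [|exact: h|exact: cess_bounded_sum].
  by apply: eq_cint => x _; rewrite big_cons Pi.
by apply: eq_cint => x _; rewrite big_cons (negbTE nPi).
Qed.

Lemma l2dotDl u v w : cess_bounded D u -> cess_bounded D v -> cess_bounded D w ->
  l2dot D (fun x => u x + v x) w = l2dot D u w + l2dot D v w.
Proof.
move=> hu hv /cess_bounded_conj hw; rewrite !l2dotE -cintD; try exact: cess_boundedM.
by apply: eq_cint => x _; rewrite mulrDl.
Qed.

Lemma l2dotDr u v w : cess_bounded D u -> cess_bounded D v -> cess_bounded D w ->
  l2dot D w (fun x => u x + v x) = l2dot D w u + l2dot D w v.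
Proof.
move=> /cess_bounded_conj hu /cess_bounded_conj hv hw.
rewrite !l2dotE -cintD; try exact: cess_boundedM.
by apply: eq_cint => x _; rewrite rmorphD mulrDr.
Qed.

Lemma l2dotZl c u w : cess_bounded D u -> cess_bounded D w ->
  l2dot D (fun x => c * u x) w = c * l2dot D u w.
Proof.
move=> hu /cess_bounded_conj hw; rewrite !l2dotE -cintZ; last exact: cess_boundedM.
by apply: eq_cint => x _; rewrite mulrA.
Qed.

Lemma l2dotZr c u w : cess_bounded D u -> cess_bounded D w ->
  l2dot D w (fun x => c * u x) = c^*%C * l2dot D w u.
Proof.
move=> /cess_bounded_conj hu hw; rewrite !l2dotE -cintZ; last exact: cess_boundedM.
by apply: eq_cint => x _; rewrite rmorphM mulrCA.
Qed.

Lemma l2dot_sumr (I : Type) (s : seq I) (P : pred I) (u : I -> 'rV[R]_n -> R[i]) w :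
  (forall i, P i -> cess_bounded D (u i)) -> cess_bounded D w ->
  l2dot D w (fun x => \sum_(i <- s | P i) u i x) = \sum_(i <- s | P i) l2dot D w (u i).
Proof.
move=> hu hw; under eq_bigr do rewrite l2dotE.
rewrite -cint_sum; last by move=> i Pi; apply: cess_boundedM => //; apply: cess_bounded_conj; exact: hu.
by rewrite l2dotE; apply: eq_cint => x _; rewrite rmorph_sum mulr_sumr.
Qed.

Lemma Im_l2dot_self u : complex.Im (l2dot D u u) = 0.
Proof.
rewrite /l2dot/=; have -> : (fun x => complex.Im (u x * (u x)^*%C)) = fun=> 0.
  by apply/funext => x; case: (u x) => a b /=; ring.
by rewrite Rintegral_cst// mul0r.
Qed.

End complex_integral.

Lemma l2normsq_ge0 {R : realType} n (D : set 'rV[R]_n) u : 0 <= l2normsq D u.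
Proof.
apply: Rintegral_ge0 => y _; case: (u y) => a b /=.
by rewrite mulrN opprK addr_ge0// -expr2 sqr_ge0.
Qed.

(** * Polynomials as smooth functions *)

Section complex_gradients.
Context {R : realType} (n : nat).
Implicit Types (u v : 'rV[R]_n -> R[i]) (du dv : 'I_n -> 'rV[R]_n -> R[i]).

Definition ccontinuous u : Prop :=
  continuous (fun x => complex.Re (u x)) /\ continuous (fun x => complex.Im (u x)).

(** Derivatives are taken along the coordinate lines, as in [cell_divergence]. *)
Definition cgradient u du : Prop := forall j x (s : R),
  is_derive s (1 : R) (fun t : R => complex.Re (u (x + t *: delta_mx ord0 j)))
    (complex.Re (du j (x + s *: delta_mx ord0 j))) /\
  is_derive s (1 : R) (fun t : R => complex.Im (u (x + t *: delta_mx ord0 j)))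
    (complex.Im (du j (x + s *: delta_mx ord0 j))).

Lemma ccontinuous_cst c : ccontinuous (fun=> c).
Proof. by split; exact: cst_continuous. Qed.

Lemma ccontinuousD u v : ccontinuous u -> ccontinuous v -> ccontinuous (fun x => u x + v x).
Proof.
move=> [u1 u2] [v1 v2]; split.
  rewrite (_ : (fun x => _) = fun x => complex.Re (u x) + complex.Re (v x)).
    by move=> x; exact: continuousD (u1 x) (v1 x).
  by apply/funext => x; case: (u x) (v x) => a b [c e].
rewrite (_ : (fun x => _) = fun x => complex.Im (u x) + complex.Im (v x)).
  by move=> x; exact: continuousD (u2 x) (v2 x).
by apply/funext => x; case: (u x) (v x) => a b [c e].
Qed.

Lemma ccontinuousM u v : ccontinuous u -> ccontinuous v -> ccontinuous (fun x => u x * v x).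
Proof.
move=> [u1 u2] [v1 v2]; split.
  rewrite (_ : (fun x => _) = fun x => complex.Re (u x) * complex.Re (v x) -
     complex.Im (u x) * complex.Im (v x)).
    move=> x; exact: continuousB (continuousM (u1 x) (v1 x)) (continuousM (u2 x) (v2 x)).
  by apply/funext => x; case: (u x) (v x) => a b [c e].
rewrite (_ : (fun x => _) = fun x => complex.Re (u x) * complex.Im (v x) +
     complex.Im (u x) * complex.Re (v x)).
  move=> x; exact: continuousD (continuousM (u1 x) (v2 x)) (continuousM (u2 x) (v1 x)).
by apply/funext => x; case: (u x) (v x) => a b [c e].
Qed.

Lemma ccontinuous_conj u : ccontinuous u -> ccontinuous (fun x => (u x)^*%C).
Proof.
move=> [u1 u2]; split.
  by rewrite (_ : (fun x => _) = fun x => complex.Re (u x))//; apply/funext => x; case: (u x).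
rewrite (_ : (fun x => _) = fun x => - complex.Im (u x)).
  by move=> x; exact: continuousN (u2 x).
by apply/funext => x; case: (u x).
Qed.

Lemma cgradient_cst c : cgradient (fun=> c) (fun _ _ => 0).
Proof. by move=> j x s; split; exact: is_derive_cst. Qed.

Lemma cgradientD u v du dv : cgradient u du -> cgradient v dv ->
  cgradient (fun x => u x + v x) (fun j x => du j x + dv j x).
Proof.
move=> hu hv j x s; have [u1 u2] := hu j x s; have [v1 v2] := hv j x s; split.
  rewrite (_ : (fun t => _) = (fun t => complex.Re (u (x + t *: delta_mx ord0 j))) +
     (fun t => complex.Re (v (x + t *: delta_mx ord0 j)))).
    by apply: is_derive_eq; case: (du _ _) (dv _ _) => a b [c e].
  by apply/funext => t; rewrite /= fctE; case: (u _) (v _) => a b [c e].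
rewrite (_ : (fun t => _) = (fun t => complex.Im (u (x + t *: delta_mx ord0 j))) +
   (fun t => complex.Im (v (x + t *: delta_mx ord0 j)))).
  by apply: is_derive_eq; case: (du _ _) (dv _ _) => a b [c e].
by apply/funext => t; rewrite /= fctE; case: (u _) (v _) => a b [c e].
Qed.

Lemma cgradientM u v du dv : cgradient u du -> cgradient v dv ->
  cgradient (fun x => u x * v x) (fun j x => du j x * v x + u x * dv j x).
Proof.
move=> hu hv j x s; have [u1 u2] := hu j x s; have [v1 v2] := hv j x s; split.
  rewrite (_ : (fun t => _) = (fun t => complex.Re (u (x + t *: delta_mx ord0 j))) *
     (fun t => complex.Re (v (x + t *: delta_mx ord0 j))) -
     (fun t => complex.Im (u (x + t *: delta_mx ord0 j))) *
     (fun t => complex.Im (v (x + t *: delta_mx ord0 j)))).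
    apply: is_derive_eq (is_deriveB (is_deriveM u1 v1) (is_deriveM u2 v2)) _.
    rewrite /GRing.scale/=.
    by case: (du _ _) (dv _ _) (u _) (v _) => a b [a1 b1] [a2 b2] [a3 b3] /=; ring.
  by apply/funext => t; rewrite /= !fctE; case: (u _) (v _) => a b [c e].
rewrite (_ : (fun t => _) = (fun t => complex.Re (u (x + t *: delta_mx ord0 j))) *
   (fun t => complex.Im (v (x + t *: delta_mx ord0 j))) +
   (fun t => complex.Im (u (x + t *: delta_mx ord0 j))) *
   (fun t => complex.Re (v (x + t *: delta_mx ord0 j)))).
  apply: is_derive_eq (is_deriveD (is_deriveM u1 v2) (is_deriveM u2 v1)) _.
  rewrite /GRing.scale/=.
  by case: (du _ _) (dv _ _) (u _) (v _) => a b [a1 b1] [a2 b2] [a3 b3] /=; ring.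
by apply/funext => t; rewrite /= !fctE; case: (u _) (v _) => a b [c e].
Qed.

Lemma cgradient_conj u du : cgradient u du ->
  cgradient (fun x => (u x)^*%C) (fun j x => (du j x)^*%C).
Proof.
move=> hu j x s; have [u1 u2] := hu j x s; split.
  rewrite (_ : (fun t => _) = (fun t => complex.Re (u (x + t *: delta_mx ord0 j)))).
    by apply: is_derive_eq; case: (du _ _).
  by apply/funext => t; case: (u _).
rewrite (_ : (fun t => _) = - (fun t => complex.Im (u (x + t *: delta_mx ord0 j)))).
  by apply: is_derive_eq; case: (du _ _).
by apply/funext => t; rewrite /= fctE; case: (u _).
Qed.

Lemma cess_bounded_continuous (D : set 'rV[R]_n) u : measurable D -> bounded_set D ->
  ccontinuous u -> cess_bounded D u.
Proof. by move=> mD bD [u1 u2]; split; exact: ess_bounded_continuous. Qed.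

End complex_gradients.

Section polynomial_functions.
Context {R : realType} (n : nat).
Implicit Types (p q : mpoly.mpoly n R[i]).

Lemma pevalD p q x : peval (p + q) x = peval p x + peval q x.
Proof. exact: mpoly.mevalD. Qed.

Lemma pevalZ (c : R[i]) p x : peval (c *: p) x = c * peval p x.
Proof. exact: mpoly.mevalZ. Qed.

Lemma pevalM p q x : peval (p * q) x = peval p x * peval q x.
Proof. exact: mpoly.mevalM. Qed.

Lemma peval0 x : peval (0 : mpoly.mpoly n R[i]) x = 0.
Proof. exact: mpoly.meval0. Qed.

Lemma peval_sum (I : Type) (s : seq I) (P : pred I) (F : I -> mpoly.mpoly n R[i]) x :
  peval (\sum_(i <- s | P i) F i) x = \sum_(i <- s | P i) peval (F i) x.
Proof.
elim: s => [|i s IH]; first by rewrite !big_nil peval0.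
by rewrite !big_cons; case: ifP; rewrite ?pevalD IH.
Qed.

Definition smooth_poly p :=
  ccontinuous (peval p) /\ cgradient (peval p) (fun j => peval (mpoly.mderiv j p)).

Lemma smooth_polyC c : smooth_poly (mpoly.mpolyC n c).
Proof.
rewrite /smooth_poly.
have -> : peval (mpoly.mpolyC n c) = fun=> c by apply/funext => x; exact: mpoly.mevalC.
split; first exact: ccontinuous_cst.
have -> : (fun j => peval (mpoly.mderiv j (mpoly.mpolyC n c))) = fun _ _ => 0.
  by apply/funext => j; apply/funext => x; rewrite mpoly.mderivC peval0.
exact: cgradient_cst.
Qed.

Lemma smooth_polyD p q : smooth_poly p -> smooth_poly q -> smooth_poly (p + q).
Proof.
move=> [cp dp] [cq dq]; rewrite /smooth_poly; split.
  by have -> : peval (p + q) = fun x => peval p x + peval q x;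
    [by apply/funext => x; exact: pevalD|exact: ccontinuousD].
have -> : peval (p + q) = fun x => peval p x + peval q x by apply/funext => x; exact: pevalD.
have -> : (fun j => peval (mpoly.mderiv j (p + q))) =
    fun j x => peval (mpoly.mderiv j p) x + peval (mpoly.mderiv j q) x.
  by apply/funext => j; apply/funext => x; rewrite mpoly.mderivD pevalD.
exact (cgradientD dp dq).
Qed.

Lemma smooth_polyM p q : smooth_poly p -> smooth_poly q -> smooth_poly (p * q).
Proof.
have E : peval (p * q) = fun x => peval p x * peval q x by apply/funext => x; exact: pevalM.
move=> [cp dp] [cq dq]; rewrite /smooth_poly E; split; first exact: ccontinuousM.
have -> : (fun j => peval (mpoly.mderiv j (p * q))) =
    fun j x => peval (mpoly.mderiv j p) x * peval q x + peval p x * peval (mpoly.mderiv j q) x.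
  by apply/funext => j; apply/funext => x; rewrite mpoly.mderivM pevalD !pevalM.
exact (cgradientM dp dq).
Qed.

Lemma smooth_polyX i : smooth_poly (mpoly.mpolyX R[i] (mpoly.mnm1 i)).
Proof.
rewrite /smooth_poly.
have -> : peval (mpoly.mpolyX R[i] (mpoly.mnm1 i)) = fun x => (x ord0 i)%:C.
  by apply/funext => x; exact: mpoly.mevalXU.
split; first by split; [exact: continuous_coord|exact: cst_continuous].
have dX j x : peval (mpoly.mderiv j (mpoly.mpolyX R[i] (mpoly.mnm1 i))) x = (j == i)%R%:R.
  rewrite mpoly.mderivX pevalZ mpoly.mnm1E eq_sym; case: eqVneq => [->|_]; last by rewrite mul0r.
  rewrite mul1r /peval mpoly.mevalX big1// => k _.
  by rewrite mpoly.mnmBE subnn expr0.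
move=> j x s; rewrite dX; split; last first.
  rewrite (_ : complex.Im _ = 0); last by case: (j == i).
  exact: is_derive_cst.
rewrite (_ : complex.Re _ = (j == i)%R%:R); last by case: (j == i).
have -> : (fun t : R => complex.Re ((x + t *: delta_mx ord0 j) ord0 i)%:C) =
   (fun t => x ord0 i + t * (j == i)%R%:R).
  by apply/funext => t /=; rewrite !mxE eqxx /= eq_sym.
apply: is_derive_eq; rewrite /GRing.scale/=; ring.
Qed.

Lemma smooth_polynomial p : smooth_poly p.
Proof.
elim/mpoly.mpolyind: p => [|c m p _ _ IH].
  by rewrite -[0](mpoly.mpolyC0 n); exact: smooth_polyC.
rewrite -mpoly.mul_mpolyC.
apply: (smooth_polyD (smooth_polyM (smooth_polyC c) _) IH).
rewrite mpoly.mpolyXE_id.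
apply: (big_ind smooth_poly) => [||i _].
- exact: smooth_polyC.
- exact: smooth_polyM.
elim: (m i) => [|k IHk]; first by rewrite expr0; exact: smooth_polyC.
by rewrite exprS; exact (smooth_polyM (smooth_polyX i) IHk).
Qed.

End polynomial_functions.

(** * Green's formula on a cell *)

Lemma Re_sum {R : realType} (I : Type) (s : seq I) (P : pred I) (F : I -> R[i]) :
  complex.Re (\sum_(i <- s | P i) F i) = \sum_(i <- s | P i) complex.Re (F i).
Proof. by apply: (big_morph (@complex.Re R)) => // -[a b] [c d]. Qed.

Lemma Im_sum {R : realType} (I : Type) (s : seq I) (P : pred I) (F : I -> R[i]) :
  complex.Im (\sum_(i <- s | P i) F i) = \sum_(i <- s | P i) complex.Im (F i).
Proof. by apply: (big_morph (@complex.Im R)) => // -[a b] [c d]. Qed.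

Section cell_green.
Context {R : realType} (n : nat) (Om : set 'rV[R]_n.+1) (M : mesh R n.+1).
Hypothesis tess : polytopal_tessellation Om M.
Variable T : cell_ix M.

Lemma cell_measurable : measurable (cell T).
Proof. exact: open_measurable_rV (cell_open tess T). Qed.

Lemma cell_finite : (lebesgue_rV R n.+1 (cell T) < +oo)%E.
Proof. exact: bounded_lebesgue_rV_lty cell_measurable (cell_bounded tess T). Qed.

(** The divergence theorem applied to the two parts of u times the conjugate of v. *)
Lemma cell_green (u v : 'rV[R]_n.+1 -> R[i]) du dv j :
  ccontinuous u -> ccontinuous v -> ccontinuous (du j) -> ccontinuous (dv j) ->
  cgradient u du -> cgradient v dv ->
  l2dot (cell T) (du j) v + l2dot (cell T) u (dv j) =
  \sum_(F | face_of T F) (fnormal T F ord0 j)%:C *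
    l2dot (fdom F) (u \o fchart F) (v \o fchart F).
Proof.
move=> cu cv cdu cdv gu gv.
have mT := cell_measurable; have Too := cell_finite.
have bT := cell_bounded tess T.
have [c1 c2] := ccontinuousM cu (ccontinuous_conj cv).
have [d1 d2] := ccontinuousD (ccontinuousM cdu (ccontinuous_conj cv))
  (ccontinuousM cu (ccontinuous_conj cdv)).
have g := cgradientM gu (cgradient_conj gv).
have E1 := cell_divergence tess T c1 d1 (fun x s => (g j x s).1).
have E2 := cell_divergence tess T c2 d2 (fun x s => (g j x s).2).
rewrite !l2dotE -cintD//; last 2 first.
- by apply: cess_boundedM; [|apply: cess_bounded_conj]; exact: cess_bounded_continuous.
- by apply: cess_boundedM; [|apply: cess_bounded_conj]; exact: cess_bounded_continuous.
rewrite /cint {}E1 {}E2.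
apply/eqP; rewrite eq_complex /= Re_sum Im_sum; apply/andP; split; apply/eqP;
  by apply: eq_bigr => F FT; rewrite /= mul0r ?subr0 ?addr0.
Qed.

End cell_green.

(** * Cells lie inside the domain *)

Section cells_in_domain.
Context {R : realType} (n : nat) (Om : set 'rV[R]_n.+1) (M : mesh R n.+1).
Hypotheses (lipOm : lipschitz_domain Om) (tess : polytopal_tessellation Om M).

Lemma continuous_enorm_affine m (c : 'rV[R]_m) (B : 'M[R]_(n.+1, m)) :
  continuous (fun y : 'rV[R]_n.+1 => enorm (c + y *m B)).
Proof.
move=> y; apply: (@continuous_comp _ _ _
  (fun y : 'rV[R]_n.+1 => dotv (c + y *m B) (c + y *m B)) (@Num.sqrt R)); last first.
  exact: sqrt_continuous.
apply: (@continuous_big _ _ +%R 0 predT _ _ _ (fun i (y : 'rV[R]_n.+1) =>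
  (c + y *m B) ord0 i * (c + y *m B) ord0 i)) => [|i _ z].
  exact: add_continuous.
have h : {for z, continuous (fun y : 'rV[R]_n.+1 => (c + y *m B) ord0 i)}.
  apply: (@continuous_comp _ _ _ (fun y : 'rV[R]_n.+1 => c + y *m B) (fun v : 'rV[R]_m => v ord0 i)).
    exact: continuous_rV_affine.
  exact: continuous_coord.
by apply: continuousM; exact: h.
Qed.

(** A point x of T outside Om is in the closure of Om, hence on its boundary, and
near x the domain is the strict epigraph of a Lipschitz function in the
direction e.  As x is not above the graph, x - t e and its neighbours are
strictly below it.  They are not in Om, although x - t e is in T and hence in
the closure of Om. *)
Lemma cell_in_domain (T : cell_ix M) : cell T `<=` Om.
Proof.
move=> x Tx; apply: contrapT => nOx.
case: lipOm => oOm _ _ _ lip.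
have TcO : cell T `<=` closure Om.
  by move=> y Ty; rewrite (cell_cover tess); exists T => //; exact: subset_closure.
have bOx : boundary Om x by rewrite open_boundary//; split; [exact: TcO|].
have [e [B [phi [L [U [[ee _ eB] phiL Ux hU]]]]]] := lip x bOx.
have [r /= r0 hr] : exists2 r, 0 < r & ball x r `<=` U `&` cell T.
  apply/nbhs_ballP; apply: filterI => //; apply: open_nbhs_nbhs; split => //.
  exact: cell_open tess T.
have Uxx : U x by case: (hr x (ballxx x r0)).
have phix : dotv x e <= phi (x *m B^T).
  by rewrite leNgt; apply/negP => h; apply: nOx; apply/(hU x Uxx).
(* For this t the point x - t e stays in the ball of radius r, in sup norm. *)
pose t := r / (`|e| + 1) / 2; have e1 : 0 < `|e| + 1 by rewrite ltr_wpDl.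
have t0 : 0 < t by rewrite !divr_gt0.
pose y0 := x - t *: e.
have xy0 : ball x r y0.
  rewrite mx_norm_ball /ball_/= /y0 opprB addrC subrK normrZ gtr0_norm// /t.
  have : 0 < r / (`|e| + 1) by rewrite divr_gt0.
  have : r / (`|e| + 1) * (`|e| + 1) = r by rewrite divfK// gt_eqF.
  move: (r / _) (normr_ge0 e) => q e0 <- q0; nra.
have y0B : y0 *m B^T = x *m B^T.
  by rewrite /y0 mulmxBl -scalemxAl [e *m _]eB scaler0 subr0.
have y0e : dotv y0 e = dotv x e - t by rewrite /y0 dotvBl dotvZl ee mulr1.
(* By the Lipschitz bound from y0, a point of U with psi < t is below the
   graph. *)
pose psi (y : 'rV[R]_n.+1) : R := dotv (y - y0) e + L * enorm (- (y0 *m B^T) + y *m B^T).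
have cpsi : continuous psi.
  have h1 : continuous (fun y : 'rV[R]_n.+1 => dotv (y - y0) e) by exact: continuous_dotv.
  have h2 : continuous (fun y : 'rV[R]_n.+1 => enorm (- (y0 *m B^T) + y *m B^T)).
    exact: continuous_enorm_affine.
  have h3 (y : 'rV[R]_n.+1) : {for y, continuous (fun y : 'rV[R]_n.+1 => L)} by exact: cst_continuous.
  move=> y; exact: continuousD (h1 y) (continuousM (h3 y) (h2 y)).
have psi0 : psi y0 = 0.
  by rewrite /psi subrr addNr /enorm !dotvE !mul0mx mxE sqrtr0 mulr0 add0r.
have nb : nbhs y0 (ball x r `&` [set y | psi y < t]).
  apply: filterI; first by apply: open_nbhs_nbhs; split => //; exact: ball_open.
  apply: (cpsi y0 [set s | s < t]); rewrite psi0; exact: lt_nbhsl.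
have [|y [Oy [xy psiy]]] := TcO y0 _ _ nb; first by case: (hr y0 xy0).
have Uy : U y by case: (hr y xy).
move/(hU y Uy): Oy => phiy.
have := phiL (y *m B^T) (y0 *m B^T); rewrite ler_norml => /andP[+ _].
move: psiy; rewrite /= /psi dotvBl y0e y0B [- _ + _]addrC => h1 h2.
lra.
Qed.

End cells_in_domain.

(** * Essential bounds of the coefficients *)

Section essential_bounds.
Context {R : realType} (n : nat) (Om : set 'rV[R]_n).

Lemma Linfty_norm_lty_ae (f : 'rV[R]_n -> R) : (Linfty_norm Om f < +oo)%E ->
  \forall x \ae lebesgue_rV R n, Om x -> `|f x| <= fine (Linfty_norm Om f).
Proof.
have N0 : (0 <= Linfty_norm Om f)%E by exact: Lnorm_ge0.
move=> Noo.
have NE : Linfty_norm Om f = (fine (Linfty_norm Om f))%:E.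
  by rewrite fineK// ge0_fin_numE.
have [mu0|] := boolP (0 < lebesgue_rV R n setT)%E; last first.
  (* If the whole space is null, every property holds almost everywhere. *)
  rewrite -leNgt measure_le0 => /eqP mu0; exists setT; split => //.
move: NE; rewrite {1}/Linfty_norm unlock mu0 => NE.
have := ess_sup_ge (lebesgue_rV R n) (abse \o (EFin \o (f \_ Om))).
rewrite NE; apply: filterS => x /= + Ox.
by rewrite patchE mem_set// lee_fin.
Qed.

Lemma ae_bound_Linfty_norm_lty (f : 'rV[R]_n -> R) (C : R) :
  (\forall x \ae lebesgue_rV R n, Om x -> `|f x| <= C) -> (Linfty_norm Om f < +oo)%E.
Proof.
move=> h; rewrite /Linfty_norm unlock; case: ifP => // _.
apply: (@le_lt_trans _ _ (`|C|%:E)); last by rewrite ltry.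
apply/ess_supP; apply: filterS h => x /= h; rewrite lee_fin patchE.
case: ifPn => [|_]; last by rewrite normr0.
by rewrite inE => /h /le_trans; apply; exact: ler_norm.
Qed.

Lemma ess_bounded_Linfty (f : 'rV[R]_n -> R) : Linfty Om f -> ess_bounded Om f.
Proof.
by move=> [mf /Linfty_norm_lty_ae h]; split => //; exists (fine (Linfty_norm Om f)).
Qed.

(** The components being bounded, the norm is finite, so that [fine] does not
replace an infinite value by 0. *)
Lemma ae_enorm_bound (A : 'rV[R]_n -> 'rV[R]_n) :
  (forall i, Linfty Om (fun x => A x ord0 i)) ->
  \forall x \ae lebesgue_rV R n, Om x ->
    enorm (A x) <= fine (Linfty_norm Om (fun x => enorm (A x))).
Proof.
move=> LA.
pose C i := fine (Linfty_norm Om (fun x => A x ord0 i)).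
have hC : \forall x \ae lebesgue_rV R n, forall i, Om x -> `|A x ord0 i| <= C i.
  by apply: filter_forall => i; apply: Linfty_norm_lty_ae; case: (LA i).
have : (Linfty_norm Om (fun x => enorm (A x)) < +oo)%E.
  apply: (@ae_bound_Linfty_norm_lty _ (Num.sqrt (\sum_i C i ^+ 2))).
  apply: filterS hC => x hx Ox; rewrite ger0_norm ?sqrtr_ge0// ler_wsqrtr//.
  apply: ler_sum => i _; rewrite -expr2 -real_normK ?num_real//.
  by rewrite ler_pXn2r ?nnegrE// ?hx// (le_trans _ (hx i Ox)).
move=> /Linfty_norm_lty_ae; apply: filterS => x h /h.
by rewrite ger0_norm// sqrtr_ge0.
Qed.

End essential_bounds.

(** * Linear systems with a singular Gram matrix *)

(** The tau i may be dependent modulo the null vectors of b, so the Gram matrix may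
be singular.  A vector of its cokernel gives a combination u of the tau i with
b u u = 0, on which l vanishes; so the row of the values of l is in the row
space of the Gram matrix. *)
Lemma sesquilinear_representation {R : realType} (E : lmodType R[i]) (N : nat)
    (tau : 'I_N -> E) (b : E -> E -> R[i]) (l : E -> R[i]) :
  (forall c u v w, b (c *: u + v) w = c * b u w + b v w) ->
  (forall c u v w, b w (c *: u + v) = c^*%C * b w u + b w v) ->
  (forall c u v, l (c *: u + v) = c^*%C * l u + l v) ->
  (forall u, b u u = 0 -> l u = 0) ->
  exists x : 'I_N -> R[i], forall y : 'I_N -> R[i],
    b (\sum_i x i *: tau i) (\sum_j y j *: tau j) = l (\sum_j y j *: tau j).
Proof.
move=> bl br ll null.
have b0l w : b 0 w = 0.
  by have := bl (-1) 0 0 w; rewrite scaler0 addr0 mulN1r addNr.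
have b0r w : b w 0 = 0.
  by have := br (-1) 0 0 w; rewrite scaler0 addr0 rmorphN1 mulN1r addNr.
have l0 : l 0 = 0.
  by have := ll (-1) 0 0; rewrite scaler0 addr0 rmorphN1 mulN1r addNr.
have bsl (x : 'I_N -> R[i]) w : b (\sum_i x i *: tau i) w = \sum_i x i * b (tau i) w.
  apply: (big_ind2 (fun u c => b u w = c)) => // [u c v c' <- <-|i _].
    by rewrite -{1}[u]scale1r bl mul1r.
  by rewrite -[_ *: _]addr0 bl b0l addr0.
have bsr (x : 'I_N -> R[i]) w : b w (\sum_i x i *: tau i) = \sum_i (x i)^*%C * b w (tau i).
  apply: (big_ind2 (fun u c => b w u = c)) => // [u c v c' <- <-|i _].
    by rewrite -{1}[u]scale1r br rmorph1 mul1r.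
  by rewrite -[_ *: _]addr0 br b0r addr0.
have ls (x : 'I_N -> R[i]) : l (\sum_i x i *: tau i) = \sum_i (x i)^*%C * l (tau i).
  apply: (big_ind2 (fun u c => l u = c)) => // [u c v c' <- <-|i _].
    by rewrite -{1}[u]scale1r ll rmorph1 mul1r.
  by rewrite -[_ *: _]addr0 ll l0 addr0.
pose B : 'M[R[i]]_N := \matrix_(i, j) b (tau i) (tau j).
pose L : 'rV[R[i]]_N := \row_j l (tau j).
have : (L <= B)%MS.
  rewrite submxE; apply/eqP/rowP => k; rewrite [RHS]mxE.
  pose c i := cokermx B i k.
  have Bc i : \sum_j B i j * c j = 0.
    have h : (B *m cokermx B) i k = 0 by rewrite mulmx_coker mxE.
    by move: h; rewrite mxE.
  pose u := \sum_j (c j)^*%C *: tau j.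
  have bu : b u u = 0.
    rewrite {1}/u bsl big1// => i _; rewrite /u bsr.
    under eq_bigr do rewrite conjcK.
    rewrite (_ : \sum_j _ = 0) ?mulr0// -[RHS](Bc i).
    by apply: eq_bigr => j _; rewrite /B mxE mulrC.
  rewrite -[RHS](null u bu) /u ls mxE.
  by apply: eq_bigr => j _; rewrite conjcK /L mxE mulrC.
move=> /submxP[x Lx]; exists (fun i => x ord0 i) => y; rewrite bsr ls.
apply: eq_bigr => j _; rewrite bsl; congr (_ * _).
have <- : L ord0 j = l (tau j) by rewrite mxE.
by rewrite Lx mxE; apply: eq_bigr => i _; rewrite mxE.
Qed.

(** * Polynomials of bounded degree *)

Section polynomial_degrees.
Context {R : realType} (n : nat).
Implicit Types (p q : mpoly.mpoly n R[i]).

Lemma deg_leP k p : reflect (forall m, (k < mpoly.mdeg m)%N -> mpoly.mcoeff m p = 0) (deg_le k p).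
Proof.
apply: (iffP idP) => [kp m km|h].
  by apply: mpoly.memN_msupp_eq0; apply: mpoly.msize_mdeg_ge; exact: leq_trans kp km.
rewrite /deg_le mpoly.msizeE; apply/bigmax_leqP_seq => m mp _.
rewrite ltnS leqNgt; apply/negP => /h m0.
by move: mp; rewrite mpoly.mcoeff_msupp m0 eqxx.
Qed.

Lemma deg_leD k p q : deg_le k p -> deg_le k q -> deg_le k (p + q).
Proof.
move=> /deg_leP hp /deg_leP hq; apply/deg_leP => m km.
by rewrite mpoly.mcoeffD hp// hq// addr0.
Qed.

Lemma deg_leZ k c p : deg_le k p -> deg_le k (c *: p).
Proof.
by move=> /deg_leP hp; apply/deg_leP => m km; rewrite mpoly.mcoeffZ hp// mulr0.
Qed.

Lemma deg_le0 k : deg_le k (0 : mpoly.mpoly n R[i]).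
Proof. by apply/deg_leP => m _; rewrite mpoly.mcoeff0. Qed.

Lemma deg_le_sum k (I : Type) (s : seq I) (P : pred I) (F : I -> mpoly.mpoly n R[i]) :
  (forall i, P i -> deg_le k (F i)) -> deg_le k (\sum_(i <- s | P i) F i).
Proof.
move=> h; elim: s => [|i s IH]; first by rewrite big_nil deg_le0.
by rewrite big_cons; case: ifP => // /h hi; exact: deg_leD.
Qed.

Lemma deg_le_mderiv k p j : deg_le k.+1 p -> deg_le k (mpoly.mderiv j p).
Proof.
move=> /deg_leP hp; apply/deg_leP => m km.
by rewrite mpoly.mcoeff_deriv hp ?mul0rn// mpoly.mdegD mpoly.mdeg1 addn1.
Qed.

Lemma deg_leX k (m : mpoly.bmultinom n k.+1) : deg_le k (mpoly.mpolyX R[i] m).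
Proof. by rewrite /deg_le mpoly.msizeX; exact: mpoly.bmdeg. Qed.

End polynomial_degrees.

(** * Polynomials vanishing on an open set *)

(** The points of D where f is nonzero form an open set, which has positive measure
unless it is empty. *)
Lemma open_Rintegral_eq0 {R : realType} n (D : set 'rV[R]_n) (f : 'rV[R]_n -> R) :
  open D -> bounded_set D -> continuous f -> (forall x, 0 <= f x) ->
  \int[lebesgue_rV R n]_(x in D) f x = 0 -> forall x, D x -> f x = 0.
Proof.
move=> oD bD cf f0 If x Dx.
have mD := open_measurable_rV oD.
have intf := continuous_integrable_rV mD bD cf.
have : (\int[lebesgue_rV R n]_(x in D) (f x)%:E)%E = 0%E.
  by rewrite -[LHS]fineK; [rewrite -/(Rintegral _ _ _) If|exact: integrable_fin_num].
move=> I0.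
have : (\int[lebesgue_rV R n]_(x in D) `|(EFin \o f) x|)%E = 0%E.
  by rewrite -I0; apply: eq_integral => y _ /=; rewrite ger0_norm.
move=> /(ae_eq_integral_abs _ mD (measurable_int _ intf)) ae0.
apply: contrapT => fx0.
have oU : open (D `&` f @^-1` [set~ 0]).
  apply: openI => //; apply: open_comp => [y _|]; first exact: cf.
  by apply: closed_openC; exact: closed_eq.
have := open_lebesgue_rV_gt0 oU (conj Dx fx0); rewrite lt_neqAle => /andP[+ _] => /eqP; apply.
symmetry; apply/negligibleP; first exact: open_measurable_rV.
apply: negligibleS ae0 => y [Dy fy] /= h; apply: fy.
by have := h Dy => -[].
Qed.

Section vanishing_polynomials.
Context {R : realType} (n : nat).
Implicit Types (p : mpoly.mpoly n R[i]) (D : set 'rV[R]_n).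

Lemma polynomial_ccontinuous p : ccontinuous (peval p).
Proof. by case: (smooth_polynomial p). Qed.

Lemma polynomial_cgradient p :
  cgradient (peval p) (fun j => peval (mpoly.mderiv j p)).
Proof. by case: (smooth_polynomial p). Qed.

Lemma mderiv_vanish D p j : open D -> (forall x, D x -> peval p x = 0) ->
  forall x, D x -> peval (mpoly.mderiv j p) x = 0.
Proof.
move=> oD p0 x Dx; have [dr di] := polynomial_cgradient p j x 0.
have nb : \forall t \near (0 : R), D (x + t *: delta_mx ord0 j).
  apply: (@continuous_line R n x (delta_mx ord0 j) 0 D).
  by rewrite scale0r addr0; exact: open_nbhs_nbhs.
have der0 (g : R[i] -> R) d : g 0 = 0 ->
    is_derive (0 : R) (1 : R) (fun t : R => g (peval p (x + t *: delta_mx ord0 j))) d -> d = 0.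
  move=> g0 [_ <-]; transitivity ('D_(1 : R) (cst (0 : R)) (0 : R)).
    by apply: near_eq_derive; apply: filterS nb => t /p0 ->.
  exact: derive_cst.
have := der0 _ _ erefl dr; have := der0 _ _ erefl di.
by rewrite scale0r addr0; case: (peval _ x) => a b /= -> ->.
Qed.

Lemma closure_vanish D p : (forall x, D x -> peval p x = 0) ->
  forall x, closure D x -> peval p x = 0.
Proof.
move=> p0 x clx; have [cr ci] := polynomial_ccontinuous p.
have h (g : R[i] -> R) : g 0 = 0 -> continuous (fun x : 'rV[R]_n => g (peval p x)) -> g (peval p x) = 0.
  move=> g0 cg.
  have : closed ((fun x : 'rV[R]_n => g (peval p x)) @^-1` [set 0]).
    by apply: closed_comp => [y _|]; [exact: cg|exact: closed_eq].
  move=> cl; apply: (cl x); apply: closure_subset clx => y Dy /=.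
  by rewrite p0.
have := h _ erefl cr; have := h _ erefl ci.
by case: (peval p x) => a b /= -> ->.
Qed.

Lemma l2dot_polynomial_eq0 D p : open D -> bounded_set D ->
  complex.Re (l2dot D (peval p) (peval p)) = 0 -> forall x, D x -> peval p x = 0.
Proof.
move=> oD bD p0 x Dx.
have cp := polynomial_ccontinuous p.
have [cr _] := ccontinuousM cp (ccontinuous_conj cp).
have : complex.Re (peval p x * (peval p x)^*%C) = 0.
  apply: (open_Rintegral_eq0 oD bD cr _ p0 Dx) => y.
  by case: (peval p y) => a b /=; rewrite mulrN opprK addr_ge0// -expr2 sqr_ge0.
case: (peval p x) => a b /=; rewrite mulrN opprK => /eqP.
by rewrite -!expr2 paddr_eq0 ?sqr_ge0// !sqrf_eq0 => /andP[/eqP -> /eqP ->].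
Qed.

End vanishing_polynomials.

(** * Vector fields with one monomial component *)

Section monomial_fields.
Context {R : realType} (n k : nat).
Local Notation E := {ffun 'I_n.+1 -> mpoly.mpoly n.+1 R[i]}.
Local Notation J := ('I_n.+1 * mpoly.bmultinom n.+1 k.+1)%type.

(** The index is an ordinal, as for the generators of a Gram matrix. *)
Definition monomial_field (a : 'I_#|{: J}|) : E :=
  [ffun j => if j == (enum_val a).1 then
    mpoly.mpolyX R[i] (mpoly.bmnm (enum_val a).2) else 0].

Lemma monomial_field_span (sg : 'I_n.+1 -> mpoly.mpoly n.+1 R[i]) :
  (forall j, deg_le k (sg j)) ->
  exists c : 'I_#|{: J}| -> R[i], [ffun j => sg j] = \sum_a c a *: monomial_field a.
Proof.
move=> dsg.
pose F (j : 'I_n.+1) (p : J) : mpoly.mpoly n.+1 R[i] :=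
  mpoly.mcoeff (mpoly.bmnm p.2) (sg p.1) *:
  (if j == p.1 then mpoly.mpolyX R[i] (mpoly.bmnm p.2) else 0).
exists (fun a => mpoly.mcoeff (mpoly.bmnm (enum_val a).2) (sg (enum_val a).1)).
apply/ffunP => j; rewrite ffunE sum_ffunE.
transitivity (\sum_(p : J) F j p); last first.
  rewrite (big_enum_val (F j)); apply: eq_bigr => a _.
  by rewrite /F !ffunE.
rewrite -(pair_bigA _ (fun j' m => F j (j', m)))/= (bigD1 j)//= [X in _ + X]big1 ?addr0.
  rewrite {1}(mpoly.mpolywE (dsg j)); apply: eq_bigr => m _.
  by rewrite /F/= eqxx.
move=> j' jj'; apply: big1 => m _.
by rewrite /F/= eq_sym (negbTE jj') scaler0.
Qed.

End monomial_fields.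

(** * The covariant gradient *)

Lemma eq_sum_affine {K : pzRingType} (I : finType) (P : pred I) (c : K) (X Y Z : I -> K) :
  (forall i, P i -> X i = c * Y i + Z i) ->
  \sum_(i | P i) X i = c * (\sum_(i | P i) Y i) + \sum_(i | P i) Z i.
Proof. by move=> h; rewrite mulr_sumr -big_split/=; exact: eq_bigr. Qed.

Section covariant_gradient.
Context {R : realType} (n : nat) (Om : set 'rV[R]_n.+1) (M : mesh R n.+1).
Hypotheses (oOm : open Om) (tess : polytopal_tessellation Om M).
Variables (T : cell_ix M) (k : nat).
Hypothesis TOm : cell T `<=` Om.
Variable A : 'rV[R]_n.+1 -> 'rV[R]_n.+1.
Hypothesis LA : forall i, Linfty Om (fun x => A x ord0 i).

Let mT : measurable (cell T) := cell_measurable tess T.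
Let Too := cell_finite tess T.
Let bT := cell_bounded tess T.
Let oT : open (cell T) := cell_open tess T.

Lemma polynomial_cess_bounded (p : mpoly.mpoly n.+1 R[i]) : cess_bounded (cell T) (peval p).
Proof. exact: cess_bounded_continuous mT bT (polynomial_ccontinuous p). Qed.

Lemma fdom_measurable (F : face_ix M) : measurable (fdom F).
Proof. exact: closed_measurable_rV (fdom_closed tess F). Qed.

Lemma fdom_finite (F : face_ix M) : face_of T F -> (lebesgue_rV R n (fdom F) < +oo)%E.
Proof. by move=> FT; exact: bounded_lebesgue_rV_lty (fdom_measurable F) (fdom_bounded tess FT). Qed.

Lemma face_polynomial_cess_bounded (F : face_ix M) (p : mpoly.mpoly n R[i]) : face_of T F ->
  cess_bounded (fdom F) (peval p).
Proof.
move=> FT; apply: cess_bounded_continuous; [exact: fdom_measurable| |exact: polynomial_ccontinuous].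
exact (fdom_bounded tess FT).
Qed.

Lemma trace_cess_bounded (F : face_ix M) (p : mpoly.mpoly n.+1 R[i]) : face_of T F ->
  cess_bounded (fdom F) (peval p \o fchart F).
Proof.
move=> FT; apply: cess_bounded_continuous; [exact: fdom_measurable|exact (fdom_bounded tess FT)|].
have [cr ci] := polynomial_ccontinuous p; split => y.
  apply: (@continuous_comp _ _ _ (fchart F) (fun x => complex.Re (peval p x))); last exact: cr.
  exact: fchart_continuous.
apply: (@continuous_comp _ _ _ (fchart F) (fun x => complex.Im (peval p x))); last exact: ci.
exact: fchart_continuous.
Qed.

Lemma normal_trace_cess_bounded (F : face_ix M) (tau : 'I_n.+1 -> mpoly.mpoly n.+1 R[i]) : face_of T F ->
  cess_bounded (fdom F) (normal_trace T F tau).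
Proof.
move=> FT; apply: cess_bounded_sum => j _; apply: cess_boundedM.
  exact: trace_cess_bounded.
exact: cess_bounded_cst.
Qed.

(** The volume term, tested with v_T, in the equations of the covariant gradient. *)
Definition covariant_test (tau : 'I_n.+1 -> mpoly.mpoly n.+1 R[i]) (x : 'rV[R]_n.+1) : R[i] :=
  - 'i%C * peval (divergence tau) x - \sum_j (A x ord0 j)%:C * peval (tau j) x.

Lemma potential_cess_bounded j : cess_bounded (cell T) (fun x => (A x ord0 j)%:C).
Proof.
apply: cess_bounded_real; apply: ess_bounded_sub TOm _; first exact: open_measurable_rV.
exact: ess_bounded_Linfty.
Qed.

Lemma potential_dot_cess_bounded (tau : 'I_n.+1 -> mpoly.mpoly n.+1 R[i]) :
  cess_bounded (cell T) (fun x => \sum_j (A x ord0 j)%:C * peval (tau j) x).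
Proof.
apply: cess_bounded_sum => j _; apply: cess_boundedM; first exact: potential_cess_bounded.
exact: polynomial_cess_bounded.
Qed.

Lemma covariant_test_cess_bounded tau : cess_bounded (cell T) (covariant_test tau).
Proof.
apply: cess_boundedD.
  by apply: cess_boundedM; [exact: cess_bounded_cst|exact: polynomial_cess_bounded].
apply: (@eq_cess_bounded _ _ _ (fun x => (-1) * \sum_j (A x ord0 j)%:C * peval (tau j) x)).
  by move=> x; rewrite mulN1r.
by apply: cess_boundedM; [exact: cess_bounded_cst|exact: potential_dot_cess_bounded].
Qed.

(** The right-hand side of the equations of the covariant gradient. *)
Definition covariant_functional (v : local_dof M) tau : R[i] :=
  l2dot (cell T) (peval v.1) (covariant_test tau) -
  'i%C * \sum_(F | face_of T F) l2dot (fdom F) (peval (v.2 F)) (normal_trace T F tau).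

Local Notation E := {ffun 'I_n.+1 -> mpoly.mpoly n.+1 R[i]}.

Lemma covariant_testD c (u w : E) x :
  covariant_test (c *: u + w) x = c * covariant_test u x + covariant_test w x.
Proof.
have dE : divergence (c *: u + w) = c *: divergence u + divergence w.
  rewrite /divergence scaler_sumr -big_split/=; apply: eq_bigr => j _.
  by rewrite !ffunE mpoly.mderivD mpoly.mderivZ.
rewrite /covariant_test dE pevalD pevalZ.
have -> : \sum_j (A x ord0 j)%:C * peval ((c *: u + w) j) x =
    c * (\sum_j (A x ord0 j)%:C * peval (u j) x) + \sum_j (A x ord0 j)%:C * peval (w j) x.
  rewrite mulr_sumr -big_split/=; apply: eq_bigr => j _.
  by rewrite !ffunE pevalD pevalZ; ring.
have alg (i z a1 a2 b1 b2 : R[i]) :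
  i * (z * a1 + a2) - (z * b1 + b2) = z * (i * a1 - b1) + (i * a2 - b2) by ring.
exact: alg.
Qed.

Lemma normal_traceD (F : face_ix M) c (u w : E) y :
  normal_trace T F (c *: u + w) y = c * normal_trace T F u y + normal_trace T F w y.
Proof.
rewrite /normal_trace mulr_sumr -big_split/=; apply: eq_bigr => j _.
by rewrite !ffunE pevalD pevalZ; ring.
Qed.

Lemma covariant_functionalD v c (u w : E) :
  covariant_functional v (c *: u + w) =
  c^*%C * covariant_functional v u + covariant_functional v w.
Proof.
have pb := polynomial_cess_bounded v.1.
have hu := covariant_test_cess_bounded u; have hw := covariant_test_cess_bounded w.
have E1 : l2dot (cell T) (peval v.1) (covariant_test (c *: u + w)) =
    c^*%C * l2dot (cell T) (peval v.1) (covariant_test u) +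
    l2dot (cell T) (peval v.1) (covariant_test w).
  rewrite -(l2dotZr mT Too c hu pb) -(l2dotDr mT Too _ hw pb); last first.
    by apply: cess_boundedM => //; exact: cess_bounded_cst.
  by congr (l2dot _ _ _); apply/funext => x; exact: covariant_testD.
have E2 F : face_of T F ->
    l2dot (fdom F) (peval (v.2 F)) (normal_trace T F (c *: u + w)) =
    c^*%C * l2dot (fdom F) (peval (v.2 F)) (normal_trace T F u) +
    l2dot (fdom F) (peval (v.2 F)) (normal_trace T F w).
  move=> FT; have fb := face_polynomial_cess_bounded (v.2 F) FT.
  have fu := normal_trace_cess_bounded u FT; have fw := normal_trace_cess_bounded w FT.
  have mF := fdom_measurable F; have Foo := fdom_finite FT.
  rewrite -(l2dotZr mF Foo c fu fb) -(l2dotDr mF Foo _ fw fb); last first.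
    by apply: cess_boundedM => //; exact: cess_bounded_cst.
  by congr (l2dot _ _ _); apply/funext => x; exact: normal_traceD.
have E3 := eq_sum_affine E2.
have alg (i z a1 a2 b1 b2 : R[i]) :
  z * a1 + a2 - i * (z * b1 + b2) = z * (a1 - i * b1) + (a2 - i * b2) by ring.
by rewrite /covariant_functional -alg -E1 -E3.
Qed.

(** A polynomial field with zero norm vanishes on the open set T, and so does its
divergence; by continuity its traces on the faces vanish too. *)
Lemma covariant_functional_null v (u : E) :
  \sum_j l2dot (cell T) (peval (u j)) (peval (u j)) = 0 -> covariant_functional v u = 0.
Proof.
move=> u0.
have uj0 j x : cell T x -> peval (u j) x = 0.
  apply: l2dot_polynomial_eq0 => //.
  have pos i : 0 <= complex.Re (l2dot (cell T) (peval (u i)) (peval (u i))).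
    exact: l2normsq_ge0.
  have := congr1 (@complex.Re R) u0; rewrite Re_sum => /eqP.
  by rewrite psumr_eq0// => /allP/(_ j); rewrite mem_index_enum => /(_ isT)/eqP.
have dot0 m (D : set 'rV[R]_m) f g : (forall x, D x -> g x = 0) -> l2dot D f g = 0.
  move=> g0; rewrite l2dotE (@eq_cint _ _ D _ (fun=> 0)).
    by apply/eqP; rewrite eq_complex /= /Rintegral integral0 eqxx.
  by move=> x Dx; rewrite g0// conjc0 mulr0.
rewrite /covariant_functional dot0 ?big1 ?mulr0 ?subr0//.
- move=> F FT; apply: dot0 => y Fy; apply: big1 => j _.
  have clF := face_in_closure FT Fy.
  by rewrite (closure_vanish (uj0 j) clF) mul0r.
- move=> x Tx; rewrite /covariant_test big1 ?subr0; last by move=> j _; rewrite uj0 ?mulr0.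
  rewrite /divergence peval_sum big1 ?mulr0// => j _.
  by rewrite (mderiv_vanish j oT (uj0 j)).
Qed.

(** The equations are linear in the coefficients of the unknown field and of the
test field on the monomial fields, so [sesquilinear_representation] solves
them; the selected value is then a solution. *)
Lemma cov_gradientP v :
  (forall j, deg_le k (cov_gradient k T A v j)) /\
  forall tau, (forall j, deg_le k (tau j)) ->
  \sum_j l2dot (cell T) (peval (cov_gradient k T A v j)) (peval (tau j)) =
  covariant_functional v tau.
Proof.
rewrite /cov_gradient; set Gs := (X in xget _ X).
suff : exists G, Gs G by move=> /(xgetPex [ffun=> 0]).
pose b (u w : E) := \sum_j l2dot (cell T) (peval (u j)) (peval (w j)).
have bl c u w z : b (c *: u + w) z = c * b u z + b w z.
  rewrite /b mulr_sumr -big_split/=; apply: eq_bigr => j _.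
  have hz := polynomial_cess_bounded (z j).
  have hu := polynomial_cess_bounded (u j); have hw := polynomial_cess_bounded (w j).
  rewrite -(l2dotZl mT Too c hu hz) -(l2dotDl mT Too _ hw hz); last first.
    by apply: cess_boundedM => //; exact: cess_bounded_cst.
  by congr (l2dot _ _ _); apply/funext => x; rewrite !ffunE pevalD pevalZ.
have br c u w z : b z (c *: u + w) = c^*%C * b z u + b z w.
  rewrite /b mulr_sumr -big_split/=; apply: eq_bigr => j _.
  have hz := polynomial_cess_bounded (z j).
  have hu := polynomial_cess_bounded (u j); have hw := polynomial_cess_bounded (w j).
  rewrite -(l2dotZr mT Too c hu hz) -(l2dotDr mT Too _ hw hz); last first.
    by apply: cess_boundedM => //; exact: cess_bounded_cst.
  by congr (l2dot _ _ _); apply/funext => x; rewrite !ffunE pevalD pevalZ.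
have [x hx] := sesquilinear_representation (@monomial_field R n k) bl br (covariant_functionalD v)
  (fun u => @covariant_functional_null v u).
exists (\sum_a x a *: monomial_field a); split => [j|sg dsg].
  rewrite sum_ffunE; apply: deg_le_sum => a _; rewrite !ffunE; apply: deg_leZ.
  by case: ifP => _; [exact: deg_leX|exact: deg_le0].
have -> : sg = [ffun j => sg j] :> ('I_n.+1 -> _) by apply/funext => j; rewrite ffunE.
have [c ->] := monomial_field_span dsg.
exact: hx.
Qed.

End covariant_gradient.

(** * The local estimate *)

Lemma ae_Rintegral_ge0 {R : realType} n (D : set 'rV[R]_n) (h : 'rV[R]_n -> R) :
  measurable D -> measurable_fun D h ->
  (\forall x \ae lebesgue_rV R n, D x -> 0 <= h x) ->
  0 <= \int[lebesgue_rV R n]_(x in D) h x.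
Proof.
move=> mD mh h0.
have -> : \int[lebesgue_rV R n]_(x in D) h x = \int[lebesgue_rV R n]_(x in D) `|h x|.
  congr fine; apply: ae_eq_integral => //; first exact/measurable_EFinP.
    by apply/measurable_EFinP; exact: measurableT_comp.
  by apply: filterS h0 => x h0 Dx; rewrite ger0_norm ?h0.
exact: Rintegral_ge0.
Qed.

Section weighted_inequalities.
Context {R : realType} (n : nat) (D : set 'rV[R]_n).
Hypotheses (mD : measurable D) (Doo : (lebesgue_rV R n D < +oo)%E).

Lemma weighted_mass_le (f : 'rV[R]_n -> R) u (c : R) :
  ess_bounded D f -> cess_bounded D u ->
  (\forall x \ae lebesgue_rV R n, D x -> f x <= c) ->
  complex.Re (l2dot D (fun x => (f x)%:C * u x) u) <= c * l2normsq D u.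
Proof.
move=> fb ub fc; have cb := cess_bounded_cst D c%:C.
have fub := cess_boundedM (cess_bounded_real fb) ub.
have uu : ess_bounded D (fun x => complex.Re (u x * (u x)^*%C)).
  by have [] := cess_boundedM ub (cess_bounded_conj ub).
have fuu : ess_bounded D (fun x => complex.Re ((f x)%:C * u x * (u x)^*%C)).
  by have [] := cess_boundedM fub (cess_bounded_conj ub).
have cuu : ess_bounded D (fun x => c * complex.Re (u x * (u x)^*%C)).
  by apply: ess_boundedM => //; exact: ess_bounded_cst.
have /ae_Rintegral_ge0 : measurable_fun D (fun x => c * complex.Re (u x * (u x)^*%C) -
    complex.Re ((f x)%:C * u x * (u x)^*%C)).
  by apply: measurable_funB; [case: cuu|case: fuu].
rewrite RintegralB//; try exact: ess_bounded_integrable.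
rewrite RintegralZl//; last exact: ess_bounded_integrable.
rewrite subr_ge0; apply => //; apply: filterS fc => x fc Dx.
case: (u x) => a b /=.
rewrite [X in 0 <= X](_ : _ = (c - f x) * (a ^+ 2 + b ^+ 2)); last by ring.
by apply: mulr_ge0; [rewrite subr_ge0 fc|rewrite addr_ge0 ?sqr_ge0].
Qed.

(** With h = g + a u, the left-hand side is at most (|h|^2 + |p|^2) / 2, and
|h|^2 <= 2 |g|^2 + 2 a^2 |u|^2. *)
Lemma covariant_young (a : 'rV[R]_n -> R) g u p :
  ess_bounded D a -> cess_bounded D g -> cess_bounded D u -> cess_bounded D p ->
  complex.Re ('i%C * l2dot D (fun x => g x + (a x)%:C * u x) p) <=
  l2normsq D g + complex.Re (l2dot D (fun x => (a x ^+ 2)%:C * u x) u) +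
  2^-1 * l2normsq D p.
Proof.
move=> ab gb ub pb.
have a2b : ess_bounded D (fun x => a x ^+ 2) by exact: ess_boundedM.
have pc := cess_bounded_conj pb; have cR := cess_bounded_real.
have [h1 h2] := cess_boundedM (cess_boundedD gb (cess_boundedM (cR _ _ _ _ ab) ub)) pc.
have [gg _] := cess_boundedM gb (cess_bounded_conj gb).
have [uu _] := cess_boundedM (cess_boundedM (cR _ _ _ _ a2b) ub) (cess_bounded_conj ub).
have [pp _] := cess_boundedM pb pc.
have ppZ := ess_boundedM (ess_bounded_cst D 2^-1) pp.
have int h : ess_bounded D h -> (lebesgue_rV R n).-integrable D (EFin \o h).
  exact: ess_bounded_integrable.
rewrite /l2normsq /l2dot/= !mul0r sub0r mul1r -RintegralZl//; last exact: int.
rewrite -!RintegralD//; try (by apply: int => //; exact: ess_boundedD).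
rewrite -mulN1r -RintegralZl//; last exact: int.
apply: le_Rintegral => //.
- by apply: int; apply: ess_boundedM => //; exact: ess_bounded_cst.
- by apply: int; apply: ess_boundedD => //; exact: ess_boundedD.
move=> x _; case: (g x) (u x) (p x) => g1 g2 [u1 u2] [p1 p2] /=.
set b := a x; rewrite -subr_ge0.
pose h1' := g1 + b * u1; pose h2' := g2 + b * u2.
(* The squares are those of |p - i h| and |g - a u|. *)
rewrite (_ : _ - _ = 2^-1 * ((h1' - p2) ^+ 2 + (h2' + p1) ^+ 2 +
  (g1 - b * u1) ^+ 2 + (g2 - b * u2) ^+ 2)); last by rewrite /h1' /h2'; field.
by rewrite mulr_ge0 ?invr_ge0// !addr_ge0 ?sqr_ge0.
Qed.

End weighted_inequalities.

Lemma absorb_half {R : realFieldType} (I : finType) (f1 f2 f3 : I -> R) (N W : R) :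
  N = \sum_j f3 j -> N <= \sum_j (f1 j + f2 j + 2^-1 * f3 j) -> \sum_j f2 j <= W ->
  2^-1 * N <= \sum_j f1 j + W.
Proof.
move=> NE; rewrite !big_split/= -mulr_sumr -NE.
by set S1 := \sum_j _; set S2 := \sum_j _ => h1 h2; lra.
Qed.

Lemma combine_bounds {R : realType} (eta N p c c' m : R) (g s q : R[i]) :
  complex.Im g = 0 -> 0 <= s -> complex.Im q = 0 ->
  2^-1 * p <= complex.Re g + c * m -> - complex.Re q <= c' * m ->
  eta^-1 * N <= p + complex.Re s ->
  ((2 * eta)^-1 * N - (c + c') * m)%:C <= g + s + q.
Proof.
case: g s q => [g g'] [s s'] [q q'] /= -> + ->; rewrite !lecE/= => /andP[/eqP -> s0] h1 h2 h3.
by rewrite !addr0 eqxx invfM mulrDl -mulrA; lra.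
Qed.

Section local_estimate.
Context {R : realType} (n : nat) (Om : set 'rV[R]_n.+1) (M : mesh R n.+1).
Hypotheses (oOm : open Om) (tess : polytopal_tessellation Om M).
Variables (T : cell_ix M) (k : nat).
Hypothesis TOm : cell T `<=` Om.
Variable A : 'rV[R]_n.+1 -> 'rV[R]_n.+1.
Hypothesis LA : forall i, Linfty Om (fun x => A x ord0 i).
Variable v : local_dof M.

Let mT : measurable (cell T) := cell_measurable tess T.
Let Too := cell_finite tess T.
Let p := potential k T v.
Let P j := mpoly.mderiv j p.
Let G := cov_gradient k T A v.
Let pcb q : cess_bounded (cell T) (peval q) := polynomial_cess_bounded tess T q.

(** Green's formula for v_T and each component of grad p. *)
Lemma green_potential :
  graddot T v.1 p + l2dot (cell T) (peval v.1) (peval (divergence P)) =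
  \sum_(F | face_of T F) l2dot (fdom F) (peval v.1 \o fchart F) (normal_trace T F P).
Proof.
have -> : l2dot (cell T) (peval v.1) (peval (divergence P)) =
    \sum_j l2dot (cell T) (peval v.1) (peval (mpoly.mderiv j (P j))).
  rewrite -(l2dot_sumr mT Too) //.
  by congr (l2dot _ _ _); apply/funext => x; rewrite /divergence peval_sum.
rewrite /graddot -big_split/=.
under eq_bigr => j _ do rewrite (cell_green tess T (polynomial_ccontinuous v.1)
  (polynomial_ccontinuous (P j)) (polynomial_ccontinuous _) (polynomial_ccontinuous _)
  (polynomial_cgradient v.1) (polynomial_cgradient (P j))).
rewrite exchange_big/=; apply: eq_bigr => F FT.
have vb := trace_cess_bounded tess v.1 FT.
have Pb j := trace_cess_bounded tess (P j) FT.
have mF := fdom_measurable tess F; have Foo := fdom_finite tess FT.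
rewrite /normal_trace (l2dot_sumr mF Foo) //; last first.
  by move=> j _; apply: cess_boundedM; [exact: Pb|exact: cess_bounded_cst].
apply: eq_bigr => j _.
have -> : (fun y => peval (P j) (fchart F y) * (fnormal T F ord0 j)%:C) =
    (fun y => (fnormal T F ord0 j)%:C * (peval (P j) \o fchart F) y).
  by apply/funext => y; rewrite mulrC.
by rewrite (l2dotZr mF Foo _ (Pb j) vb) conjc_real.
Qed.

(** With S the sum of the face terms in v_F and D = (v_T, div grad p)_T, Green's
formula turns the relation defining p into |grad p|^2 = S - D, while the
equations of G tested with grad p read
(G, grad p)_T = i D - (A v_T, grad p)_T - i S. *)
Lemma gradient_identity :
  (graddot T p p = graddot T v.1 p +
    \sum_(F | face_of T F) l2dot (fdom F) (jump F v) (normal_trace T F P)) ->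
  deg_le k.+1 p ->
  graddot T p p = 'i%C * \sum_j
    l2dot (cell T) (fun x => peval (G j) x + (A x ord0 j)%:C * peval v.1 x) (peval (P j)).
Proof.
move=> hp dp.
have [_ /(_ P (fun j => deg_le_mderiv j dp))] := cov_gradientP oOm tess k TOm LA v.
rewrite -/G => hG.
have Ab j := potential_cess_bounded oOm TOm LA j.
have jumpE F : face_of T F -> l2dot (fdom F) (jump F v) (normal_trace T F P) =
    l2dot (fdom F) (peval (v.2 F)) (normal_trace T F P) -
    l2dot (fdom F) (peval v.1 \o fchart F) (normal_trace T F P).
  move=> FT; have nb := normal_trace_cess_bounded tess P FT.
  have fb := face_polynomial_cess_bounded tess (v.2 F) FT.
  have vb := trace_cess_bounded tess v.1 FT.
  have mF := fdom_measurable tess F; have Foo := fdom_finite tess FT.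
  rewrite -[- l2dot _ _ _]mulN1r -(l2dotZl mF Foo _ vb nb) -(l2dotDl mF Foo fb _ nb); last first.
    by apply: cess_boundedM => //; exact: cess_bounded_cst.
  by congr (l2dot _ _ _); apply/funext => y; rewrite /jump (mulN1r (peval v.1 (fchart F y))).
have E1 : graddot T p p =
    (\sum_(F | face_of T F) l2dot (fdom F) (peval (v.2 F)) (normal_trace T F P)) -
    l2dot (cell T) (peval v.1) (peval (divergence P)).
  rewrite hp (eq_bigr _ jumpE) sumrB -green_potential; ring.
have E2 : l2dot (cell T) (peval v.1) (covariant_test A P) =
    'i%C * l2dot (cell T) (peval v.1) (peval (divergence P)) -
    \sum_j l2dot (cell T) (fun x => (A x ord0 j)%:C * peval v.1 x) (peval (P j)).
  have Apb := potential_dot_cess_bounded oOm tess TOm LA P.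
  have -> : covariant_test A P = (fun x => (- 'i%C) * peval (divergence P) x +
      (-1) * \sum_j (A x ord0 j)%:C * peval (P j) x).
    by apply/funext => x; rewrite mulN1r.
  have E4 : l2dot (cell T) (peval v.1) (fun x => \sum_j (A x ord0 j)%:C * peval (P j) x) =
      \sum_j l2dot (cell T) (peval v.1) (fun x => (A x ord0 j)%:C * peval (P j) x).
    by apply: (l2dot_sumr mT Too) => // j _; apply: cess_boundedM; [exact: Ab|exact: pcb].
  have Db : cess_bounded (cell T) (fun x => - 'i%C * peval (divergence P) x).
    by apply: cess_boundedM; [exact: cess_bounded_cst|exact: pcb].
  have mApb : cess_bounded (cell T) (fun x => -1 * \sum_j (A x ord0 j)%:C * peval (P j) x).
    by apply: cess_boundedM; [exact: cess_bounded_cst|exact: Apb].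
  rewrite (l2dotDr mT Too Db mApb (pcb _)).
  rewrite (l2dotZr mT Too (- 'i%C) (pcb (divergence P)) (pcb v.1)).
  rewrite (l2dotZr mT Too (-1) Apb (pcb v.1)) E4 rmorphN1 mulN1r.
  congr (_ * _ - _); first by apply/eqP; rewrite eq_complex /= oppr0 opprK !eqxx.
  apply: eq_bigr => j _; rewrite !l2dotE; apply: eq_cint => x _.
  have cM (a : R) (b : R[i]) : (a%:C * b)^*%C = a%:C * b^*%C.
    by rewrite (rmorphM (@conjc R)); congr (_ * _); exact: conjc_real.
  by rewrite cM mulrCA mulrA.
have E3 : \sum_j l2dot (cell T) (fun x => peval (G j) x + (A x ord0 j)%:C * peval v.1 x) (peval (P j)) =
  (\sum_j l2dot (cell T) (peval (G j)) (peval (P j))) +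
  \sum_j l2dot (cell T) (fun x => (A x ord0 j)%:C * peval v.1 x) (peval (P j)).
  rewrite -big_split/=; apply: eq_bigr => j _.
  by rewrite (l2dotDl mT Too)//; apply: cess_boundedM.
rewrite E3 hG /covariant_functional E2 E1.
set S := \sum_(F | _) _; set D := l2dot _ _ (peval (divergence P)); set W := \sum_j _.
rewrite (_ : _ - W - _ + W = 'i%C * (D - S)); last by ring.
by rewrite mulrA -expr2 sqr_i; ring.
Qed.

(** Each component of [gradient_identity] is bounded by [covariant_young]; half of
the gradient is absorbed on the left, and the squares of the components of A
add up to at most C^2. *)
Lemma gradnormsq_potential_le (C : R) :
  (\forall x \ae lebesgue_rV R n.+1, Om x -> enorm (A x) <= C) ->
  2^-1 * gradnormsq T p <= \sum_j l2normsq (cell T) (peval (G j)) +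
    C ^+ 2 * l2normsq (cell T) (peval v.1).
Proof.
move=> AC.
have rhs0 : 0 <= \sum_j l2normsq (cell T) (peval (G j)) +
    C ^+ 2 * l2normsq (cell T) (peval v.1).
  apply: addr_ge0; first by apply: sumr_ge0 => j _; exact: l2normsq_ge0.
  by apply: mulr_ge0; [exact: sqr_ge0|exact: l2normsq_ge0].
(* If the relations defining p have no solution, p is 0. *)
have [[q pq]|np] := pselect (exists q : mpoly.mpoly n.+1 R[i], [/\ deg_le k.+1 q,
    forall w, deg_le k.+1 w -> graddot T q w = graddot T v.1 w +
      \sum_(F | face_of T F) l2dot (fdom F) (jump F v)
          (normal_trace T F (fun j => mpoly.mderiv j w)) &
    l2dot (cell T) (fun x => peval q x - peval v.1 x) (fun=> 1) = 0]); last first.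
  have -> : gradnormsq T p = 0; last by rewrite mulr0.
  rewrite /gradnormsq big1// => j _.
  have -> : peval (mpoly.mderiv j p) = fun=> 0.
    apply/funext => x; rewrite /p /potential xgetPN; last by move=> q hq; apply: np; exists q.
    by rewrite raddf0 /peval raddf0.
  by rewrite /l2normsq /l2dot/= oppr0 mulr0 subr0 Rintegral_cst// mul0r.
have [dp /(_ p) hp _] : [set q : mpoly.mpoly n.+1 R[i] | [/\ deg_le k.+1 q,
    forall w, deg_le k.+1 w -> graddot T q w = graddot T v.1 w +
      \sum_(F | face_of T F) l2dot (fdom F) (jump F v)
          (normal_trace T F (fun j => mpoly.mderiv j w)) &
    l2dot (cell T) (fun x => peval q x - peval v.1 x) (fun=> 1) = 0]] p.
  exact: (xgetPex 0 (ex_intro _ q pq)).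
have Ab j : ess_bounded (cell T) (fun x => A x ord0 j).
  by have [] := potential_cess_bounded oOm TOm LA j.
have A2b j : ess_bounded (cell T) (fun x => A x ord0 j ^+ 2).
  exact: ess_boundedM.
have Apt : gradnormsq T p <= \sum_j (l2normsq (cell T) (peval (G j)) +
    complex.Re (l2dot (cell T) (fun x => (A x ord0 j ^+ 2)%:C * peval v.1 x) (peval v.1)) +
    2^-1 * l2normsq (cell T) (peval (P j))).
  have -> : gradnormsq T p = complex.Re (graddot T p p) by rewrite /graddot Re_sum.
  rewrite (gradient_identity (hp dp) dp) mulr_sumr Re_sum; apply: ler_sum => j _.
  exact: covariant_young mT Too _ _ _ _ (Ab j) (pcb _) (pcb _) (pcb _).
have Sb : ess_bounded (cell T) (fun x => \sum_j A x ord0 j ^+ 2).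
  have [] : cess_bounded (cell T) (fun x => \sum_j (A x ord0 j ^+ 2)%:C).
    by apply: cess_bounded_sum => j _; exact: cess_bounded_real.
  by under eq_fun do rewrite Re_sum.
have Asum : \sum_j complex.Re (l2dot (cell T)
      (fun x => (A x ord0 j ^+ 2)%:C * peval v.1 x) (peval v.1)) <=
    C ^+ 2 * l2normsq (cell T) (peval v.1).
  have AC2 : \forall x \ae lebesgue_rV R n.+1, cell T x -> \sum_j A x ord0 j ^+ 2 <= C ^+ 2.
    apply: filterS AC => x h /TOm /h {}h.
    rewrite (eq_bigr (fun j => A x ord0 j * A x ord0 j)); last by move=> j _; rewrite expr2.
    have s0 : 0 <= dotv (A x) (A x) by apply: sumr_ge0 => j _; rewrite -expr2 sqr_ge0.
    have C0 : 0 <= C by apply: le_trans h; exact: sqrtr_ge0.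
    by rewrite -[X in X <= _](sqr_sqrtr s0) ler_pXn2r ?nnegrE ?sqrtr_ge0.
  apply: le_trans (weighted_mass_le mT Too Sb (pcb v.1) AC2).
  rewrite -Re_sum le_eqVlt; apply/orP; left; apply/eqP; congr complex.Re.
  under eq_bigr do rewrite l2dotE.
  rewrite -(cint_sum mT Too); last first.
    move=> j _; apply: cess_boundedM; last exact: cess_bounded_conj.
    by apply: cess_boundedM => //; exact: cess_bounded_real.
  rewrite l2dotE; apply: eq_cint => x _.
  rewrite -mulr_suml -mulr_suml; congr (_ * _ * _).
  by rewrite (rmorph_sum (real_complex R)).
exact: absorb_half (erefl _) Apt Asum.
Qed.

(** Half of the lower bound in the equivalence satisfied by s is controlled by
[gradnormsq_potential_le] and by s itself, which is nonnegative. *)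
Lemma local_lower_bound (eta C C' : R) (V : 'rV[R]_n.+1 -> R)
    (s : local_dof M -> local_dof M -> R[i]) :
  (\forall x \ae lebesgue_rV R n.+1, Om x -> enorm (A x) <= C) ->
  ess_bounded Om V -> (\forall x \ae lebesgue_rV R n.+1, Om x -> `|V x| <= C') ->
  hho_stabilization k eta T s -> UT k T v ->
  (((2 * eta)^-1 * norm1Tsq T v - (C ^+ 2 + C') * l2normsq (cell T) (peval v.1))%:C <=
  \sum_j l2dot (cell T) (peval (G j)) (peval (G j)) + s v v +
  l2dot (cell T) (fun x => (V x)%:C * peval v.1 x) (peval v.1)).
Proof.
move=> AC Vb VC' stab Uv.
have VbT : ess_bounded (cell T) V by apply: ess_bounded_sub Vb => //; exact: open_measurable_rV.
have s0 := stab_psd stab Uv; have [sE _] := stab_equiv stab Uv.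
have hG := gradnormsq_potential_le AC.
have hV : - complex.Re (l2dot (cell T) (fun x => (V x)%:C * peval v.1 x) (peval v.1)) <=
    C' * l2normsq (cell T) (peval v.1).
  have NVb := ess_boundedN VbT.
  have NVC : \forall x \ae lebesgue_rV R n.+1, cell T x -> - V x <= C'.
    by apply: filterS VC' => x h /TOm /h; apply: le_trans; rewrite -normrN ler_norm.
  apply: le_trans (weighted_mass_le mT Too NVb (pcb v.1) NVC).
  have -> : (fun x => (- V x)%:C * peval v.1 x) = (fun x => -1 * ((V x)%:C * peval v.1 x)).
    by apply/funext => x; rewrite mulrA; congr (_ * _); rewrite mulN1r rmorphN.
  rewrite (l2dotZl mT Too); last exact: pcb; last first.
    by apply: cess_boundedM => //; exact: cess_bounded_real.
  by rewrite mulN1r raddfN.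
have ImV : complex.Im (l2dot (cell T) (fun x => (V x)%:C * peval v.1 x) (peval v.1)) = 0.
  rewrite /l2dot/=; under eq_Rintegral => x _.
    rewrite (_ : complex.Im _ = 0); last by case: (peval v.1 x) => a b /=; ring.
    over.
  by rewrite Rintegral_cst// mul0r.
have ImG : complex.Im (\sum_j l2dot (cell T) (peval (G j)) (peval (G j))) = 0.
  by rewrite Im_sum; apply: big1 => j _; exact: (Im_l2dot_self mT (peval (G j))).
by apply: combine_bounds ImG s0 ImV _ hV sE; rewrite Re_sum.
Qed.

End local_estimate.

(** * The global estimate *)

Lemma restrict_dof_UT {R : realType} (d k : nat) (Om : set 'rV[R]_d.+1)
    (M : mesh R d.+1) (T : cell_ix M) (v : global_dof M) :
  Uh k Om v -> UT k T (restrict_dof T v).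
Proof.
move=> [vT vF _]; split => /=; first exact: vT.
  by move=> F; rewrite ffunE; case: ifP => // _; exact: deg_le0.
by move=> F nFT; rewrite ffunE (negbTE nFT).
Qed.

(** The constants of [local_lower_bound] are the same on all cells. *)
Lemma discrete_garding {R : realType} (n k : nat) (Om : set 'rV[R]_n.+1)
    (M : mesh R n.+1) (eta : R) (s : cell_ix M -> local_dof M -> local_dof M -> R[i])
    (A : 'rV[R]_n.+1 -> 'rV[R]_n.+1) (V : 'rV[R]_n.+1 -> R) (v : global_dof M) :
  lipschitz_domain Om -> polytopal_tessellation Om M ->
  (forall T, hho_stabilization k eta T (s T)) ->
  (forall i, Linfty Om (fun x => A x ord0 i)) -> Linfty Om V -> Uh k Om v ->
  ((2 * eta)^-1 * norm1hsq v -
    (fine (Linfty_norm Om (fun x => enorm (A x))) ^+ 2 + fine (Linfty_norm Om V)) *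
      l2hsq v)%:C <= a_h k s V v v A.
Proof.
move=> lipOm tess hs LA LV Uv; have [oOm _ _ _ _] := lipOm.
have AC := ae_enorm_bound LA; have VC := Linfty_norm_lty_ae LV.2.
have Vb := ess_bounded_Linfty LV.
move: (fine _) AC (fine _) VC => C AC C' VC.
have -> : (2 * eta)^-1 * norm1hsq v - (C ^+ 2 + C') * l2hsq v =
    \sum_T ((2 * eta)^-1 * norm1Tsq T (restrict_dof T v) -
      (C ^+ 2 + C') * l2normsq (cell T) (peval (restrict_dof T v).1)).
  by rewrite sumrB -!mulr_sumr.
rewrite (rmorph_sum (real_complex R)); apply: ler_sum => T _.
exact: (local_lower_bound oOm tess (cell_in_domain lipOm tess (T:=T)) LA AC Vb VC (hs T)
  (restrict_dof_UT T Uv)).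
Qed.

(* The order of R[i] makes the inequality say that a_h(v, v; A) is real and
   bounded below by the right-hand side. *)
Theorem theorem3p8 (R : realType) (d : nat) (d23 : d = 2%N \/ d = 3%N)
    (Om : set 'rV[R]_d) (lipOm : lipschitz_domain Om)
    (H : set R) (M : R -> mesh R d) (admM : admissible_mesh_sequence Om H M)
    (k : nat)
    (s : forall h, cell_ix (M h) -> local_dof (M h) -> local_dof (M h) -> R[i])
    (stab : exists2 eta : R, 0 < eta &
       forall h, H h -> forall T, hho_stabilization k eta T (s h T))
    (A : 'rV[R]_d -> 'rV[R]_d)
    (A_W1infty : forall i, W1infty Om (fun x => A x ord0 i))
    (V : 'rV[R]_d -> R) (V_Linfty : Linfty Om V) :
  exists alpha gamma : R, [/\ 0 < alpha, 0 < gamma &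
    forall h, H h -> forall v : global_dof (M h), Uh k Om v ->
      (alpha * norm1hsq v -
       gamma * (fine (Linfty_norm Om (fun x => enorm (A x))) ^+ 2 +
                fine (Linfty_norm Om V)) * l2hsq v)%:C
      <= a_h k (s h) V v v A].
Proof.
have [eta eta0 hs] := stab.
exists (2 * eta)^-1, 1; split => //; first by rewrite invr_gt0 mulr_gt0.
move=> h Hh v Uv; rewrite mul1r.
have [_ _ _ /(_ h Hh)[tess _] _] := admM.
have LA i := (A_W1infty i).1.
by case: d23 => dE; subst d; exact: (discrete_garding lipOm tess (hs h Hh) LA V_Linfty Uv).
Qed.
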